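(* Let $d\ge1$, $T>0$. Let $H:\mathbb R^{2d}\to\mathbb R^d$ be locally Lipschitz with $|H(z)|\le C(1+|z|)$ for all $z\in\mathbb R^{2d}$. Let $L:\mathbb R^{2d}\times\mathcal P_1(\mathbb R^{2d})\to[0,+\infty)$ be continuous in $(x,v)\in\mathbb R^{2d}$ and such that whenever $(\mu_j)_j\subset\mathcal P_1(\mathbb R^{2d})$ converges narrowly to $\mu\in\mathcal P_1(\mathbb R^{2d})$, then $L(x,v,\mu_j)\to L(x,v,\mu)$ uniformly with respect to $(x,v)$ on compact subsets of $\mathbb R^{2d}$. Let $\psi:\mathbb R^d\to[0,+\infty)$ be convex and let $C_\psi\ge0$, $1\le q<+\infty$ be such that $\operatorname{Lip}(\psi,B(0,R))\le C_\psi R^{q-1}$ for all $R>0$. Let $\ell\in L^q(0,T)$, let $\mu^0\in\mathcal P_1(\mathbb R^{2d})$ have compact support, and let $f\in\mathcal F_\ell$ (see context, with $n=2d$). Let $\mu_N^0=\frac1N\sum_{i=1}^N\delta_{((x_N^0)_i,(v_N^0)_i)}$, $N\in\mathbb N$, be a sequence of atomic empirical measures such that $\lim_{N\to\infty}\mathcal W_1(\mu_N^0,\mu^0)=0$. Let $\mu_N(t)=\frac1N\sum_{i=1}^N\delta_{(x_i(t),v_i(t))}$, where $(x_i,v_i)_{i=1}^N$ is the Carathéodory solution on $[0,T]$ of $$\dot x_i=v_i,\qquad\dot v_i=(H\star\mu_N)(x_i,v_i)+f(t,x_i,v_i),\qquad i=1,\dots,N,$$ with initial datum $(x(0),v(0))=(x_N^0,v_N^0)$.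 Then there exists a map $\mu:[0,T]\to\mathcal P_1(\mathbb R^{2d})$ such that (i) $\lim_{N\to\infty}\mathcal W_1(\mu_N(t),\mu(t))=0$ uniformly with respect to $t\in[0,T]$; (ii) $\mu$ is a weak equi-compactly supported solution (see context) of $\frac{\partial\mu}{\partial t}+v\cdot\nabla_x\mu+\nabla_v\cdot[(H\star\mu+f)\mu]=0$ with forcing term $f$; (iii) $$\lim_{N\to\infty}\int_0^T\int_{\mathbb R^{2d}}\big(L(x,v,\mu_N(t))+\psi(f(t,x,v))\big)\,d\mu_N(t)(x,v)\,dt=\int_0^T\int_{\mathbb R^{2d}}\big(L(x,v,\mu(t))+\psi(f(t,x,v))\big)\,d\mu(t)(x,v)\,dt.$$
   Context: $\mathcal P_1(\mathbb R^n)$ is the set of Borel probability measures on $\mathbb R^n$ with finite first moment and $\mathcal W_1$ the 1-Wasserstein distance. $(H\star\mu)(z)=\int H(z-\zeta)\,d\mu(\zeta)$. $\operatorname{Lip}(g,A)$ is the Lipschitz constant of $g$ on $A$. A Carathéodory function is measurable in $t$ and continuous in the space variable; a Carathéodory solution of an ODE is an absolutely continuous function satisfying the equation a.e. Admissible controls: for $\ell\in L^q(0,T)$, $\mathcal F_\ell$ is the class of Carathéodory functions $f:[0,T]\times\mathbb R^n\to\mathbb R^d$ such that for a.e. $t\in[0,T]$: $f(t,\cdot)\in W^{1,\infty}_{loc}(\mathbb R^n,\mathbb R^d)$ and $|f(t,0)|+\operatorname{Lip}(f(t,\cdot),\mathbb R^n)\le\ell(t)$. Weak solution: given $f\in\mathcal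 F_\ell$, a $\mathcal W_1$-continuous map $\mu:[0,T]\to\mathcal P_1(\mathbb R^{2d})$ is a weak equi-compactly supported solution of the equation with forcing term $f$ if there is $R>0$ with $\operatorname{supp}\mu(t)\subset B(0,R)$ for every $t\in[0,T]$ and, with $w_{H,\mu,f}(t,x,v):=(v,\;H\star\mu(t)(x,v)+f(t,x,v))$, $$\frac{d}{dt}\int_{\mathbb R^{2d}}\zeta\,d\mu(t)=\int_{\mathbb R^{2d}}\nabla\zeta(x,v)\cdot w_{H,\mu,f}(t,x,v)\,d\mu(t)(x,v)$$ in the sense of distributions on $(0,T)$ for every $\zeta\in C_c^\infty(\mathbb R^d\times\mathbb R^d)$.
   Formalization: Part (iii) is proved under the added assumption that the supports of all initial measures mu_N^0 lie in one common ball, since W_1 convergence alone does not give (iii); (i) and (ii) need no such bound. Measurability in t is Borel measurability. *)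

(* Defs.v *)
From HB Require Import structures.
From mathcomp Require Import all_boot all_order all_algebra.
From mathcomp Require Import all_classical all_reals all_analysis.
From mathcomp Require Import measurable_realfun.

Set Implicit Arguments.
Unset Strict Implicit.
Unset Printing Implicit Defensive.
Import Order.TTheory GRing.Theory Num.Theory.
Import numFieldTopology.Exports numFieldNormedType.Exports.

Local Open Scope classical_set_scope.
Local Open Scope ring_scope.

(* The library norm on 'rV[R]_n is the sup norm; only its topology is used.
   Quantitative conditions are stated with the Euclidean norm. *)
Definition enorm {R : realType} {n : nat} (z : 'rV[R]_n) : R :=
  Num.sqrt (\sum_(i < n) z ord0 i ^+ 2).

Definition edot {R : realType} {n : nat} (u w : 'rV[R]_n) : R :=
  \sum_(i < n) u ord0 i * w ord0 i.

Definition eball {R : realType} {n : nat} (c : 'rV[R]_n) (r : R) :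
    set 'rV[R]_n := [set z | enorm (z - c) < r].

(* Least Lipschitz constant of g on A, +oo if there is none; nrm is the norm
   of the target space. *)
Definition Lip {R : realType} {n : nat} {Y : zmodType} (nrm : Y -> R)
    (g : 'rV[R]_n -> Y) (A : set 'rV[R]_n) : \bar R :=
  ereal_inf [set k%:E | k in [set k : R | 0 <= k /\
    forall x y, A x -> A y -> nrm (g x - g y) <= k * enorm (x - y)]].

Definition locally_Lipschitz {R : realType} {n m : nat}
    (g : 'rV[R]_n -> 'rV[R]_m) : Prop :=
  forall z, exists2 r : R, 0 < r & (Lip enorm g (eball z r) < +oo)%E.

Definition borelRn (R : realType) (n : nat) :=
  g_sigma_algebraType (@open 'rV[R]_n).

Record P1 (R : realType) (n : nat) : Type := MkP1 {
  P1_probability :> probability (borelRn R n) R ;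
  P1_moment : (\int[P1_probability]_z (enorm (z : 'rV[R]_n))%:E < +oo)%E }.

Definition msupport {R : realType} {n : nat} (mu : P1 R n) : set 'rV[R]_n :=
  [set z | forall U : set 'rV[R]_n, open U -> U z -> (0 < mu U)%E].

Definition narrow_cvg {R : realType} {n : nat} (mu_ : nat -> P1 R n)
    (mu : P1 R n) : Prop :=
  forall g : 'rV[R]_n -> R, continuous g ->
    (exists M : R, forall z, `|g z| <= M) ->
    (fun j => \int[mu_ j]_z g z) @ \oo --> \int[mu]_z g z.

Definition is_coupling {R : realType} {n : nat} (mu nu : P1 R n)
    (gamma : probability (borelRn R n * borelRn R n)%type R) : Prop :=
  forall A : set (borelRn R n), measurable A ->
    gamma (A `*` setT) = mu A /\ gamma (setT `*` A) = nu A.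

Definition W1 {R : realType} {n : nat} (mu nu : P1 R n) : \bar R :=
  ereal_inf [set (\int[gamma]_p (enorm ((p.1 : 'rV[R]_n) - p.2))%:E)%E
            | gamma in [set gamma | is_coupling mu nu gamma]].

Section empirical_measure.
Context {R : realType} {n : nat}.

Lemma continuous_measurable_borelRn (g : 'rV[R]_n -> R) :
  continuous g -> measurable_fun setT (g : borelRn R n -> R).
Proof.
move=> /continuousP cg.
apply: (measurability _ (RGenOpens.measurableE R)) => _ [_ [a [b ->] <-]].
by apply: sub_sigma_algebra; rewrite setTI; apply: cg; exact: interval_open.
Qed.

Lemma continuous_enorm : continuous (@enorm R n).
Proof.
move=> z; apply: continuous_comp; last exact: sqrt_continuous.
have cX (i : 'I_n) : continuous (fun z : 'rV[R]_n => z ord0 i ^+ 2).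
  move=> y; apply: (@continuous_comp _ _ _ (fun z : 'rV[R]_n => z ord0 i)
    (fun r : R => r ^+ 2)); [exact: coord_continuous|exact: exprn_continuous].
apply: (@cvg_big _ _ _ _ _ _ _ _ _ (fun i (z : 'rV[R]_n) => z ord0 i ^+ 2)).
- by move=> x; exact: (@add_continuous R^o).
- exact: (nbhs_filter z).
- by move=> i _; exact: cX.
Qed.

Context (N : nat) (z : 'I_N.+1 -> 'rV[R]_n).

(* (1/N') sum_(i < N') delta_(z i) for the positive number N' = N.+1. *)
Definition emp_measure : set (borelRn R n) -> \bar R :=
  mscale (N.+1%:R^-1)%:nng
    (msum (fun k => \d_(z (inord k) : borelRn R n)) N.+1).

HB.instance Definition _ := Measure.on emp_measure.

Lemma emp_measureE A :
  emp_measure A = ((N.+1%:R^-1)%:E * \sum_(i < N.+1) \d_(z i : borelRn R n) A)%E.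
Proof.
rewrite /emp_measure /mscale /msum /=; congr (_ * _)%E.
by apply: eq_bigr => i _; rewrite inord_val.
Qed.

Lemma emp_measure_setT : emp_measure setT = 1%E.
Proof.
rewrite emp_measureE (eq_bigr (fun=> 1%E)) => [|i _]; last by rewrite diracT.
by rewrite sumEFin sumr_const card_ord -EFinM mulVf// pnatr_eq0.
Qed.

HB.instance Definition _ :=
  Measure_isProbability.Build _ _ _ emp_measure emp_measure_setT.

Lemma emp_measure_moment :
  (\int[emp_measure]_y (enorm (y : 'rV[R]_n))%:E < +oo)%E.
Proof.
have mE : measurable_fun setT (EFin \o (@enorm R n : borelRn R n -> R)).
  apply/measurable_EFinP; apply: continuous_measurable_borelRn.
  exact: continuous_enorm.
have E0 (y : borelRn R n) : setT y -> (0 <= (enorm (y : 'rV[R]_n))%:E)%E.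
  by move=> _; rewrite lee_fin sqrtr_ge0.
rewrite ge0_integral_mscale// ge0_integral_measure_sum//.
rewrite (eq_bigr (fun i : 'I_N.+1 => (enorm (z (inord i)))%:E)) => [|i _].
  by rewrite sumEFin -EFinM ltry.
by rewrite integral_dirac// diracT mul1e.
Qed.

Definition empirical : P1 R n := MkP1 emp_measure_moment.

End empirical_measure.

(* All directional derivatives exist and are of class C^(k-1); on R^n this is
   the usual notion. *)
Fixpoint Ck {R : realType} {V : normedModType R} (k : nat) (g : V -> R) : Prop :=
  if k is k'.+1 then
    (forall u z, derivable (g : V -> R^o) z u) /\
    (forall u, Ck k' (fun z => 'D_u (g : V -> R^o) z))
  else continuous g.

Definition test_function {R : realType} {V : normedModType R} (Omega : set V)
    (g : V -> R) : Prop :=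
  (forall k, Ck k g) /\
  exists K : set V, [/\ compact K, K `<=` Omega & forall z, ~ K z -> g z = 0].

Definition grad {R : realType} {n : nat} (g : 'rV[R]_n -> R) (z : 'rV[R]_n) :
    'rV[R]_n :=
  \row_(i < n) 'D_(delta_mx ord0 i) (g : 'rV[R]_n -> R^o) z.

(* The integral over R^n, computed coordinate by coordinate.  It is applied
   below only to bounded Borel functions with compact support, for which it
   is the Lebesgue integral by Fubini. *)
Fixpoint iint {R : realType} (n : nat) : ('rV[R]_n -> R) -> R :=
  match n return ('rV[R]_n -> R) -> R with
  | 0%N => fun g => g 0
  | m.+1 => fun g => \int[lebesgue_measure]_s
      iint (fun y : 'rV[R]_m => g (row_mx (s%:M : 'rV[R]_1) y))
  end.

(* Every class in L^oo_loc has a Borel representative that is bounded, and not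
   only essentially bounded, on each ball. *)
Definition Loo_loc {R : realType} {n : nat} (g : 'rV[R]_n -> R) : Prop :=
  measurable_fun setT (g : borelRn R n -> R) /\
  forall r : R, exists M : R, forall z, eball 0 r z -> `|g z| <= M.

(* u is in L^oo_loc together with its weak first order derivatives p. *)
Definition W1oo_loc {R : realType} {n d : nat} (u : 'rV[R]_n -> 'rV[R]_d) :
    Prop :=
  forall j : 'I_d, Loo_loc (fun z => u z ord0 j) /\
  forall i : 'I_n, exists2 p : 'rV[R]_n -> R, Loo_loc p &
    forall phi : 'rV[R]_n -> R, test_function setT phi ->
      iint (fun z => u z ord0 j * grad phi z ord0 i) =
      - iint (fun z => p z * phi z).

(* du/dt = g in the sense of distributions on ]0, T[. *)
Definition distributional_derivative {R : realType} (T : R) (u g : R -> R) :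
    Prop :=
  [/\ locally_integrable `]0, T[ u, locally_integrable `]0, T[ g &
  forall phi : R^o -> R, test_function `]0, T[ phi ->
    \int[lebesgue_measure]_(t in `]0, T[) (u t * 'D_1 (phi : R^o -> R^o) t) =
    - \int[lebesgue_measure]_(t in `]0, T[) (g t * phi t)].

Definition in_Lq {R : realType} (T q : R) (l : R -> R) : Prop :=
  measurable_fun `]0, T[ l /\
  (\int[lebesgue_measure]_(t in `]0%R, T[) (`|l t| `^ q)%:E < +oo)%E.

Definition Caratheodory {R : realType} {n d : nat} (T : R)
    (f : R -> 'rV[R]_n -> 'rV[R]_d) : Prop :=
  (forall z, measurable_fun `[0, T] (fun t => f t z : borelRn R d)) /\
  (forall t, t \in `[0, T] -> continuous (f t)).

Definition admissible_control {R : realType} {n d : nat} (T : R) (l : R -> R)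
    (f : R -> 'rV[R]_n -> 'rV[R]_d) : Prop :=
  Caratheodory T f /\
  {ae lebesgue_measure, forall t : R, t \in `[0, T] ->
    W1oo_loc (f t) /\
    ((enorm (f t 0%R))%:E + Lip enorm (f t) setT <= (l t)%:E)%E}.

Definition conv {R : realType} {n d : nat} (H : 'rV[R]_n -> 'rV[R]_d)
    (mu : P1 R n) (z : 'rV[R]_n) : 'rV[R]_d :=
  \row_(j < d) \int[mu]_zeta H (z - (zeta : 'rV[R]_n)) ord0 j.

Definition abs_continuous {R : realType} {n : nat} (a b : R)
    (g : R -> 'rV[R]_n) : Prop :=
  forall e : R, 0 < e -> exists2 del : R, 0 < del &
    forall (m : nat) (s r : 'I_m -> R),
      (forall k, a <= s k /\ s k <= r k /\ r k <= b) ->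
      trivIset setT (fun k => `]s k, r k[%classic) ->
      \sum_(k < m) (r k - s k) < del ->
      \sum_(k < m) enorm (g (r k) - g (s k)) < e.

(* A point of R^d x R^d is row_mx x v : 'rV[R]_(d + d). *)
Definition particle_solution {R : realType} {d : nat} (T : R)
    (H : 'rV[R]_(d + d) -> 'rV[R]_d) (f : R -> 'rV[R]_(d + d) -> 'rV[R]_d)
    (N : nat) (x0 v0 : 'I_N.+1 -> 'rV[R]_d) (x v : 'I_N.+1 -> R -> 'rV[R]_d) :
    Prop :=
  forall i : 'I_N.+1,
  [/\ abs_continuous 0 T (x i), abs_continuous 0 T (v i),
      x i 0 = x0 i, v i 0 = v0 i &
      {ae lebesgue_measure, forall t : R, t \in `[0, T] ->
        is_derive (t : R^o) 1 (x i : R^o -> 'rV[R]_d) (v i t) /\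
        is_derive (t : R^o) 1 (v i : R^o -> 'rV[R]_d)
          (conv H (empirical (fun k => row_mx (x k t) (v k t)))
             (row_mx (x i t) (v i t)) + f t (row_mx (x i t) (v i t)))}].

Definition wfield {R : realType} {d : nat} (H : 'rV[R]_(d + d) -> 'rV[R]_d)
    (mu : R -> P1 R (d + d)) (f : R -> 'rV[R]_(d + d) -> 'rV[R]_d)
    (t : R) (z : 'rV[R]_(d + d)) : 'rV[R]_(d + d) :=
  row_mx (rsubmx z) (conv H (mu t) z + f t z).

Definition weak_solution {R : realType} {d : nat} (T : R)
    (H : 'rV[R]_(d + d) -> 'rV[R]_d) (f : R -> 'rV[R]_(d + d) -> 'rV[R]_d)
    (mu : R -> P1 R (d + d)) : Prop :=
  [/\ forall t : R, t \in `[0, T] ->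
        (fun s => W1 (mu s) (mu t)) @ within `[0, T] (nbhs t) --> 0%E,
      exists2 r : R, 0 < r &
        forall t : R, t \in `[0, T] -> msupport (mu t) `<=` eball 0 r &
      forall zeta : 'rV[R]_(d + d) -> R, test_function setT zeta ->
        distributional_derivative T
          (fun t => \int[mu t]_z zeta z)
          (fun t => \int[mu t]_z edot (grad zeta z) (wfield H mu f t z))].

Definition admissible_cost {R : realType} {n : nat}
    (L : 'rV[R]_n -> P1 R n -> R) : Prop :=
  [/\ forall z mu, 0 <= L z mu,
      forall mu, continuous (fun z => L z mu) &
      forall (mu_ : nat -> P1 R n) (mu : P1 R n), narrow_cvg mu_ mu ->
        forall K : set 'rV[R]_n, compact K -> forall e : R, 0 < e ->
        \forall j \near \oo, forall z, K z -> `|L z (mu_ j) - L z mu| < e].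

Definition total_cost {R : realType} {d : nat} (T : R)
    (L : 'rV[R]_(d + d) -> P1 R (d + d) -> R) (psi : 'rV[R]_d -> R)
    (f : R -> 'rV[R]_(d + d) -> 'rV[R]_d) (mu : R -> P1 R (d + d)) : \bar R :=
  (\int[lebesgue_measure]_(t in `[0%R, T])
     \int[mu t]_z (L z (mu t) + psi (f t z))%:E)%E.

(* Main.v *)
(* In the sup norm, a trajectory z_i grows at most like 1 + |z_i(0)|, uniformly
   in N.  Two particle systems are compared through a transport plan between
   their initial data: by Gronwall's inequality, trajectories started in a fixed
   ball stay as close as their initial points, up to the cost of the plan.  As H
   is only locally Lipschitz, mass outside a ball is charged with its first
   moment.  Plans from muN0 and from muM0 to mu0, glued along a fine finite
   partition of the compact support of mu0, give a plan of small cost from muN0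
   to muM0.  Hence the trajectories are Cauchy and converge to a flow Z_t on the
   support of mu0, and mu(t) is the image of mu0 by Z_t.  Transporting plans
   from muN0 to mu0 along the flows bounds W1(muN(t), mu(t)) uniformly in t.

   Every particle satisfies an exact weak identity, by the fundamental theorem
   of calculus for the absolutely continuous function phi(t) zeta(z_i(t)); the
   limit is taken by dominated convergence, pointwise in t, since H * muN(t)
   converges locally uniformly.  For the costs, the uniform bound on the initial
   supports keeps all particles in one ball; there L(., muN(t)) is bounded
   uniformly in t and N by compactness of [0, T], and psi(f(t, .)) is bounded by
   a multiple of 1 + l(t)^q. *)

Require Import Defs.
From HB Require Import structures.
From mathcomp Require Import all_boot all_order all_algebra.
From mathcomp Require Import all_classical all_reals all_analysis.
From mathcomp Require Import measurable_realfun.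
From mathcomp Require Import lra ring.

Set Implicit Arguments.
Unset Strict Implicit.
Unset Printing Implicit Defensive.
Import Order.TTheory GRing.Theory Num.Theory.
Import numFieldTopology.Exports numFieldNormedType.Exports.

Local Open Scope classical_set_scope.
Local Open Scope ring_scope.

(** * Norms and moduli of continuity *)

(** W1 convergence lets a vanishing fraction of the initial particles run off to infinity, and the
    nonlocal force couples every particle to them; no single Lipschitz constant of [H] serves such
    pairs. Linear growth of [H] bounds their force by a multiple of [1 + |p| + |q|], and W1 controls
    the mean of that quantity: a point at distance at least 1 from the support of [mu0] pays for its
    own norm in the transport cost. This is where the balls of radius [R0 + 1] come from. Each
    estimate applies Gronwall at two levels. One trajectory, or one pair, is bounded with the mean
    over all of them as a forcing term; averaging closes an inequality for the mean; its bound is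
    put back into the individual estimate. The constants may depend on the integrable rate but never
    on the number of particles, so they are always quantified before the systems. Plans between
    empirical measures are matrices. Discretizing each coupling with [mu0] on finitely many cells
    turns gluing into a finite sum and replaces disintegration. For merely continuous integrands the
    modulus [e + K * |z - z'|], with [e] as small as desired, plays the part of a Lipschitz
    bound. *)

Section norms.
Context {R : realType} {n : nat}.
Implicit Types (z : 'rV[R]_n) (r e K M : R).

Lemma coord_le_norm z i : `|z ord0 i| <= `|z|.
Proof.
rewrite [leRHS]/Num.Def.normr /= mx_normrE; apply/bigmax_geP; right => /=.
by exists (ord0, i).
Qed.

Lemma norm_le_coord z M : 0 <= M -> (forall i, `|z ord0 i| <= M) -> `|z| <= M.
Proof.
move=> M0 h; rewrite [leLHS]/Num.Def.normr /= mx_normrE; apply/bigmax_leP; split=> //.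
by move=> [i j] _ /=; rewrite ord1; exact: h.
Qed.

Lemma norm_le_enorm z : `|z| <= enorm z.
Proof.
apply: norm_le_coord => [|i]; first exact: sqrtr_ge0.
rewrite -sqrtr_sqr ler_sqrt; last by apply: sumr_ge0 => j _; exact: sqr_ge0.
by rewrite (bigD1 i)//= lerDl sumr_ge0// => j _; exact: sqr_ge0.
Qed.

(** The factor [n] is cruder than its square root, but after squaring only [n <= n ^ 2] has to be
    checked. *)
Lemma enorm_le_norm z : enorm z <= n%:R * `|z|.
Proof.
have h0 : 0 <= n%:R * `|z| by rewrite mulr_ge0.
rewrite -[leRHS]ger0_norm// -sqrtr_sqr ler_sqrt; last exact: sqr_ge0.
apply: (@le_trans _ _ (\sum_(i < n) `|z| ^+ 2)).
  apply: ler_sum => i _; rewrite -real_normK ?num_real//.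
  by rewrite lerXn2r// ?nnegrE// coord_le_norm.
rewrite sumr_const card_ord exprMn -[leLHS]mulr_natl ler_wpM2r ?sqr_ge0//.
rewrite -natrX ler_nat.
by case: (n) => // k; rewrite leq_pmulr.
Qed.

Lemma compact_norm_ball r : compact [set z : 'rV[R]_n | `|z| <= r].
Proof.
apply: bounded_closed_compact.
  exists r; split; first exact: num_real.
  by move=> x rx z /= /le_trans; apply; exact: ltW.
rewrite (_ : mkset _ = (fun z : 'rV[R]_n => `|z|) @^-1` [set x | x <= r])//.
by apply: closed_comp; [move=> x _; exact: norm_continuous|exact: closed_le].
Qed.

Lemma enormB z z' : enorm (z - z') = enorm (z' - z).
Proof.
congr Num.sqrt; apply: eq_bigr => i _; rewrite !mxE.
by rewrite -sqrrN opprB.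
Qed.

End norms.

Section moduli.
Context {R : realType} {n : nat}.
Implicit Types (z : 'rV[R]_n) (r e K M : R).

(** Compactness of the product of two balls, in its near-covering form with the filter at infinity:
    local thresholds [M] merge into one [K]. The property must persist for all larger [K], which the
    hypothesis builds in. *)
Lemma ball_pair_bound (P : R -> 'rV[R]_n -> 'rV[R]_n -> Prop) r :
  (forall z z', exists M, \forall p \near (z, z'),
     forall K, M <= K -> P K p.1 p.2) ->
  exists2 K, 0 <= K &
    forall z z', `|z| <= r -> `|z'| <= r -> P K z z'.
Proof.
move=> h.
have cB := @compact_norm_ball R n r.
have /compact_near_coveringP cBB := compact_setX cB cB.
have [] := cBB R (pinfty_nbhs R) (fun K p => P K p.1 p.2) _.
  move=> [z z'] _; have [M hM] := h z z'.
  exists ([set p | forall K, M <= K -> P K p.1 p.2], [set K | M <= K]).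
    by split => //; apply: nbhs_pinfty_ge; exact: num_real.
  by move=> [p K] /= [] /[apply].
(* A neighbourhood of infinity contains only the values strictly above [M], hence the [+ 1]. *)
move=> M [_ hM]; exists (Num.max M 0 + 1).
  by rewrite addr_ge0// le_max lexx orbT.
move=> z z' zr z'r; apply: (hM _ _ (z, z')); last by split.
by rewrite (@le_lt_trans _ _ (Num.max M 0))// ?le_max ?lexx// ltrDl.
Qed.

Lemma near_pair_dist (z z' : 'rV[R]_n) : z != z' ->
  \forall p \near (z, z'), `|z - z'| / 2 <= `|p.1 - p.2|.
Proof.
move=> zz'; have d0 : 0 < `|z - z'| by rewrite normr_gt0 subr_eq0.
have : {for (z, z'), continuous
    (fun p : 'rV[R]_n * 'rV[R]_n => `|p.1 - p.2|)}.
  apply: continuous_comp; last exact: norm_continuous.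
  apply: continuousB; [exact: cvg_fst|exact: cvg_snd].
move=> /cvgrPdist_lt /(_ (`|z - z'| / 2)).
rewrite divr_gt0// => /(_ isT); apply: filterS => p /=.
by rewrite ltr_norml => /andP[_]; lra.
Qed.

Lemma near_pair_bound {m} (g : 'rV[R]_n -> 'rV[R]_m) (z z' : 'rV[R]_n) :
  continuous g -> \forall p \near (z, z'), `|g p.1 - g p.2| <= `|g z - g z'| + 1.
Proof.
move=> cg; have : {for (z, z'), continuous
    (fun p : 'rV[R]_n * 'rV[R]_n => `|g p.1 - g p.2|)}.
  apply: continuous_comp; last exact: norm_continuous.
  apply: continuousB; apply: continuous_comp;
    [exact: cvg_fst|exact: cg|exact: cvg_snd|exact: cg].
move=> /cvgrPdist_lt /(_ 1 ltr01); apply: filterS => p /=.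
by rewrite ltr_norml => /andP[]; lra.
Qed.

(** Off the diagonal the numerator stays bounded and [|p.1 - p.2|] stays above half its value at
    [(z, z')], so any large enough [K] works nearby. *)
Lemma near_pair_lip {m} (g : 'rV[R]_n -> 'rV[R]_m) (z z' : 'rV[R]_n) :
  continuous g -> z != z' ->
  exists M, \forall p \near (z, z'),
     forall K, M <= K -> `|g p.1 - g p.2| <= K * `|p.1 - p.2|.
Proof.
move=> cg zz'; have d0 : 0 < `|z - z'| by rewrite normr_gt0 subr_eq0.
exists ((`|g z - g z'| + 1) / (`|z - z'| / 2)).
near=> p => K hK.
have h1 : `|z - z'| / 2 <= `|p.1 - p.2| by near: p; exact: near_pair_dist.
have : `|g p.1 - g p.2| <= `|g z - g z'| + 1.
  by near: p; exact: near_pair_bound.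
move=> /le_trans; apply; rewrite -ler_pdivrMr; last first.
  by rewrite (lt_le_trans _ h1)// divr_gt0.
apply: le_trans hK; rewrite ler_pM2l; last by rewrite ltr_wpDl.
by rewrite lef_pV2// posrE ?divr_gt0// (lt_le_trans _ h1)// divr_gt0.
Unshelve. all: by end_near. Qed.

(** Off the diagonal a Lipschitz bound holds locally; on the diagonal continuity makes the increment
    smaller than [e] with [K = 0]. Compactness merges the two. *)
Lemma continuous_modulus_ball {m} (g : 'rV[R]_n -> 'rV[R]_m) r e :
  continuous g -> 0 < e ->
  exists2 K, 0 <= K & forall z z', `|z| <= r -> `|z'| <= r ->
    `|g z - g z'| <= e + K * `|z - z'|.
Proof.
move=> cg e0; apply: (ball_pair_bound
  (P := fun K z z' => `|g z - g z'| <= e + K * `|z - z'|)) => z z'.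
have [->|/(near_pair_lip cg)[M hM]] := eqVneq z z'; last first.
  exists M; apply: filterS hM => p hp K /hp /le_trans; apply.
  by rewrite lerDr ltW.
exists 0.
have : {for (z', z'), continuous
    (fun p : 'rV[R]_n * 'rV[R]_n => g p.1 - g p.2)}.
  apply: continuousB; apply: continuous_comp;
    [exact: cvg_fst|exact: cg|exact: cvg_snd|exact: cg].
move=> /cvgrPdist_lt /(_ e e0); apply: filterS => p /=.
rewrite subrr sub0r normrN => /ltW pe K K0; rewrite (le_trans pe)//.
by rewrite lerDl mulr_ge0.
Qed.

(** If [z] leaves the ball of radius [r + 1], then [1 <= |z - z'|] and linear growth is absorbed: [2
    + |z| + |z'| <= 2 + 2r + |z - z'| <= (3 + 2r) |z - z'|]. Thus only one of the two points has to
    be confined. *)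
Lemma continuous_modulus {m} (g : 'rV[R]_n -> 'rV[R]_m) M r e :
  continuous g -> (forall z, `|g z| <= M * (1 + `|z|)) -> 0 <= r -> 0 < e ->
  exists2 K, 0 <= K & forall z z', `|z'| <= r ->
    `|g z - g z'| <= e + K * `|z - z'|.
Proof.
move=> cg gM r0 e0.
have [K K0 hK] := continuous_modulus_ball (r + 1) cg e0.
have M0 : 0 <= M.
  have := gM 0; rewrite normr0 addr0 mulr1; exact: le_trans.
exists (K + M * (3 + 2 * r)) => [|z z' z'r].
  by rewrite addr_ge0// mulr_ge0// addr_ge0// mulr_ge0.
have [zr|zr] := leP `|z| (r + 1).
  rewrite (le_trans (hK _ _ zr _))//; first by rewrite (le_trans z'r)// lerDl.
  rewrite lerD2l ler_wpM2r// lerDl mulr_ge0// addr_ge0// mulr_ge0//.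
have tri : `|z| <= `|z - z'| + r.
  rewrite -[z in leLHS](subrK z') (le_trans (ler_normD _ _))//.
  by rewrite lerD2l.
have d1 : 1 <= `|z - z'| by lra.
rewrite (@le_trans _ _ (M * (3 + 2 * r) * `|z - z'|))//; last first.
  by rewrite (mulrDl K) addrA lerDr addr_ge0 ?mulr_ge0 // ltW.
rewrite (le_trans (ler_normB _ _))// (le_trans (lerD (gM _) (gM _)))//.
rewrite -mulrDr -mulrA ler_wpM2l//.
apply: (@le_trans _ _ (2 + 2 * r + `|z - z'|)); first lra.
have : (2 + 2 * r) * 1 <= (2 + 2 * r) * `|z - z'|.
  by rewrite ler_wpM2l// addr_ge0// mulr_ge0.
lra.
Qed.

Lemma cvg_dist0 (z : 'rV[R]_n) : `|z - x| @[x --> z] --> (0 : R).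
Proof.
have ? := nbhs_filter z.
rewrite -[X in _ --> X](@normr0 _ 'rV[R]_n) -[in X in _ --> X](subrr z).
by apply: cvg_norm; apply: cvgB; [exact: cvg_cst|exact: cvg_id].
Qed.

Lemma locally_Lipschitz_continuous {m} (g : 'rV[R]_n -> 'rV[R]_m) :
  (forall z, exists K, \forall p \near (z, z),
     `|g p.1 - g p.2| <= K * `|p.1 - p.2|) -> continuous g.
Proof.
move=> lg z; have ? := nbhs_filter z; apply/cvgrPdist_lt => e e0.
have [K hK] := lg z.
have [/= [A B] [/= Az Bz] AB] := hK.
have c := cvg_dist0 z.
near=> x; rewrite (@le_lt_trans _ _ (K * `|z - x|))//.
  apply: (AB (z, x)); split; first exact: nbhs_singleton.
  by near: x.
rewrite (@le_lt_trans _ _ ((`|K| + 1) * `|z - x|))//.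
  by rewrite ler_wpM2r// (le_trans (ler_norm _))// lerDl.
rewrite -ltr_pdivlMl ?ltr_wpDl//.
near: x; have /cvgrPdist_lt /(_ ((`|K| + 1)^-1 * e)) := c.
rewrite mulr_gt0 ?invr_gt0 ?ltr_wpDl// => /(_ isT).
by apply: filterS => x; rewrite sub0r normrN normr_id.
Unshelve. all: by end_near. Qed.

(** The local Lipschitz constant serves on the diagonal, the quotient bound off it. No segment
    between the points is followed. *)
Lemma locally_Lipschitz_ball {m} (g : 'rV[R]_n -> 'rV[R]_m) r :
  (forall z, exists K, \forall p \near (z, z),
     `|g p.1 - g p.2| <= K * `|p.1 - p.2|) ->
  exists2 K, 0 <= K & forall z z', `|z| <= r -> `|z'| <= r ->
    `|g z - g z'| <= K * `|z - z'|.
Proof.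
move=> lg; have cg := locally_Lipschitz_continuous lg.
apply: (ball_pair_bound
  (P := fun K z z' => `|g z - g z'| <= K * `|z - z'|)) => z z'.
have [->|/(near_pair_lip cg)//] := eqVneq z z'.
have [K hK] := lg z'; exists K; apply: filterS hK => p hp K' KK'.
by rewrite (le_trans hp)// ler_wpM2r.
Qed.

End moduli.

Lemma locally_Lipschitz_norm {R : realType} {n m} (g : 'rV[R]_n -> 'rV[R]_m)
    (z : 'rV[R]_n) :
  locally_Lipschitz g -> exists K, \forall p \near (z, z),
     `|g p.1 - g p.2| <= K * `|p.1 - p.2|.
Proof.
move=> /(_ z)[r r0] /ereal_inf_lt[_ [k [k0 hk] <-] _].
exists (k * n%:R).
pose B := [set z' : 'rV[R]_n | n%:R * `|z - z'| < r].
have nB : nbhs z B.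
  have c := cvg_dist0 z.
  (* [n.+1] in place of [n] keeps the radius positive when [n = 0]. *)
  move/cvgrPdist_lt : c => /(_ (n.+1%:R^-1 * r)).
  rewrite mulr_gt0// ?invr_gt0// => /(_ isT); apply: filterS => x.
  rewrite sub0r normrN normr_id ltr_pdivlMl//; apply: le_lt_trans.
  by rewrite ler_wpM2r// ler_nat.
exists (B, B) => // -[p p'] /= [Bp Bp'].
rewrite (le_trans (norm_le_enorm _))// (le_trans (hk _ _ _ _))//.
- by rewrite /eball/= enormB (le_lt_trans (enorm_le_norm _)).
- by rewrite /eball/= enormB (le_lt_trans (enorm_le_norm _)).
- by rewrite -mulrA ler_wpM2l// enorm_le_norm.
Qed.

(** * Measures with finite first moment *)

Section borel.
Context {R : realType} {n : nat}.
Local Open Scope ereal_scope.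

Lemma measurable_coord (i : 'I_n) :
  measurable_fun setT (fun z : borelRn R n => (z : 'rV[R]_n) ord0 i).
Proof.
by apply: continuous_measurable_borelRn => z; exact: coord_continuous.
Qed.

Lemma open_measurable_borelRn (U : set 'rV[R]_n) :
  open U -> measurable (U : set (borelRn R n)).
Proof. exact: sub_sigma_algebra. Qed.

Lemma closed_measurable_borelRn (U : set 'rV[R]_n) :
  closed U -> measurable (U : set (borelRn R n)).
Proof.
move=> cU; rewrite -(setCK U); apply: measurableC.
by apply: open_measurable_borelRn; exact: closed_openC.
Qed.

Lemma measurable_fun_enorm_sub d (X : measurableType d)
    (F G : X -> borelRn R n) :
  measurable_fun setT F -> measurable_fun setT G ->
  measurable_fun setT (fun x => enorm ((F x : 'rV[R]_n) - G x)).
Proof.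
move=> mF mG; rewrite /enorm.
apply: (@measurableT_comp _ _ _ _ _ _ (@Num.sqrt R)).
  by apply: continuous_measurable_fun; exact: sqrt_continuous.
apply: measurable_sum => i.
apply: measurable_funX.
under eq_fun do rewrite !mxE.
apply: measurable_funD.
  exact: measurableT_comp (measurable_coord i) mF.
apply: measurable_funN.
exact: measurableT_comp (measurable_coord i) mG.
Qed.

End borel.

Section empirical_integral.
Context {R : realType} {n : nat}.
Variables (N : nat) (z : 'I_N.+1 -> 'rV[R]_n).
Local Open Scope ereal_scope.

Lemma ge0_integral_empirical (g : borelRn R n -> \bar R) :
  measurable_fun setT g -> (forall y, 0 <= g y) ->
  \int[empirical z]_y g y = (N.+1%:R^-1)%:E * \sum_(i < N.+1) g (z i).
Proof.
move=> mg g0.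
rewrite ge0_integral_mscale// ge0_integral_measure_sum//; congr (_ * _).
by apply: eq_bigr => i _; rewrite integral_dirac// diracT mul1e inord_val.
Qed.

Lemma integral_empirical (g : 'rV[R]_n -> R) :
  measurable_fun setT (g : borelRn R n -> R) ->
  \int[empirical z]_y (g y)%:E = (N.+1%:R^-1 * \sum_(i < N.+1) g (z i))%:E.
Proof.
move=> mg; have mg' : measurable_fun setT (EFin \o g : borelRn R n -> \bar R).
  exact/measurable_EFinP.
rewrite integralE !ge0_integral_empirical//.
- under eq_bigr do rewrite funeposE /= -EFin_max.
  under [X in _ - _ * X]eq_bigr do rewrite funenegE /= -EFin_max.
  rewrite !sumEFin -!EFinM -EFinB -mulrBr -sumrB; congr (_ * _)%:E.
  apply: eq_bigr => i _.
  by case: (leP (g (z i)) 0%R); case: (leP (- g (z i))%R 0%R); lra.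
- exact: measurable_funeneg.
- exact: measurable_funepos.
Qed.

Lemma Rintegral_empirical (g : 'rV[R]_n -> R) :
  measurable_fun setT (g : borelRn R n -> R) ->
  (\int[empirical z]_y g y = N.+1%:R^-1 * \sum_(i < N.+1) g (z i))%R.
Proof. by move=> mg; rewrite /Rintegral integral_empirical. Qed.

End empirical_integral.

Lemma conv_empirical {R : realType} {n d : nat} (H : 'rV[R]_n -> 'rV[R]_d) N
    (zs : 'I_N.+1 -> 'rV[R]_n) (z : 'rV[R]_n) :
  continuous H ->
  Defs.conv H (empirical zs) z = N.+1%:R^-1 *: \sum_(i < N.+1) H (z - zs i).
Proof.
move=> cH; apply/rowP => j; rewrite mxE Rintegral_empirical.
  by rewrite !mxE summxE.
have c : continuous (fun y : 'rV[R]_n => H (z - y) ord0 j).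
  move=> y; have ? := nbhs_filter y.
  have c1 : continuous_at y (fun y : 'rV[R]_n => H (z - y)).
    apply: continuous_comp; last exact: cH.
    by apply: cvgB; [exact: cvg_cst|exact: cvg_id].
  exact: (continuous_comp c1 (@coord_continuous _ _ _ ord0 j _)).
exact: continuous_measurable_borelRn c.
Qed.
Section support.
Context {R : realType} {n : nat} (mu : P1 R n).

Lemma null_open_of_notin_msupport (z : 'rV[R]_n) : ~ msupport mu z ->
  exists U : set 'rV[R]_n, [/\ open U, U z & mu U = 0%E].
Proof.
move=> /existsNP[U] /not_implyP[oU] /not_implyP[Uz /negP].
by rewrite -leNgt measure_le0 => /eqP; exists U.
Qed.

Lemma closed_msupport : closed (msupport mu).
Proof.
rewrite closedE => z; apply: contra_notP.
move=> /null_open_of_notin_msupport[U [oU Uz U0]].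
have : nbhs z U by exact: open_nbhs_nbhs.
by apply: filterS => x Ux /(_ U oU Ux); rewrite U0 ltxx.
Qed.

(** Second countability in concrete form: rational centres and radii [1 / (k + 1)] give a countable
    base, needed to discard uncountably many null neighbourhoods at once. *)
Lemma rational_ball_nbhs (z : 'rV[R]_n) (U : set 'rV[R]_n) : open U -> U z ->
  exists (q : 'rV[rat]_n) (k : nat),
    ball (map_mx ratr q : 'rV[R]_n) k.+1%:R^-1 z /\
    ball (map_mx ratr q : 'rV[R]_n) k.+1%:R^-1 `<=` U.
Proof.
move=> oU Uz; have : nbhs z U by exact: open_nbhs_nbhs.
move=> /nbhs_ballP[e /= e0 zeU].
have [k ke] : exists k : nat, k.+1%:R^-1 < e / 2.
  have [k _ /(_ k (leqnn k))] := near_infty_natSinv_lt (PosNum (divr_gt0 e0 (ltr0n R 2))).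
  by exists k.
have hq i : exists q : rat, ratr q \in `]z ord0 i - k.+1%:R^-1, z ord0 i + k.+1%:R^-1[.
  have : z ord0 i - k.+1%:R^-1 < z ord0 i + k.+1%:R^-1 :> R.
    by rewrite ltrD2l gtrN// invr_gt0.
  by move=> /rat_in_itvoo.
have [q qz] := choice hq.
have bz : ball (map_mx ratr (\row_i q i) : 'rV[R]_n) k.+1%:R^-1 z.
  split; first by rewrite invr_gt0.
  move=> i j; rewrite ord1 !mxE /ball /= distrC ltr_distlC.
  by have := qz j; rewrite in_itv.
exists (\row_i q i), k; split => // x bx; apply: zeU.
rewrite [e]splitr; apply: ball_triangle.
  by apply: ball_sym; apply: le_ball bz; exact: ltW.
by apply: le_ball bx; exact: ltW.
Qed.

(** Every point outside the support lies in a null ball of the countable base. [unpickle] enumerates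
    the base, and the balls of positive mass are replaced by the empty set. *)
Lemma msupport_conull : mu (~` msupport mu) = 0%E.
Proof.
have mS : measurable (~` msupport mu : set (borelRn R n)).
  by apply: measurableC; apply: closed_measurable_borelRn; exact: closed_msupport.
pose B (qk : 'rV[rat]_n * nat) : set (borelRn R n) :=
  ball (map_mx ratr qk.1 : 'rV[R]_n) qk.2.+1%:R^-1.
pose F (m : nat) : set (borelRn R n) :=
  if unpickle m is Some qk then if mu (B qk) == 0%E then B qk else set0
  else set0.
have : mu.-negligible (\bigcup_m F m).
  apply: negligible_bigcup => m; rewrite /F.
  case: unpickle => [qk|]; last exact: negligible_set0.
  case: ifPn => [/eqP h|_]; last exact: negligible_set0.
  apply/negligibleP => //; apply: open_measurable_borelRn.
  exact: ball_open.
move=> mF; apply/negligibleP => //; apply: negligibleS mF => z /= Sz.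
have [U [oU Uz U0]] := null_open_of_notin_msupport Sz.
have [q [k [bz bU]]] := rational_ball_nbhs oU Uz.
exists (pickle (q, k)) => //; rewrite /F pickleK ifT//.
rewrite -measure_le0 -U0 le_measure// inE.
- by apply: open_measurable_borelRn; exact: ball_open.
- exact: open_measurable_borelRn.
Qed.

End support.

Lemma integral_probability_cst {R : realType} d (T : measurableType d)
    (P : probability T R) (r : R) : (\int[P]_x r%:E = r%:E)%E.
Proof.
rewrite integral_cst//; transitivity (r%:E * 1)%E; last by rewrite mule1.
congr (_ * _)%E; exact: probability_setT.
Qed.

Section integrability.
Context {R : realType} {n : nat} (mu : P1 R n).
Local Open Scope ereal_scope.

Lemma measurable_enorm : measurable_fun setT (@enorm R n : borelRn R n -> R).
Proof. by apply: continuous_measurable_borelRn; exact: continuous_enorm. Qed.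

Lemma P1_integrable (g : 'rV[R]_n -> R) (M : R) :
  measurable_fun setT (g : borelRn R n -> R) ->
  (forall z, `|g z| <= M * (1 + enorm z))%R ->
  mu.-integrable setT (EFin \o (g : borelRn R n -> R)).
Proof.
move=> mg gM; apply: (@le_integrable _ _ _ _ _ _ _
  (EFin \o (fun z : borelRn R n => M * (1 + enorm (z : 'rV[R]_n)))%R)) => //.
- exact/measurable_EFinP.
- by move=> z _ /=; rewrite lee_fin (le_trans (gM z))// ler_norm.
have i1 : mu.-integrable setT (EFin \o cst (1%R : R)).
  exact: finite_measure_integrable_cst.
have i2 : mu.-integrable setT (EFin \o (@enorm R n : borelRn R n -> R)).
  apply/integrableP; split; first by apply/measurable_EFinP; exact: measurable_enorm.
  apply: le_lt_trans (P1_moment mu); rewrite le_eqVlt; apply/orP; left.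
  apply/eqP; apply: eq_integral => z _ /=.
  by rewrite ger0_norm// sqrtr_ge0.
have := integrableZl measurableT M (integrableD measurableT i1 i2).
exact: eq_integrable.
Qed.

Lemma P1_conull_integrable (g : 'rV[R]_n -> R) (A : set 'rV[R]_n) (M : R) :
  measurable (A : set (borelRn R n)) -> mu (~` A) = 0 ->
  measurable_fun setT (g : borelRn R n -> R) ->
  (forall z, A z -> `|g z| <= M)%R ->
  mu.-integrable setT (EFin \o (g : borelRn R n -> R)).
Proof.
move=> mA A0 mg gM; apply/integrableP; split; first exact/measurable_EFinP.
apply: (@le_lt_trans _ _ (\int[mu]_z (`|M|%:E))); last first.
  by rewrite integral_probability_cst ltry.
apply: ae_ge0_le_integral => //.
- by apply/measurable_EFinP/measurableT_comp.
exists (~` A); split => //; first exact: measurableC.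
move=> z /= h Az; apply: h => _ /=; rewrite lee_fin.
by rewrite (le_trans (gM z Az))// ler_norm.
Qed.

End integrability.

Section coupling.
Context {R : realType} {n : nat} (mu nu : P1 R n).
Variable gamma : probability (borelRn R n * borelRn R n)%type R.
Hypothesis hgamma : is_coupling mu nu gamma.
Local Open Scope ereal_scope.

Let fst_pushforward A : measurable A -> pushforward gamma fst A = mu A.
Proof.
move=> mA; rewrite -(hgamma mA).1 /pushforward; congr (gamma _).
by apply/seteqP; split => -[a b] //= [].
Qed.

Let snd_pushforward A : measurable A -> pushforward gamma snd A = nu A.
Proof.
move=> mA; rewrite -(hgamma mA).2 /pushforward; congr (gamma _).
by apply/seteqP; split => -[a b] //= [].
Qed.

Lemma ge0_integral_coupling_fst (g : borelRn R n -> \bar R) :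
  measurable_fun setT g -> (forall z, 0 <= g z) ->
  \int[gamma]_p g p.1 = \int[mu]_z g z.
Proof.
move=> mg g0; have := @ge0_integral_pushforward _ _ _ _ R fst measurable_fst
  gamma setT g measurableT mg (fun y _ => g0 y).
rewrite preimage_setT => <-; apply: eq_measure_integral => A mA _.
exact: fst_pushforward.
Qed.

Lemma ge0_integral_coupling_snd (g : borelRn R n -> \bar R) :
  measurable_fun setT g -> (forall z, 0 <= g z) ->
  \int[gamma]_p g p.2 = \int[nu]_z g z.
Proof.
move=> mg g0; have := @ge0_integral_pushforward _ _ _ _ R snd measurable_snd
  gamma setT g measurableT mg (fun y _ => g0 y).
rewrite preimage_setT => <-; apply: eq_measure_integral => A mA _.
exact: snd_pushforward.
Qed.

Lemma integrable_coupling_fst (g : borelRn R n -> R) :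
  mu.-integrable setT (EFin \o g) ->
  gamma.-integrable setT (fun p => (g p.1)%:E).
Proof.
move=> /integrableP[mg ig]; apply/integrableP; split.
  exact: measurableT_comp mg measurable_fst.
rewrite (ge0_integral_coupling_fst (g := fun z => `|(EFin \o g) z|))//.
exact: measurableT_comp.
Qed.

Lemma integrable_coupling_snd (g : borelRn R n -> R) :
  nu.-integrable setT (EFin \o g) ->
  gamma.-integrable setT (fun p => (g p.2)%:E).
Proof.
move=> /integrableP[mg ig]; apply/integrableP; split.
  exact: measurableT_comp mg measurable_snd.
rewrite (ge0_integral_coupling_snd (g := fun z => `|(EFin \o g) z|))//.
exact: measurableT_comp.
Qed.

Lemma Rintegral_coupling_fst (g : borelRn R n -> R) :
  measurable_fun setT g ->
  (\int[gamma]_p g p.1 = \int[mu]_z g z)%R.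
Proof.
move=> mg; rewrite /Rintegral integralE [in RHS]integralE.
have mg' : measurable_fun setT (EFin \o g) by exact/measurable_EFinP.
congr (fine (_ - _)).
  rewrite -(ge0_integral_coupling_fst (measurable_funepos mg'))//.
  by apply: eq_integral => p _; rewrite !funeposE.
rewrite -(ge0_integral_coupling_fst (measurable_funeneg mg'))//.
by apply: eq_integral => p _; rewrite !funenegE.
Qed.

Lemma Rintegral_coupling_snd (g : borelRn R n -> R) :
  measurable_fun setT g ->
  (\int[gamma]_p g p.2 = \int[nu]_z g z)%R.
Proof.
move=> mg; rewrite /Rintegral integralE [in RHS]integralE.
have mg' : measurable_fun setT (EFin \o g) by exact/measurable_EFinP.
congr (fine (_ - _)).
  rewrite -(ge0_integral_coupling_snd (measurable_funepos mg'))//.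
  by apply: eq_integral => p _; rewrite !funeposE.
rewrite -(ge0_integral_coupling_snd (measurable_funeneg mg'))//.
by apply: eq_integral => p _; rewrite !funenegE.
Qed.

Lemma coupling_ae (A B : set (borelRn R n)) :
  measurable A -> measurable B -> mu (~` A) = 0 -> nu (~` B) = 0 ->
  {ae gamma, forall p, A p.1 /\ B p.2}.
Proof.
move=> mA mB A0 B0.
have h1 : gamma.-negligible (~` A `*` setT).
  apply/negligibleP; first by apply: measurableX => //; exact: measurableC.
  exact: (etrans (hgamma (measurableC mA)).1 A0).
have h2 : gamma.-negligible (setT `*` ~` B).
  apply/negligibleP; first by apply: measurableX => //; exact: measurableC.
  exact: (etrans (hgamma (measurableC mB)).2 B0).
apply: negligibleS (negligibleU h1 h2) => -[a b] /= /not_andP[]; by [left|right].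
Qed.

Lemma measurable_cost : measurable_fun setT
  (fun p : borelRn R n * borelRn R n => enorm ((p.1 : 'rV[R]_n) - p.2)).
Proof. exact: measurable_fun_enorm_sub. Qed.

(** Easy half of Kantorovich duality: both integrals are written against [gamma], and the modulus is
    applied under the integral sign. It is required only for [A] and [B], which carry the
    marginals. *)
Lemma coupling_integral_dist (g : 'rV[R]_n -> R) (A B : set (borelRn R n))
    (a K : R) :
  measurable A -> measurable B -> mu (~` A) = 0 -> nu (~` B) = 0 ->
  mu.-integrable setT (EFin \o (g : borelRn R n -> R)) ->
  nu.-integrable setT (EFin \o (g : borelRn R n -> R)) ->
  (0 <= a)%R -> (0 <= K)%R ->
  (forall z z', A z -> B z' -> `|g z - g z'| <= a + K * enorm (z - z'))%R ->
  (`|\int[mu]_z g z - \int[nu]_z g z|)%R%:E <=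
    a%:E + K%:E * \int[gamma]_p (enorm ((p.1 : 'rV[R]_n) - p.2))%:E.
Proof.
move=> mA mB A0 B0 i1 i2 a0 K0 hg.
have mg : measurable_fun setT (g : borelRn R n -> R).
  by move/integrableP : i1 => -[/measurable_EFinP].
have ig1 := integrable_coupling_fst i1.
have ig2 := integrable_coupling_snd i2.
have -> : (\int[mu]_z g z - \int[nu]_z g z =
    \int[gamma]_p (g p.1 - g p.2))%R.
  by rewrite RintegralB// Rintegral_coupling_fst// Rintegral_coupling_snd.
have ig : gamma.-integrable setT (EFin \o (fun p => g p.1 - g p.2)%R).
  by apply: eq_integrable (integrableB measurableT ig1 ig2).
rewrite EFin_normr_Rintegral//.
apply: (le_trans (le_abse_integral _ _ _)) => //.
  by case/integrableP : ig.
have c0 : forall p : borelRn R n * borelRn R n, setT p ->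
    0 <= (enorm ((p.1 : 'rV[R]_n) - p.2))%:E.
  by move=> p _; rewrite lee_fin sqrtr_ge0.
have mc : measurable_fun setT (fun p : borelRn R n * borelRn R n =>
    (enorm ((p.1 : 'rV[R]_n) - p.2))%:E).
  by apply/measurable_EFinP; exact: measurable_cost.
have -> : a%:E = \int[gamma]_p (cst a%:E p).
  by rewrite integral_probability_cst.
rewrite -ge0_integralZl// -ge0_integralD//; last 2 first.
- by move=> p pT; rewrite mule_ge0// c0.
- exact: measurable_funeM.
apply: ae_ge0_le_integral => //.
- by apply: measurableT_comp => //; case/integrableP : ig.
- by move=> p pT; rewrite -EFinM -EFinD lee_fin addr_ge0// mulr_ge0// sqrtr_ge0.
- by apply: emeasurable_funD => //; exact: measurable_funeM.
apply: filterS (coupling_ae mA mB A0 B0) => p [pA pB] _ /=.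
by rewrite -EFinM -EFinD lee_fin hg.
Qed.

Lemma W1_le_coupling :
  W1 mu nu <= \int[gamma]_p (enorm ((p.1 : 'rV[R]_n) - p.2))%:E.
Proof. by apply: ereal_inf_lbound; exists gamma. Qed.

End coupling.

Lemma W1_lt_coupling {R : realType} {n : nat} (mu nu : P1 R n) (e : \bar R) :
  (W1 mu nu < e)%E -> exists2 gamma, is_coupling mu nu gamma &
    (\int[gamma]_p (enorm ((p.1 : 'rV[R]_n) - p.2))%:E < e)%E.
Proof. by move=> /ereal_inf_lt[_ [gamma hg <-] he]; exists gamma. Qed.

Lemma W1_integral_dist {R : realType} {n : nat} (mu nu : P1 R n)
    (g : 'rV[R]_n -> R) (A B : set (borelRn R n)) (a K e : R) :
  measurable A -> measurable B -> mu (~` A) = 0%E -> nu (~` B) = 0%E ->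
  mu.-integrable setT (EFin \o (g : borelRn R n -> R)) ->
  nu.-integrable setT (EFin \o (g : borelRn R n -> R)) ->
  0 <= a -> 0 <= K ->
  (forall z z', A z -> B z' -> `|g z - g z'| <= a + K * enorm (z - z')) ->
  (W1 mu nu < e%:E)%E ->
  `|\int[mu]_z g z - \int[nu]_z g z| <= a + K * e.
Proof.
move=> mA mB A0 B0 i1 i2 a0 K0 hg /W1_lt_coupling[gamma hgam he].
rewrite -lee_fin; apply: (le_trans (coupling_integral_dist hgam mA mB A0 B0 i1 i2 a0 K0 hg)).
rewrite EFinD EFinM leeD2l// lee_wpmul2l//.
exact: ltW.
Qed.

(** * Absolutely continuous functions *)

Section real_induction.
Context {R : realType}.

(** At the supremum of the points where [P] holds, one step from a point just below it either
    reaches [b] or passes the supremum. The step goes from [s <= c] to [t >= c], so it does both the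
    closure and the continuation. *)
Lemma real_induction (P : R -> Prop) (a b : R) : a <= b -> P a ->
  (forall c, a <= c <= b -> exists2 e, 0 < e & forall s t,
     a <= s <= c -> c <= t <= b -> c - e < s -> t < c + e -> P s -> P t) ->
  P b.
Proof.
move=> ab Pa step; pose S := [set t | a <= t <= b /\ P t].
have Sa : S a by split; rewrite ?lexx.
have hS : has_sup S.
  by split; [exists a|exists b => t [/andP[]]].
have ac : a <= sup S by exact: ub_le_sup hS.2 _ Sa.
have cb : sup S <= b by apply: ge_sup; [exists a|move=> t [/andP[]]].
have acb : a <= sup S <= b by rewrite ac.
have [e e0 he] := step _ acb.
have [s [/andP[As sb] Ps] cs] := sup_adherent e0 hS.
have sc : s <= sup S by apply: ub_le_sup hS.2 _ _; split; rewrite ?As.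
(* Either [t = b], which is the goal, or [t] is a member of [S] beyond its supremum. *)
pose t := Num.min b (sup S + e / 2).
have Pt : P t.
  apply: (he s) => //.
  - by rewrite As.
  - by rewrite /t le_min cb lerDl divr_ge0 ?(ltW e0)//= ge_min lexx.
  - by rewrite /t gt_min ltrD2l; apply/orP; right; lra.
have [bt|tb] := leP b (sup S + e / 2).
  by have -> : b = t by rewrite /t min_l.
have : t <= sup S.
  apply: ub_le_sup hS.2 _ _; split => //; rewrite /t ge_min lexx andbT.
  by rewrite le_min ab/= (le_trans ac)// lerDl divr_ge0// ltW.
by rewrite /t min_r ?(ltW tb)//; lra.
Qed.

End real_induction.

(* Unlike the limit of difference quotients, this form also controls the
   increments F t - F s with s <= c <= t. *)
Definition diff_at {R : realType} {V : normedModType R} (F : R -> V) (c : R)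
    (l : V) : Prop :=
  forall e : R, 0 < e -> exists2 del : R, 0 < del &
    forall x, `|x - c| < del -> `|F x - F c - (x - c) *: l| <= e * `|x - c|.

Lemma is_derive_diff_at {R : realType} {V : normedModType R} (F : R -> V) c l :
  is_derive (c : R^o) 1 (F : R^o -> V) l -> diff_at F c l.
Proof.
move=> [dF <-] e e0.
have /cvgrPdist_lt /(_ e e0) := dF.
rewrite /derive -/(lim _).
move=> [del /= del0 hdel]; exists del => // x xc.
have [->|xnc] := eqVneq x c; first by rewrite !subrr scale0r subr0 !normr0 mulr0.
have h0 : x - c != 0 by rewrite subr_eq0.
have := hdel (x - c); rewrite /ball_/= sub0r normrN => /(_ xc h0).
rewrite (_ : (x - c)%:A + c = x :> R^o); last first.
  by rewrite /GRing.scale/= mulr1 subrK.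
set D := lim _ => hD.
have -> : F x - F c - (x - c) *: D = - ((x - c) *: (D - (x - c)^-1 *: (F x - F c))).
  by rewrite scalerBr scalerA mulfV// scale1r opprB.
by rewrite normrN normrZ mulrC ler_pM2r ?normr_gt0// ltW.
Qed.

Lemma diff_at_coord {R : realType} {n : nat} (F : R -> 'rV[R]_n) c l i :
  diff_at F c l -> diff_at (fun t => F t ord0 i : R^o) c (l ord0 i).
Proof.
move=> h e e0; have [del del0 hdel] := h e e0; exists del => // x /hdel.
apply: le_trans; apply: le_trans (coord_le_norm _ i).
by rewrite !mxE.
Qed.
Section integrable_real.
Context {R : realType} d (T : measurableType d) (mu : {measure set T -> \bar R}).
Variables (D : set T) (mD : measurable D).
Implicit Types f g : T -> R.

Lemma integrable_addR f g : mu.-integrable D (EFin \o f) ->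
  mu.-integrable D (EFin \o g) -> mu.-integrable D (EFin \o (fun x => f x + g x)).
Proof. by move=> fi gi; apply: eq_integrable (integrableD mD fi gi). Qed.

Lemma integrable_subR f g : mu.-integrable D (EFin \o f) ->
  mu.-integrable D (EFin \o g) -> mu.-integrable D (EFin \o (fun x => f x - g x)).
Proof. by move=> fi gi; apply: eq_integrable (integrableB mD fi gi). Qed.

Lemma integrable_scaleR f (r : R) : mu.-integrable D (EFin \o f) ->
  mu.-integrable D (EFin \o (fun x => r * f x)).
Proof. by move=> fi; apply: eq_integrable (integrableZl mD r fi). Qed.

Lemma integrable_normR f : mu.-integrable D (EFin \o f) ->
  mu.-integrable D (EFin \o (fun x => `|f x|)).
Proof. exact: integrable_norm. Qed.

Lemma integrable_measurableR f : mu.-integrable D (EFin \o f) ->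
  measurable_fun D f.
Proof. by move=> /integrableP[/measurable_EFinP]. Qed.

End integrable_real.

Lemma dominated_integrableR {R : realType} d (T : measurableType d)
    (mu : {measure set T -> \bar R}) (D : set T) (f g : T -> R) :
  measurable D -> measurable_fun D f -> (forall x, D x -> `|f x| <= g x) ->
  mu.-integrable D (EFin \o g) -> mu.-integrable D (EFin \o f).
Proof.
move=> mD mf fg; apply: le_integrable => //; first exact/measurable_EFinP.
by move=> x Dx /=; rewrite lee_fin (le_trans (fg x Dx))// ler_norm.
Qed.

Lemma integrable_cst_lty {R : realType} d (T : measurableType d)
    (mu : {measure set T -> \bar R}) (D : set T) (k : R) :
  measurable D -> (mu D < +oo)%E -> mu.-integrable D (EFin \o cst k).
Proof.
move=> mD Dy; apply/integrableP; split; first exact/measurable_EFinP.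
rewrite (_ : (\int[mu]_(x in D) _)%E = (`|k|%:E * mu D)%E).
  by rewrite lte_mul_pinfty.
exact: (integral_cst mu mD `|k|%:E).
Qed.

Section integral_tools.
Context {R : realType}.
Notation mu := (@lebesgue_measure R).
Implicit Types (f g : R -> R) (a b s t : R).

(** Absolute continuity of the integral. [h m] is the part of [|g|] where it exceeds [m]; its
    integral tends to 0 by dominated convergence, and the remaining part is bounded by [m]. *)
Lemma integrable_small_set (D : set R) g e :
  measurable D -> mu.-integrable D (EFin \o g) -> 0 < e ->
  exists2 del, 0 < del & forall A, measurable A -> A `<=` D ->
    (mu A < del%:E)%E -> \int[mu]_(x in A) `|g x| < e.
Proof.
move=> mD ig e0.
have mg : measurable_fun D g by move/integrableP : ig => -[/measurable_EFinP].
pose h (m : nat) (x : R) : R := if m%:R < `|g x| then `|g x| else 0.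
have mh m : measurable_fun D (h m).
  have mng : measurable_fun D (fun x => `|g x|) by exact: measurableT_comp.
  apply: measurable_fun_if => //; first exact: measurable_fun_ltr.
  by apply: measurable_funS mng => //; exact: subIsetl.
have hg m x : h m x <= `|g x| by rewrite /h; case: ifP.
have h0 m x : 0 <= h m x by rewrite /h; case: ifP.
have ig' : mu.-integrable D (EFin \o (fun x => `|g x|)).
  exact: integrable_norm ig.
have ih m : mu.-integrable D (EFin \o h m).
  refine (@dominated_integrableR R _ _ mu D (h m) (fun x => `|g x|) mD (mh m) _ ig').
  by move=> x Dx /=; rewrite ger0_norm.
have [] := @dominated_convergence _ _ R mu D mD (fun m => EFin \o h m)
  (cst 0%E) (EFin \o (fun x => `|g x|)) _ _ _ ig' _.
- by move=> m; apply/measurable_EFinP; exact: mh.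
- exact: measurable_cst.
- apply: aeW => x Dx; apply: cvg_near_cst; near=> m.
  rewrite /= /h ifF//; apply/negbTE; rewrite -leNgt.
  near: m; exact: nbhs_infty_ger.
- by apply: aeW => x m Dx /=; rewrite lee_fin ger0_norm.
move=> _ _; rewrite integral0 => /fine_cvgP[_ /cvgrPdist_lt /(_ (e / 2))].
rewrite divr_gt0// => /(_ isT) [m _ /(_ m (leqnn m))] /=.
rewrite sub0r normrN => hm.
(* On a set of this measure the part bounded by [m] contributes at most [e / 2]; [m.+1] also covers
   [m = 0]. *)
exists (e / 2 / m.+1%:R); first by rewrite !divr_gt0.
move=> A mA AD Adel.
have muA : mu A \is a fin_num.
  by rewrite ge0_fin_numE// (lt_trans Adel)// ltry.
have ic k : mu.-integrable A (EFin \o cst k).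
  by apply: integrable_cst_lty => //; rewrite ltey_eq muA.
have ihA : mu.-integrable A (EFin \o h m) by exact: integrableS (ih m).
apply: (@le_lt_trans _ _ (\int[mu]_(x in A) (m%:R + h m x))).
  apply: le_Rintegral => //; first exact: integrableS ig'.
    by apply: integrable_addR => //; exact: ic.
  move=> x Ax; rewrite /h; case: ltP; rewrite ?addr0//.
  by rewrite lerDr.
rewrite RintegralD//; last exact: ic.
rewrite Rintegral_cst// [e]splitr ler_ltD//; last first.
  apply: le_lt_trans hm; rewrite ger0_norm; last first.
    by apply: fine_ge0; apply: integral_ge0 => x _; rewrite lee_fin.
  apply: fine_le; [exact: integrable_fin_num ihA|exact: integrable_fin_num (ih m)|].
  apply: ge0_subset_integral => //; first by apply/measurable_EFinP; exact: mh.
  by move=> x _; rewrite lee_fin.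
apply: (@le_trans _ _ (m.+1%:R * fine (mu A))).
  by rewrite ler_wpM2r ?fine_ge0// ler_nat.
rewrite mulrC -ler_pdivlMr// ltW// -lte_fin fineK//.
Unshelve. all: by end_near. Qed.

Lemma Rintegral_itv_diff f a s t : a <= s -> s <= t ->
  mu.-integrable `[a, t] (EFin \o f) ->
  \int[mu]_(x in `[a, t]) f x - \int[mu]_(x in `[a, s]) f x =
  \int[mu]_(x in `]s, t]) f x.
Proof.
by move=> as_ st itf; rewrite Rintegral_itvB// bnd_simp.
Qed.

Lemma le_norm_Rintegral f g (D : set R) : measurable D ->
  mu.-integrable D (EFin \o f) -> mu.-integrable D (EFin \o g) ->
  (forall x, D x -> `|f x| <= g x) ->
  `|\int[mu]_(x in D) f x| <= \int[mu]_(x in D) g x.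
Proof.
move=> mD fi gi fg; rewrite (le_trans (le_normr_Rintegral _ _))//.
apply: le_Rintegral => //.
exact: integrable_norm fi.
Qed.

Lemma integrable_cst_itv (i : interval R) a b k : [set` i] `<=` `[a, b] ->
  mu.-integrable [set` i] (EFin \o cst k).
Proof.
suff icc : mu.-integrable `[a, b] (EFin \o cst k).
  by move=> iab; apply: integrableS icc.
apply/integrableP; split; first exact/measurable_EFinP.
rewrite (_ : (\int[mu]_(x in `[a, b]) _)%E = (`|k|%:E * mu `[a, b])%E).
  rewrite lebesgue_measure_itv/=.
  by case: ifP => _; rewrite -?EFinB -?EFinM ?mule0 ltry.
exact: (integral_cst mu _ `|k|%:E).
Qed.

Lemma Rintegral_cst_oc s t k : s <= t ->
  \int[mu]_(x in `]s, t]) k = k * (t - s).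
Proof.
move=> st; transitivity (k * fine (mu `]s, t])).
  exact: Rintegral_cst.
rewrite lebesgue_measure_itv/= lte_fin.
by case: ltP => // ts; rewrite [t - s](_ : _ = 0)//; lra.
Qed.

Lemma Rintegral_cst_cc s t k : s <= t ->
  \int[mu]_(x in `[s, t]) k = k * (t - s).
Proof.
move=> st; transitivity (k * fine (mu `[s, t])).
  exact: Rintegral_cst.
rewrite lebesgue_measure_itv/= lte_fin.
by case: ltP => // ts; rewrite [t - s](_ : _ = 0)//; lra.
Qed.

End integral_tools.

Definition abs_continuous_real {R : realType} (a b : R) (F : R -> R) : Prop :=
  forall e : R, 0 < e -> exists2 del : R, 0 < del &
    forall (m : nat) (s r : 'I_m -> R),
      (forall k, a <= s k /\ s k <= r k /\ r k <= b) ->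
      trivIset setT (fun k => `]s k, r k[%classic) ->
      \sum_(k < m) (r k - s k) < del ->
      \sum_(k < m) `|F (r k) - F (s k)| < e.

Lemma abs_continuous_coord {R : realType} {n : nat} (a b : R)
    (g : R -> 'rV[R]_n) i :
  abs_continuous a b g -> abs_continuous_real a b (fun t => g t ord0 i).
Proof.
move=> h e /h[del del0 hdel]; exists del => // m s r hsr tsr /hdel.
move=> /(_ hsr tsr); apply: le_lt_trans; apply: ler_sum => k _.
by rewrite (le_trans _ (norm_le_enorm _))// (le_trans _ (coord_le_norm _ i))// !mxE.
Qed.

Section ac_FTC.
Context {R : realType}.
Notation mu := (@lebesgue_measure R).

(** Used to append one interval in the inductive step for absolutely continuous functions. The free
    [h] allows one family to serve both for the total length and for the total increment. *)
Lemma extend_disjoint_family (a s t : R) (m : nat) (u r : 'I_m -> R) :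
  a <= s -> s <= t ->
  (forall k, a <= u k /\ u k <= r k /\ r k <= s) ->
  trivIset setT (fun k => `]u k, r k[%classic) ->
  exists (u' r' : 'I_m.+1 -> R),
   [/\ (forall k, a <= u' k /\ u' k <= r' k /\ r' k <= t),
    trivIset setT (fun k => `]u' k, r' k[%classic) &
    forall h : R -> R -> R,
      \sum_(k < m.+1) h (u' k) (r' k) = \sum_(k < m) h (u k) (r k) + h s t].
Proof.
move=> as_ st hur tur.
pose u' k := if unlift ord_max k is Some j then u j else s.
pose r' k := if unlift ord_max k is Some j then r j else t.
exists u', r'; split.
- move=> k; rewrite /u' /r'; case: unliftP => [j _|_].
    by have [? [? ?]] := hur j; rewrite (le_trans _ st).
  by rewrite as_ st lexx.
- apply/trivIsetP => i j _ _ ij; rewrite /u' /r'.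
  case: unliftP ij => [i' ->|->]; case: unliftP => [j' ->|->] ij.
  + by move/trivIsetP : tur; apply => //; apply: contraNneq ij => ->.
  + apply/seteqP; split => // x [] /=; rewrite !in_itv/= => /andP[_ xr] /andP[sx _].
    by have [_ [_ rs]] := hur i'; have := lt_trans xr (le_lt_trans rs sx); rewrite ltxx.
  + apply/seteqP; split => // x [] /=; rewrite !in_itv/= => /andP[sx _] /andP[_ xr].
    by have [_ [_ rs]] := hur j'; have := lt_trans xr (le_lt_trans rs sx); rewrite ltxx.
  + by rewrite eqxx in ij.
- move=> h; rewrite big_ord_recr/=; congr (_ + h _ _).
  + apply: eq_bigr => k _; rewrite /u' /r'.
    have -> : widen_ord (leqnSn m) k = lift ord_max k.
      by apply: val_inj; rewrite /= /bump leqNgt ltn_ord.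
    by rewrite liftK.
  + by rewrite /u' unlift_none.
  + by rewrite /r' unlift_none.
Qed.

Lemma derivative_diff_at (F : R -> R) (t l : R) :
  derivable F t 1 -> F^`()%classic t = l -> diff_at (F : R -> R^o) t l.
Proof.
move=> dF Fl; apply: is_derive_diff_at; apply: DeriveDef; first exact: dF.
by rewrite -Fl derive1E.
Qed.

Lemma diff_at_sub (F G : R -> R) t k l :
  diff_at (F : R -> R^o) t k -> diff_at (G : R -> R^o) t l ->
  diff_at ((fun x => F x - G x) : R -> R^o) t (k - l).
Proof.
move=> hF hG e e0; have e20 : 0 < e / 2 by rewrite divr_gt0.
have [dF dF0 h1] := hF _ e20; have [dG dG0 h2] := hG _ e20.
exists (Num.min dF dG); first by rewrite lt_min dF0.
move=> x; rewrite lt_min => /andP[/h1 + /h2].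
rewrite /GRing.scale/= => k1 k2.
rewrite (_ : F x - G x - (F t - G t) - (x - t) * (k - l) =
  F x - F t - (x - t) * k - (G x - G t - (x - t) * l)); last ring.
rewrite (le_trans (ler_normB _ _))// (le_trans (lerD k1 k2))//.
by rewrite -mulrDl -splitr.
Qed.

(** The errors at [s] and [t] add up to [e * ((t - c) + (c - s))], exactly [e * (t - s)], because
    [c] lies between them. *)
Lemma diff_at0_straddle (D : R -> R) c e : diff_at (D : R -> R^o) c 0 -> 0 < e ->
  exists2 del, 0 < del & forall s t, s <= c -> c <= t -> c - del < s ->
    t < c + del -> `|D t - D s| <= e * (t - s).
Proof.
move=> h /h[del del0 hdel]; exists del => // s t sc ct cs tc.
have := hdel t; rewrite scaler0 subr0 ger0_norm ?subr_ge0// ltrBlDl => /(_ tc) h1.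
have := hdel s; rewrite scaler0 subr0 (ler0_norm (x := s - c)) ?subr_le0// opprB.
rewrite ltrBlDl -ltrBlDr => /(_ cs) h2.
rewrite (_ : D t - D s = (D t - D c) - (D s - D c)); last ring.
rewrite (le_trans (ler_normB _ _))// (le_trans (lerD h1 h2))//.
by rewrite -mulrDr addrA subrK.
Qed.

Lemma negligible_open_cover (N : set R) e : mu.-negligible N -> 0 < e ->
  exists U : set R, [/\ open U, N `<=` U & (mu U < e%:E)%E].
Proof.
move=> [A [mA A0 NA]] e0.
have Ay : (mu A < +oo)%E by rewrite A0.
have [U [oU AU Ue]] := lebesgue_regularity_outer mA Ay e0.
exists U; split => //; first exact: subset_trans AU.
rewrite -(setDUK AU) (le_lt_trans (measureU2 _ _ _))//.
  by apply: measurableD => //; exact: open_measurable.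
by rewrite [X in (X + _)%E]A0 add0e.
Qed.

Section core.
Variables (a b : R) (F g : R -> R).
Hypothesis ab : a <= b.
Hypothesis acF : abs_continuous_real a b F.
Hypothesis ig : mu.-integrable setT (EFin \o g).
Hypothesis dF : {ae mu, forall t, a <= t <= b -> diff_at (F : R -> R^o) t (g t)}.

Let G t := \int[mu]_(x in `[a, t]) g x.

Let ig' D : measurable D -> mu.-integrable D (EFin \o g).
Proof. by move=> mD; apply: integrableS ig. Qed.

Let dG : {ae mu, forall t, a < t -> diff_at (G : R -> R^o) t (g t)}.
Proof.
have lg : locally_integrable setT g.
  by apply: open_integrable_locally => //; exact: openT.
have iy y : mu.-integrable `[a, y] (EFin \o g) by exact: ig'.
have ? := ae_filter_ringOfSetsType mu.
have := @FTC1 R g (BLeft a) iy lg; apply: filterS => t h at_.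
by have [|? ?] := h; [rewrite lte_fin|exact: derivative_diff_at].
Qed.

(** Its derivative vanishes almost everywhere, so the fundamental theorem reduces to the constancy
    of [D]. *)
Let D t := F t - G t.

Let dD : {ae mu, forall t, a <= t <= b -> diff_at (D : R -> R^o) t 0}.
Proof.
have ? := ae_filter_ringOfSetsType mu.
have na : {ae mu, forall t, t != a}.
  exists [set a]; split => //; first exact: lebesgue_measure_set1.
  by move=> t /= /negP; rewrite negbK => /eqP.
move: na dF dG; apply: filterS3 => t ta h1 h2 /[dup]/h1 {}h1 /andP[at_ _].
have /h2 {}h2 : a < t by rewrite lt_neqAle eq_sym ta.
by rewrite -(subrr (g t)); exact: diff_at_sub.
Qed.

(* Points where D is differentiable are chained by real induction.  The
   exceptional null set is covered by an open set of small measure, on which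
   the total increment is small by absolute continuity. *)
Let nonconstancy_bound e : 0 < e -> `|D b - D a| <= e * (b - a) + e + e.
Proof.
move=> e0.
have [del1 del10 hF] := acF e0.
have [del2 del20 hg] := integrable_small_set measurableT ig e0.
have del12 : 0 < Num.min del1 del2 by rewrite lt_min del10.
have [U [oU NU Udel]] := negligible_open_cover dD del12.
have mU : measurable U by exact: open_measurable.
pose J t := \int[mu]_(x in `[a, t]) (`|g x| * \1_U x).
pose M t := \int[mu]_(x in `[a, t]) \1_U x.
have iJ A : measurable A -> mu.-integrable A (EFin \o (fun x => `|g x| * \1_U x)).
  move=> mA; refine (@dominated_integrableR R _ _ mu A _ (fun x => `|g x|) mA _ _ _).
  - apply: measurable_funM => //.
    by apply: measurableT_comp => //; exact: integrable_measurableR (ig' mA).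
  - move=> x _; rewrite normrM normr_id ler_piMr//.
    by rewrite indicE; case: (x \in U); rewrite ?normr0 ?normr1.
  - exact: integrable_normR (ig' mA).
have iM t : mu.-integrable `[a, t] (EFin \o \1_U).
  refine (@dominated_integrableR R _ _ mu `[a, t] _ (cst 1) _ _ _ _) => //.
  - move=> x _; rewrite indicE; case: (x \in U); rewrite ?normr0 ?normr1//.
  - exact: (integrable_cst_itv (a := a) (b := t)).
(* Invariant of the induction: steps around points of differentiability are charged to
   [e * (t - a)]; steps inside [U] are recorded as disjoint intervals, whose total length is at most
   the measure [M t] of the part of [U] met so far, while [J t] pays for the increments of [G]
   there. *)
pose P t := exists m (u r : 'I_m -> R),
  [/\ (forall k, a <= u k /\ u k <= r k /\ r k <= t),
    trivIset setT (fun k => `]u k, r k[%classic),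
    \sum_(k < m) (r k - u k) <= M t &
    `|D t - D a| <= e * (t - a) + \sum_(k < m) `|F (r k) - F (u k)| + J t].
have mA : measurable (`[a, b] `&` U) by exact: measurableI.
have muA : (mu (`[a, b] `&` U) < (Num.min del1 del2)%:E)%E.
  by apply: le_lt_trans Udel; rewrite le_measure// ?inE.
suff [m [u [r [h1 h2 h3 h4]]]] : P b.
  rewrite (le_trans h4)// lerD//; last first.
    rewrite /J (_ : \int[mu]_(x in _) _ = \int[mu]_(x in `[a, b] `&` U) `|g x|).
      by rewrite ltW// hg// (lt_le_trans muA)// lee_fin ge_min lexx orbT.
    rewrite Rintegral_mkcondr; apply: eq_Rintegral => x _.
    by rewrite patchE indicE; case: (x \in U); rewrite ?mulr1 ?mulr0.
  rewrite lerD2l ltW// hF// (le_lt_trans h3)//.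
  rewrite /M (_ : \int[mu]_(x in _) _ = \int[mu]_(x in `[a, b] `&` U) 1).
    rewrite Rintegral_cst// mul1r -lte_fin fineK; last first.
      by rewrite ge0_fin_numE// (lt_trans muA)// ltry.
    by rewrite (lt_le_trans muA)// lee_fin ge_min lexx.
  rewrite Rintegral_mkcondr; apply: eq_Rintegral => x _.
  by rewrite patchE indicE; case: (x \in U).
apply: (real_induction ab).
- exists 0%N, (fun=> a), (fun=> a); rewrite !big_ord0; split.
  + by case.
  + by apply/trivIsetP => -[].
  + by apply: Rintegral_ge0 => x _; rewrite indicE.
  + rewrite !subrr normr0 mulr0 !add0r; apply: Rintegral_ge0 => x _.
    by rewrite mulr_ge0// indicE.
move=> c acb; have [Uc|Uc] := pselect (U c).
  have [del /= del0 hdel] : \forall x \near c, U x by exact: open_nbhs_nbhs.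
  exists del => // s t /andP[as_ sc] /andP[ct tb] cs tc.
  have st : s <= t := le_trans sc ct.
  have stU : `]s, t] `<=` U.
    move=> x /=; rewrite in_itv/= => /andP[sx xt]; apply: hdel.
    rewrite /= ltr_distlC (lt_trans cs sx)/=.
    by rewrite (le_lt_trans xt).
  move=> [m [u [r [h1 h2 h3 h4]]]].
  have [u' [r' [h1' h2' h']]] := extend_disjoint_family as_ st h1 h2.
  exists m.+1, u', r'; split => //.
  + rewrite (h' (fun x y => y - x)) -lerBrDr.
    rewrite (le_trans h3)// lerBrDr -lerBrDl.
    rewrite /M Rintegral_itv_diff//.
    rewrite (@eq_Rintegral _ _ _ mu `]s, t] (cst 1)); last first.
      by move=> x /set_mem/stU Ux; rewrite indicE mem_set.
    by rewrite Rintegral_cst_oc// mul1r.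
  + rewrite (h' (fun x y => `|F y - F x|)).
    have h5 : `|G t - G s| <= J t - J s.
      rewrite /G /J !Rintegral_itv_diff//; [|exact: iJ|exact: ig'].
      apply: le_norm_Rintegral => //; [exact: ig'|exact: iJ|].
      by move=> x /stU Ux; rewrite indicE mem_set// mulr1.
    have := ler_normD (D t - D s) (D s - D a); rewrite addrA subrK.
    have := ler_normB (F t - F s) (G t - G s).
    rewrite (_ : F t - F s - (G t - G s) = D t - D s); last by rewrite /D; ring.
    have : 0 <= e * (t - s) by rewrite mulr_ge0 ?subr_ge0// ltW.
    by move: h4 h5; rewrite !mulrBr; lra.
(* Outside [U], hence outside the exceptional set, [D] has derivative 0 at [c]; the family is left
   unchanged. *)
have [del del0 hdel] : exists2 del, 0 < del & forall s t, s <= c -> c <= t ->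
    c - del < s -> t < c + del -> `|D t - D s| <= e * (t - s).
  apply: diff_at0_straddle => //; apply: contrapT => nd; apply: Uc.
  by apply: NU => /= /(_ acb).
exists del => // s t /andP[as_ sc] /andP[ct tb] cs tc.
have st : s <= t := le_trans sc ct.
move=> [m [u [r [h1 h2 h3 h4]]]]; exists m, u, r; split => //.
- by move=> k; have [? [? ?]] := h1 k; rewrite (le_trans _ st).
- rewrite (le_trans h3)// -subr_ge0 /M Rintegral_itv_diff//.
  by apply: Rintegral_ge0 => x _; rewrite indicE.
- have Jst : 0 <= J t - J s.
    rewrite /J Rintegral_itv_diff//; last exact: iJ.
    by apply: Rintegral_ge0 => x _; rewrite mulr_ge0// indicE.
  have := hdel _ _ sc ct cs tc.
  have := ler_normD (D t - D s) (D s - D a); rewrite addrA subrK.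
  by move: h4 Jst; rewrite !mulrBr; lra.
Qed.

Lemma ac_FTC_core : F b - F a = \int[mu]_(x in `[a, b]) g x.
Proof.
suff : D b - D a = 0.
  rewrite /D /G set_itv1 Rintegral_set1 subr0 => /eqP.
  by rewrite addrAC subr_eq0 => /eqP.
apply/eqP; rewrite -normr_le0; apply/ler_addgt0Pr => e e0; rewrite add0r.
have k0 : 0 < b - a + 2 by rewrite ltr_wpDl// subr_ge0.
(* The three contributions add up to the tolerance times [b - a + 2], so dividing by that factor
   leaves [e]. *)
rewrite (le_trans (@nonconstancy_bound (e / (b - a + 2)) _)) ?divr_gt0//.
rewrite (_ : _ + _ = e / (b - a + 2) * (b - a + 2)); last ring.
by rewrite divfK// gt_eqF.
Qed.
End core.

Lemma ac_FTC (a b : R) (F g : R -> R) : a <= b ->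
  abs_continuous_real a b F -> mu.-integrable `[a, b] (EFin \o g) ->
  {ae mu, forall t, a <= t <= b -> diff_at (F : R -> R^o) t (g t)} ->
  F b - F a = \int[mu]_(x in `[a, b]) g x.
Proof.
move=> ab acF ig dF; have ig0 : mu.-integrable setT (EFin \o (g \_ `[a, b])).
  by move: ig; rewrite integrable_mkcond// restrict_EFin.
rewrite (@ac_FTC_core a b F (g \_ `[a, b]))//.
  by rewrite -Rintegral_mkcondr setIid.
have ? := ae_filter_ringOfSetsType mu.
apply: filterS dF => t h tab; have := h tab.
by rewrite patchE mem_set//= in_itv.
Qed.

End ac_FTC.

Lemma continuous_coord {R : realType} {n d : nat} (F : 'rV[R]_n -> 'rV[R]_d)
    (j : 'I_d) : continuous F -> continuous (fun y : 'rV[R]_n => F y ord0 j).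
Proof.
by move=> cF y; exact: (continuous_comp (cF y) (@coord_continuous _ _ _ ord0 j _)).
Qed.

Definition ucont_on {R : realType} {n : nat} (T : R) (z : R -> 'rV[R]_n) : Prop :=
  forall e : R, 0 < e -> exists2 del : R, 0 < del & forall s t : R, 0 <= s <= T ->
    0 <= t <= T -> `|t - s| < del -> `|z t - z s| < e.

(** * Particle trajectories *)

Section ucont.
Context {R : realType} {n : nat} (T : R).
Implicit Types z : R -> 'rV[R]_n.

Lemma abs_continuous_ucont_on z : abs_continuous 0 T z -> ucont_on T z.
Proof.
move=> h e /h[del del0 hdel]; exists del => //.
have key s t : 0 <= s -> s <= t -> t <= T -> t - s < del -> `|z t - z s| < e.
  move=> s0 st tT stdel.
  have := hdel 1%N (fun=> s) (fun=> t); rewrite !big_ord1.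
  have tr : trivIset [set: 'I_1] (fun=> `]s, t[%classic).
    by move=> i j _ _ _; rewrite !ord1.
  move=> /(_ _ tr stdel) h1; apply: le_lt_trans (h1 _); last by [].
  exact: norm_le_enorm.
move=> s t /andP[s0 sT] /andP[t0 tT]; have [st|/ltW ts] := leP s t.
  by rewrite ger0_norm ?subr_ge0// => /key; exact.
by rewrite distrC [X in _ -> X < _]distrC ger0_norm ?subr_ge0// => /key; exact.
Qed.

Lemma ucont_onB z z' : ucont_on T z -> ucont_on T z' ->
  ucont_on T (fun t => z t - z' t).
Proof.
move=> h h' e e0; have e20 : 0 < e / 2 by rewrite divr_gt0.
have [d d0 hd] := h _ e20; have [d' d'0 hd'] := h' _ e20.
exists (Num.min d d'); first by rewrite lt_min d0.
move=> s t hs ht; rewrite lt_min => /andP[/(hd _ _ hs ht) h1 /(hd' _ _ hs ht) h2].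
rewrite (_ : z t - z' t - _ = (z t - z s) - (z' t - z' s)); last first.
  by apply/rowP => i; rewrite !mxE; ring.
by rewrite (le_lt_trans (ler_normB _ _))// [e]splitr ltrD.
Qed.

(** Each step of the real induction is shorter than [del] and raises the bound by at most 1. *)
Lemma ucont_on_bounded z : 0 <= T -> ucont_on T z ->
  exists2 B, 0 <= B & forall t, 0 <= t <= T -> `|z t| <= B.
Proof.
move=> T0 /(_ 1 ltr01)[del del0 hdel].
suff [B hB] : exists B, forall t, 0 <= t <= T -> `|z t| <= B.
  by exists B => //; apply: le_trans (hB 0 _) => //; rewrite lexx.
pose P t := exists B, forall s, 0 <= s <= t -> `|z s| <= B.
apply: (real_induction (P := P) T0).
  by exists `|z 0| => s s0; rewrite [s](_ : _ = 0)//; apply: le_anti; rewrite andbC.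
move=> c c0T; exists (del / 2); first by rewrite divr_gt0.
move=> s t /andP[s0 sc] /andP[ct tT] cs tc [B hB].
exists (B + 1) => r /andP[r0 rt].
have [rs|sr] := leP r s.
  by rewrite (le_trans (hB r _)) ?r0// lerDl.
rewrite -[z r](subrK (z s)) (le_trans (ler_normD _ _))// addrC lerD//.
  by rewrite hB// s0/=.
apply/ltW/hdel; first by rewrite s0 (le_trans sc)// (le_trans ct).
  by rewrite r0 (le_trans rt).
by rewrite gtr0_norm ?subr_gt0//; lra.
Qed.

End ucont.

Section caratheodory.
Context {R : realType} {n : nat} (T : R).

Lemma measurable_fun_countable_switch (D : set R) (q : R -> nat) (h : nat -> R -> R) :
  measurable D -> (forall m, measurable (D `&` q @^-1` [set m])) ->
  (forall m, measurable_fun D (h m)) -> measurable_fun D (fun t => h (q t) t).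
Proof.
move=> mD mq mh _ B mB.
rewrite (_ : _ `&` _ =
    \bigcup_m ((D `&` q @^-1` [set m]) `&` (D `&` h m @^-1` B))).
  by apply: bigcupT_measurable => m; apply: measurableI => //; exact: mh.
apply/seteqP; split=> [t [Dt Bt]|t [m _ [[Dt <-] [_ Bt]]]]; last by split.
by exists (q t).
Qed.

(* The state is frozen at the left end of each cell of a grid of step 1/(k+1). *)
Lemma diagonal_measurable (a : R -> R -> R) :
  (forall s, measurable_fun `[0, T] (a s)) ->
  (forall t (s : nat -> R), 0 <= t <= T -> (forall k, 0 <= s k <= T) ->
    s @ \oo --> t -> a (s k) t @[k --> \oo] --> a t t) ->
  measurable_fun `[0, T] (fun t => a t t).
Proof.
move=> ma ca.
pose q (k : nat) (t : R) : nat := Num.truncn (t * k.+1%:R).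
pose g k t := a ((q k t)%:R / k.+1%:R) t.
apply: (@measurable_fun_cvg _ _ _ _ g).
- move=> k; apply: (measurable_fun_countable_switch
    (h := fun m t => a (m%:R / k.+1%:R) t)) => // m.
  rewrite (_ : _ `&` _ = `[0, T] `&` `[m%:R / k.+1%:R, m.+1%:R / k.+1%:R[).
    exact: measurableI.
  apply/seteqP; split=> t /= []; rewrite !in_itv/= => /andP[t0 tT].
    rewrite /q => <-; rewrite t0 tT; split => //.
    have t1 : 0 <= t * k.+1%:R by rewrite mulr_ge0.
    have /andP[h1 h2] := truncn_itv t1.
    by rewrite ler_pdivrMr// ltr_pdivlMr// h1.
  rewrite ler_pdivrMr// ltr_pdivlMr// t0 tT => h; split => //.
  exact: truncn_def.
- move=> t /=; rewrite in_itv/= => /andP[t0 tT].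
  have t1 k : 0 <= t * k.+1%:R by rewrite mulr_ge0.
  apply: ca; first by rewrite t0.
    move=> k; have /andP[h1 h2] := truncn_itv (t1 k).
    by rewrite divr_ge0//= (le_trans _ tT)// ler_pdivrMr.
  apply/cvgrPdist_lt => e e0.
  have [k0 _ hk0] := near_infty_natSinv_lt (PosNum e0).
  exists k0 => // k /hk0 /= ke; have /andP[h1 h2] := truncn_itv (t1 k).
  rewrite ger0_norm; last by rewrite subr_ge0 ler_pdivrMr.
  apply: le_lt_trans ke; rewrite lerBlDl -[X in _ <= _ + X]mul1r -mulrDl.
  by rewrite ler_pdivlMr// natr1 ltW.
Qed.

Lemma ucont_on_cvg (z : R -> 'rV[R]_n) t (s : nat -> R) : ucont_on T z -> 0 <= t <= T ->
  (forall k, 0 <= s k <= T) -> s @ \oo --> t -> z (s k) @[k --> \oo] --> z t.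
Proof.
move=> uz tT sT st; apply/cvgrPdist_lt => e e0; have [del del0 hdel] := uz e e0.
move/cvgrPdist_lt : st => /(_ _ del0); apply: filterS => k; exact: hdel.
Qed.

Lemma caratheodory_comp_measurable (f : R -> 'rV[R]_n -> R) (z : R -> 'rV[R]_n) :
  (forall y, measurable_fun `[0, T] (fun t => f t y)) ->
  (forall t, t \in `[0, T] -> continuous (f t)) -> ucont_on T z ->
  measurable_fun `[0, T] (fun t => f t (z t)).
Proof.
move=> mf cf uz; apply: (diagonal_measurable (a := fun s t => f t (z s))) => //.
move=> t s tT sT st; have ct : continuous (f t) by apply: cf; rewrite in_itv.
exact: (cvg_comp _ _ (ucont_on_cvg uz tT sT st) (ct (z t))).
Qed.

End caratheodory.

Lemma Caratheodory_coord_measurable {R : realType} {n d : nat} (T : R)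
    (f : R -> 'rV[R]_n -> 'rV[R]_d) (z : R -> 'rV[R]_n) j :
  Caratheodory T f -> ucont_on T z ->
  measurable_fun `[0, T] (fun t => f t (z t) ord0 j).
Proof.
move=> [mf cf] uz.
apply: (caratheodory_comp_measurable (f := fun t y => f t y ord0 j)) => //.
  by move=> y; exact: measurableT_comp (measurable_coord j) (mf y).
by move=> t tT; apply: continuous_coord; exact: cf.
Qed.

Lemma continuous_comp_measurable {R : realType} {n : nat} (T : R)
    (F : 'rV[R]_n -> R) (z : R -> 'rV[R]_n) :
  continuous F -> ucont_on T z -> measurable_fun `[0, T] (fun t => F (z t)).
Proof.
by move=> cF uz; apply: (caratheodory_comp_measurable (f := fun=> F)).
Qed.

(** * Gronwall's inequality with an integrable kernel *)

Section gronwall.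
Context {R : realType}.
Notation mu := (@lebesgue_measure R).
Implicit Types (u lam : R -> R).

Lemma integrable_itvS (T t : R) (f : R -> R) : t <= T ->
  mu.-integrable `[0, T] (EFin \o f) -> mu.-integrable `[0, t] (EFin \o f).
Proof.
move=> tT; apply: integrableS => //; apply: subset_itvl; by rewrite bnd_simp.
Qed.

(** With [S] the supremum of [u] on the piece, the kernel integral of at most 1/2 gives
    [S <= A + S / 2], so [S <= 2A] and the right-hand side is at most [A + S / 2 <= 2A]. The a
    priori bound [B] makes [S] finite. *)
Lemma gronwall_step (lam u : R -> R) (s t B A c : R) : 0 <= s -> s <= t ->
  mu.-integrable `[0, t] (EFin \o lam) ->
  mu.-integrable `[0, t] (EFin \o (fun x => lam x * u x)) ->
  (forall x, 0 <= x <= t -> 0 <= lam x) ->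
  (forall x, 0 <= x <= t -> u x <= B) ->
  \int[mu]_(x in `]s, t]) lam x <= 2^-1 ->
  (forall x, 0 <= x <= t -> u x <= c + \int[mu]_(y in `[0, x]) (lam y * u y)) ->
  0 <= A -> c + \int[mu]_(y in `[0, s]) (lam y * u y) <= A ->
  c + \int[mu]_(y in `[0, t]) (lam y * u y) <= 2 * A.
Proof.
move=> s0 st il ilu lam0 uB half hu A0 hA.
pose S := sup [set u x | x in `[s, t]].
have hS : has_sup [set u x | x in `[s, t]].
  split; first by exists (u s), s => //=; rewrite in_itv/= lexx.
  exists B => y [x /=]; rewrite in_itv/= => /andP[sx xt] <-.
  by apply: uB; rewrite (le_trans s0)//.
have ltt x : s <= x -> x <= t -> x <= t by [].
have uS x : s <= x -> x <= t -> u x <= S.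
  move=> sx xt; apply: ub_le_sup => //; first exact: hS.2.
  by exists x => //=; rewrite in_itv/= sx.
have ioc x : x <= t -> mu.-integrable `]s, x] (EFin \o lam).
  move=> xt; apply: integrableS il => //.
  by apply: subset_itv; rewrite bnd_simp.
have lam_le x : s <= x -> x <= t -> \int[mu]_(y in `]s, x]) lam y <= 2^-1.
  move=> sx xt; apply: le_trans half.
  have /= := @Rintegral_itvB R lam (BRight s) (BRight t) x (ioc _ (lexx t)).
  rewrite !bnd_simp => /(_ sx xt) => /eqP.
  rewrite subr_eq => /eqP ->; rewrite lerDr; apply: Rintegral_ge0 => y /=.
  rewrite in_itv/= => /andP[xy yt]; apply: lam0.
  by rewrite (le_trans s0 (le_trans sx (ltW xy))).
have key x : 0 <= S -> s <= x -> x <= t ->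
    c + \int[mu]_(y in `[0, x]) (lam y * u y) <= A + S / 2.
  move=> S0 sx xt.
  have ix := integrable_itvS xt ilu.
  have := Rintegral_itv_diff s0 sx ix => /eqP.
  rewrite subr_eq => /eqP ->; rewrite addrCA addrC lerD//.
  rewrite (@le_trans _ _ (\int[mu]_(y in `]s, x]) (S * lam y)))//.
    apply: le_Rintegral => //.
    - by apply: integrableS ix => //; apply: subset_itv; rewrite bnd_simp.
    - by apply: integrable_scaleR => //; exact: ioc.
    - move=> y /=; rewrite in_itv/= => /andP[sy yx].
      rewrite mulrC ler_wpM2r//.
        by apply: lam0; rewrite (le_trans s0 (ltW sy)) (le_trans yx xt).
      exact: uS (ltW sy) (le_trans yx xt).
  rewrite RintegralZl//; last exact: ioc.
  by rewrite ler_wpM2l// lam_le.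
(* If [S < 0] then [u] is negative on the piece and the integral only decreases, so the bound [A]
   persists. *)
have [S0|S0] := leP 0 S; last first.
  have iy : mu.-integrable `]s, t] (EFin \o (fun x => lam x * u x)).
    by apply: integrableS ilu => //; apply: subset_itv; rewrite bnd_simp.
  have := Rintegral_itv_diff s0 st ilu => /eqP.
  rewrite subr_eq => /eqP ->.
  have : \int[mu]_(y in `]s, t]) (lam y * u y) <= 0.
    rewrite -oppr_ge0 -[leRHS]mulN1r -RintegralZl//.
    apply: Rintegral_ge0 => y /=; rewrite in_itv/= => /andP[sy yt].
    rewrite mulN1r oppr_ge0 mulr_ge0_le0//.
      by apply: lam0; rewrite (le_trans s0 (ltW sy)) yt.
    exact: le_trans (uS _ (ltW sy) yt) (ltW S0).
  by move: hA A0; lra.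
have : S <= A + S / 2.
  apply: ge_sup; first exact: hS.1.
  move=> y [x /=]; rewrite in_itv/= => /andP[sx xt] <-.
  apply: le_trans (key x S0 sx xt); apply: hu.
  by rewrite (le_trans s0).
have := key t S0 st (lexx t); lra.
Qed.

(* The interval is cut into finitely many pieces on which lam has integral at
   most 1/2; the bound at most doubles on each of them. *)
Lemma gronwall (T : R) lam : 0 <= T ->
  mu.-integrable `[0, T] (EFin \o lam) ->
  (forall t, 0 <= t <= T -> 0 <= lam t) ->
  exists2 K, 1 <= K & forall u B c t, 0 <= t <= T -> 0 <= c ->
    measurable_fun `[0, t] u ->
    (forall s, 0 <= s <= t -> 0 <= u s <= B) ->
    (forall s, 0 <= s <= t -> u s <= c + \int[mu]_(y in `[0, s]) (lam y * u y)) ->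
    u t <= K * c.
Proof.
move=> T0 il lam0.
have h20 : 0 < 2^-1 :> R by rewrite invr_gt0.
have mT : measurable `[0, T] by exact: measurable_itv.
have [del del0 hdel] := integrable_small_set mT il h20.
have [m hm] : exists m : nat, T / m.+1%:R < del.
  (* Dividing by [T + 1] remains legitimate when [T = 0]. *)
  have T10 : 0 < T + 1 by rewrite ltr_wpDl.
  have [m _ /(_ m (leqnn m)) /= hm] := near_infty_natSinv_lt
    (PosNum (divr_gt0 del0 T10)).
  exists m; apply: (@le_lt_trans _ _ ((T + 1) * m.+1%:R^-1)).
    by rewrite ler_wpM2r ?invr_ge0// lerDl.
  by move: hm; rewrite ltr_pdivlMr// mulrC.
exists (2 ^+ m.+1) => [|u B c t /andP[t0 tT] c0 mu_u uB hu].
  by rewrite exprn_ege1// ler1n.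
have ilt := integrable_itvS tT il.
have ilu : mu.-integrable `[0, t] (EFin \o (fun x => lam x * u x)).
  refine (@dominated_integrableR R _ _ mu `[0, t] _ (fun x => B * lam x) _ _ _ _) => //.
  - by apply: measurable_funM => //; exact: integrable_measurableR ilt.
  - move=> x /=; rewrite in_itv/= => /andP[x0 xt].
    have /andP[u0 uxB] : 0 <= u x <= B by rewrite uB// x0.
    have l0 : 0 <= lam x by rewrite lam0// x0 (le_trans xt).
    by rewrite ger0_norm ?mulr_ge0// mulrC ler_wpM2r.
  - by apply: integrable_scaleR => //; exact: ilt.
have claim k x : 0 <= x -> x <= t -> x <= k%:R * (T / m.+1%:R) ->
    c + \int[mu]_(y in `[0, x]) (lam y * u y) <= 2 ^+ k * c.
  elim: k x => [|k IH] x x0 xt xk.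
    have -> : x = 0 by apply/eqP; rewrite eq_le x0 andbT; move: xk; rewrite mul0r.
    by rewrite set_itv1 Rintegral_set1 addr0 expr0 mul1r.
  have Tm0 : 0 <= T / m.+1%:R by rewrite divr_ge0.
  (* The last grid point not beyond [x]: the induction hypothesis applies at [s], and the rest
     [x - s] is at most one cell. *)
  pose s := Num.min x (k%:R * (T / m.+1%:R)).
  have s0 : 0 <= s by rewrite le_min x0 mulr_ge0.
  have sx : s <= x by rewrite ge_min lexx.
  have sdel : x - s < del.
    apply: le_lt_trans hm; rewrite lerBlDr -lerBlDl le_min.
    rewrite lerBlDl lerDr Tm0/= lerBlDl.
    by move: xk; rewrite -natr1 mulrDl mul1r addrC.
  rewrite exprS -mulrA; apply: (@gronwall_step lam u s x B) => //.
  - exact: integrable_itvS ilt.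
  - exact: integrable_itvS ilu.
  - by move=> y /andP[y0 yx]; rewrite lam0// y0 (le_trans yx)// (le_trans xt).
  - by move=> y /andP[y0 yx]; have /andP[] : 0 <= u y <= B by rewrite uB// y0 (le_trans yx).
  - have soc : `]s, x] `<=` `[0, T].
      by apply: subset_itv; rewrite bnd_simp// (le_trans xt).
    rewrite (@le_trans _ _ (\int[mu]_(y in `]s, x]) `|lam y|))//.
      rewrite (@eq_Rintegral _ _ _ mu _ lam (fun y => `|lam y|))//.
      move=> y /set_mem /soc /=; rewrite in_itv/= => yT.
      by rewrite ger0_norm// lam0.
    rewrite ltW// hdel// lebesgue_measure_itv/= lte_fin.
    by case: ifP => _; rewrite -?EFinB lte_fin.
  - by move=> y /andP[y0 yx]; rewrite hu// y0 (le_trans yx).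
  - by rewrite mulr_ge0// exprn_ge0.
  - by apply: IH => //; [rewrite (le_trans sx)|rewrite ge_min lexx orbT].
rewrite (le_trans (hu t _)) ?t0 ?lexx//.
apply: claim => //; rewrite (le_trans tT)// mulrCA divff ?mulr1//.
Qed.
End gronwall.

Lemma le_norm_Rintegral_ae {R : realType} d (X : measurableType d)
    (mu : {measure set X -> \bar R}) (D : set X) (f g : X -> R) :
  measurable D -> mu.-integrable D (EFin \o f) ->
  mu.-integrable D (EFin \o g) -> (forall x, D x -> 0 <= g x) ->
  {ae mu, forall x, D x -> `|f x| <= g x} ->
  `|\int[mu]_(x in D) f x| <= \int[mu]_(x in D) g x.
Proof.
move=> mD fi gi g0 fg; rewrite (le_trans (le_normr_Rintegral _ _))//.
have nfi := integrable_normR fi.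
apply: fine_le; [exact: integrable_fin_num nfi|exact: integrable_fin_num gi|].
apply: ae_ge0_le_integral => //.
- by apply/measurable_EFinP; exact: integrable_measurableR nfi.
- by apply/measurable_EFinP; exact: integrable_measurableR gi.
Qed.

Lemma dominated_integrableR_ae {R : realType} d (X : measurableType d)
    (mu : {measure set X -> \bar R}) (D : set X) (f g : X -> R) :
  measurable D -> measurable_fun D f -> (forall x, D x -> 0 <= g x) ->
  {ae mu, forall x, D x -> `|f x| <= g x} ->
  mu.-integrable D (EFin \o g) -> mu.-integrable D (EFin \o f).
Proof.
move=> mD mf g0 fg gi; apply/integrableP; split; first exact/measurable_EFinP.
apply: (@le_lt_trans _ _ (\int[mu]_(x in D) (g x)%:E)%E).
  apply: ae_ge0_le_integral => //.
  - by do 2 apply: measurableT_comp => //.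
  - by apply/measurable_EFinP; exact: integrable_measurableR gi.
move/integrableP : gi => [_]; apply: le_lt_trans.
rewrite le_eqVlt; apply/orP; left; apply/eqP; apply: eq_integral => x /set_mem Dx.
by rewrite /= ger0_norm// g0.
Qed.

Lemma norm_row_mx {R : realType} {n m : nat} (a : 'rV[R]_n) (b : 'rV[R]_m) :
  `|row_mx a b| <= `|a| + `|b|.
Proof.
apply: norm_le_coord => [|i]; first exact: addr_ge0.
rewrite mxE; case: splitP => j _.
  by rewrite (le_trans (coord_le_norm _ _))// lerDl.
by rewrite (le_trans (coord_le_norm _ _))// lerDr.
Qed.

Lemma norm_rsubmx {R : realType} {n m : nat} (z : 'rV[R]_(n + m)) :
  `|rsubmx z| <= `|z|.
Proof. by apply: norm_le_coord => // i; rewrite mxE coord_le_norm. Qed.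

(** Coordinatewise Volterra form of the system. It carries continuity of the trajectories and
    integrability of the field along them, so the stability estimates need neither derivatives nor
    exceptional times of the trajectories. *)
Definition integral_solution {R : realType} {d : nat} (T : R)
    (H : 'rV[R]_(d + d) -> 'rV[R]_d) (f : R -> 'rV[R]_(d + d) -> 'rV[R]_d)
    (N : nat) (z : 'I_N.+1 -> R -> 'rV[R]_(d + d)) : Prop :=
  forall i, ucont_on T (z i) /\ forall j,
   let w s := wfield H (fun s => empirical (z^~ s)) f s (z i s) ord0 j in
   lebesgue_measure.-integrable `[0, T] (EFin \o w) /\
   forall t, 0 <= t <= T ->
    z i t ord0 j - z i 0 ord0 j = \int[lebesgue_measure]_(s in `[0, t]) w s.

Section particles.
Context {R : realType} {d : nat} (T : R).
Variables (H : 'rV[R]_(d + d) -> 'rV[R]_d).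
Variables (f : R -> 'rV[R]_(d + d) -> 'rV[R]_d) (CH : R) (kf : R -> R).
Notation mu := (@lebesgue_measure R).
Hypothesis T0 : 0 <= T.
Hypothesis cH : continuous H.
Hypothesis CH0 : 0 <= CH.
Hypothesis HC : forall z, `|H z| <= CH * (1 + `|z|).
Hypothesis cf : Caratheodory T f.
Hypothesis kf0 : forall t, 0 <= kf t.
Hypothesis ikf : mu.-integrable `[0, T] (EFin \o kf).
Hypothesis f_ae : {ae mu, forall t, 0 <= t <= T ->
  (forall z, `|f t z| <= kf t * (1 + `|z|)) /\
  (forall z z', `|f t z - f t z'| <= kf t * `|z - z'|)}.

Lemma norm_conv_empirical N (zs : 'I_N.+1 -> 'rV[R]_(d + d)) z :
  `|Defs.conv H (empirical zs) z| <=
  CH * (1 + `|z| + N.+1%:R^-1 * \sum_(i < N.+1) `|zs i|).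
Proof.
rewrite conv_empirical// normrZ ger0_norm ?invr_ge0//.
rewrite (le_trans (ler_wpM2l _ (ler_norm_sum _ _ _))) ?invr_ge0//.
rewrite (@le_trans _ _ (N.+1%:R^-1 * \sum_(i < N.+1) (CH * (1 + `|z|) + CH * `|zs i|)))//.
  rewrite ler_wpM2l ?invr_ge0//; apply: ler_sum => i _.
  rewrite (le_trans (HC _))// -mulrDr ler_wpM2l// -addrA lerD2l.
  exact: ler_normB.
rewrite big_split/= sumr_const card_ord -[X in X + _]mulr_natl mulrDr.
by rewrite mulKf ?pnatr_eq0// -mulr_sumr mulrCA -mulrDr.
Qed.

Let lam t := 1 + CH + kf t.

Lemma norm_wfield N (zs : 'I_N.+1 -> R -> 'rV[R]_(d + d)) t z :
  (forall y, `|f t y| <= kf t * (1 + `|y|)) ->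
  `|wfield H (fun s => empirical (zs^~ s)) f t z| <=
  lam t * (1 + `|z| + N.+1%:R^-1 * \sum_(i < N.+1) `|zs i t|).
Proof.
move=> hf; rewrite (le_trans (norm_row_mx _ _))//.
have := ler_normD (Defs.conv H (empirical (zs^~ t)) z) (f t z).
have := norm_conv_empirical (zs^~ t) z.
have := hf z; have := norm_rsubmx z.
set m := _ * \sum_(i < _) _; have m0 : 0 <= m.
  by rewrite mulr_ge0 ?invr_ge0// sumr_ge0.
have : 0 <= kf t * m by rewrite mulr_ge0.
rewrite /lam; have := normr_ge0 z; rewrite /=; lra.
Qed.

(** The finitely many trajectories are bounded by a common [B] on [[0, T]], so the field along them
    is dominated by [(1 + B + B) * lam]. The fundamental theorem for absolutely continuous functions
    then applies to each coordinate. *)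
Lemma particle_integral_solution N x0 v0 (x v : 'I_N.+1 -> R -> 'rV[R]_d) :
  particle_solution T H f x0 v0 x v ->
  integral_solution T H f (fun i t => row_mx (x i t) (v i t)).
Proof.
move=> hp.
pose z i t := row_mx (x i t) (v i t).
have uz i : ucont_on T (z i).
  have [/abs_continuous_ucont_on hx /abs_continuous_ucont_on hv _ _ _] := hp i.
  move=> e e0; have e20 : 0 < e / 2 by rewrite divr_gt0.
  have [d1 d10 h1] := hx _ e20; have [d2 d20 h2] := hv _ e20.
  exists (Num.min d1 d2); first by rewrite lt_min d10.
  move=> s t hs ht; rewrite lt_min => /andP[/(h1 _ _ hs ht) k1 /(h2 _ _ hs ht) k2].
  rewrite (_ : z i t - z i s = row_mx (x i t - x i s) (v i t - v i s)); last first.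
    by rewrite opp_row_mx add_row_mx.
  by rewrite (le_lt_trans (norm_row_mx _ _))// [e]splitr ltrD.
have bz : exists2 B, 0 <= B & forall i t, 0 <= t <= T -> `|z i t| <= B.
  have hb i := ucont_on_bounded T0 (uz i).
  have /choice[B hB] : forall i, exists B, 0 <= B /\
      forall t, 0 <= t <= T -> `|z i t| <= B.
    by move=> i; have [B ? ?] := hb i; exists B.
  exists (\sum_i B i); first by apply: sumr_ge0 => i _; have [] := hB i.
  move=> i t /(hB i).2 /le_trans; apply; rewrite (bigD1 i)//= lerDl.
  by apply: sumr_ge0 => k _; have [] := hB k.
have [B B0 zB] := bz.
move=> i; split; first exact: uz.
move=> j w.
have mw : measurable_fun `[0, T] w.
  rewrite /w /wfield; case: (split_ordP j) => j' jE.
    rewrite [X in measurable_fun _ X](_ : _ = fun s => z i s ord0 (rshift d j')).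
      by apply: (continuous_comp_measurable (F := fun y => y ord0 _) _ (uz i)) => y;
        exact: coord_continuous.
    by apply/funext => s; rewrite jE row_mxEl mxE.
  rewrite [X in measurable_fun _ X](_ : _ = fun s => N.+1%:R^-1 *
      (\sum_k H (z i s - z k s) ord0 j') + f s (z i s) ord0 j'); last first.
    apply/funext => s; rewrite jE row_mxEr mxE conv_empirical// mxE summxE.
    by [].
  apply: measurable_funD; last exact: Caratheodory_coord_measurable.
  apply: measurable_funM => //; apply: measurable_sum => k.
  apply: (continuous_comp_measurable (F := fun y => H y ord0 j')).
    exact: continuous_coord.
  by apply: ucont_onB; exact: uz.
have iw : mu.-integrable `[0, T] (EFin \o w).
  refine (@dominated_integrableR_ae R _ _ mu `[0, T] w
    (fun s => (1 + B + B) * lam s) _ mw _ _ _) => //.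
  - by move=> s _; rewrite mulr_ge0 ?addr_ge0.
  - have ? := ae_filter_ringOfSetsType mu.
    apply: filterS f_ae => s hs; rewrite /= in_itv/= => /[dup] sT /hs[hfs _].
    rewrite /w (le_trans (coord_le_norm _ _))// (le_trans (norm_wfield _ _ hfs))//.
    rewrite mulrC ler_wpM2r ?addr_ge0// -!addrA lerD2l lerD ?zB//.
    rewrite ler_pdivrMl// mulr_natl.
    rewrite -[X in _ *+ X](card_ord N.+1) -sumr_const.
    by apply: ler_sum => k _; exact: zB.
  - apply: integrable_scaleR => //; apply: integrable_addR => //.
    exact: (integrable_cst_itv (a := 0) (b := T)).
split => // t /andP[t0 tT].
apply: (ac_FTC (F := fun t => z i t ord0 j) t0).
- have [hx hv _ _ _] := hp i.
  move=> e e0; rewrite /z; case: (split_ordP j) => j' ->.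
    have [del del0 hdel] := abs_continuous_coord j' hx e0.
    exists del => // m s r hsr tsr /hdel h.
    under eq_bigr do rewrite !row_mxEl; apply: h => // k.
    by have [? [? rt]] := hsr k; rewrite (le_trans rt).
  have [del del0 hdel] := abs_continuous_coord j' hv e0.
  exists del => // m s r hsr tsr /hdel h.
  under eq_bigr do rewrite !row_mxEr; apply: h => // k.
  by have [? [? rt]] := hsr k; rewrite (le_trans rt).
- exact: integrable_itvS iw.
- have [_ _ _ _ hd] := hp i.
  have ? := ae_filter_ringOfSetsType mu.
  apply: filterS hd => s hs /andP[s0 st].
  have [|hx hv] := hs; first by rewrite in_itv/= s0 (le_trans st).
  rewrite /w /wfield /z; case: (split_ordP j) => j' ->.
    rewrite row_mxEl row_mxKr.
    have := diff_at_coord j' (is_derive_diff_at hx).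
    by congr diff_at; apply/funext => y; rewrite row_mxEl.
  rewrite row_mxEr.
  have := diff_at_coord j' (is_derive_diff_at hv).
  by congr diff_at; apply/funext => y; rewrite row_mxEr.
Qed.

End particles.

Section forced_gronwall.
Context {R : realType}.
Notation mu := (@lebesgue_measure R).

Lemma integrableM_bounded (D : set R) (f g : R -> R) (B : R) :
  measurable D -> mu.-integrable D (EFin \o f) -> measurable_fun D g ->
  (forall x, D x -> `|g x| <= B) ->
  mu.-integrable D (EFin \o (fun x => f x * g x)).
Proof.
move=> mD fi mg gB.
refine (@dominated_integrableR R _ _ mu D _ (fun x => B * `|f x|) mD _ _ _).
- by apply: measurable_funM => //; exact: integrable_measurableR fi.
- by move=> x Dx; rewrite normrM mulrC ler_wpM2r// gB.
- by apply: integrable_scaleR => //; exact: integrable_normR.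
Qed.

Lemma le_Rintegral_itv (T s t : R) (f : R -> R) : s <= t -> t <= T ->
  mu.-integrable `[0, T] (EFin \o f) -> (forall x, 0 <= x <= T -> 0 <= f x) ->
  \int[mu]_(x in `[0, s]) f x <= \int[mu]_(x in `[0, t]) f x.
Proof.
move=> st tT fi f0.
have [s0|s0] := leP 0 s; last first.
  rewrite set_itv_ge; last by rewrite bnd_simp -ltNge.
  rewrite Rintegral_set0; apply: Rintegral_ge0 => x /=.
  by rewrite in_itv/= => /andP[x0 xt]; rewrite f0// x0 (le_trans xt).
rewrite -subr_ge0 (Rintegral_itv_diff s0 st (integrable_itvS tT fi)).
apply: Rintegral_ge0 => x /=; rewrite in_itv/= => /andP[sx xt].
by rewrite f0// (le_trans s0 (ltW sx)) (le_trans xt).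
Qed.

(** The forcing is non-negative, so its integral up to [s] is at most that up to [t]. With [t] fixed
    it joins the constant [c], and the unforced inequality applies on [[0, t]]. *)
Lemma gronwall_forced (T : R) (lam : R -> R) : 0 <= T ->
  mu.-integrable `[0, T] (EFin \o lam) ->
  (forall t, 0 <= t <= T -> 0 <= lam t) ->
  exists2 K : R, 1 <= K & forall (u beta : R -> R) (B c t : R), 0 <= t <= T -> 0 <= c ->
    measurable_fun `[0, T] u ->
    (forall s, 0 <= s <= T -> 0 <= u s <= B) ->
    mu.-integrable `[0, T] (EFin \o beta) ->
    (forall s, 0 <= s <= T -> 0 <= beta s) ->
    (forall s, 0 <= s <= T ->
      u s <= c + \int[mu]_(y in `[0, s]) (lam y * u y + beta y)) ->
    u t <= K * (c + \int[mu]_(y in `[0, t]) beta y).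
Proof.
move=> T0 il lam0; have [K K1 hK] := gronwall T0 il lam0.
exists K => // u beta B c t /andP[t0 tT] c0 mu_u uB ib beta0 hu.
have leT s : s <= t -> s <= T by move=> /le_trans; apply.
apply: (hK u B _ t) => //.
- by rewrite t0.
- rewrite addr_ge0//; apply: Rintegral_ge0 => x /=; rewrite in_itv/= => /andP[x0 xt].
  by rewrite beta0// x0 leT.
- by apply: measurable_funS mu_u => //; apply: subset_itvl; rewrite bnd_simp.
- by move=> s /andP[s0 st]; rewrite uB// s0 leT.
- move=> s /andP[s0 st].
  have ilu : mu.-integrable `[0, T] (EFin \o (fun y => lam y * u y)).
    apply: (integrableM_bounded (B := B)) => // x /=; rewrite in_itv/= => xT.
    by have /andP[u0 ?] := uB x xT; rewrite ger0_norm.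
  rewrite (le_trans (hu s _)) ?s0 ?leT//.
  rewrite RintegralD//; [|exact: integrable_itvS (leT _ st) ilu|
    exact: integrable_itvS (leT _ st) ib].
  rewrite addrA addrAC lerD2r lerD2l.
  exact: le_Rintegral_itv ib beta0.
Qed.

End forced_gronwall.

(** * Growth and stability estimates uniform in the number of particles *)

Section estimates.
Context {R : realType} {d : nat} (T : R).
Variables (H : 'rV[R]_(d + d) -> 'rV[R]_d).
Variables (f : R -> 'rV[R]_(d + d) -> 'rV[R]_d) (CH : R) (kf : R -> R).
Notation mu := (@lebesgue_measure R).
Notation n := (d + d)%N.
Hypothesis T0 : 0 <= T.
Hypothesis cH : continuous H.
Hypothesis CH0 : 0 <= CH.
Hypothesis HC : forall z, `|H z| <= CH * (1 + `|z|).
Hypothesis HL : forall r, exists2 L, 0 <= L & forall z z', `|z| <= r ->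
  `|z'| <= r -> `|H z - H z'| <= L * `|z - z'|.
Hypothesis kf0 : forall t, 0 <= kf t.
Hypothesis ikf : mu.-integrable `[0, T] (EFin \o kf).
Hypothesis f_ae : {ae mu, forall t, 0 <= t <= T ->
  (forall z, `|f t z| <= kf t * (1 + `|z|)) /\
  (forall z z', `|f t z - f t z'| <= kf t * `|z - z'|)}.

(** The summands account for the velocity component, the convolution and the forcing. *)
Definition rate (t : R) := 1 + CH + kf t.

Lemma rate_ge0 t : 0 <= rate t.
Proof. by rewrite !addr_ge0. Qed.

Lemma integrable_rate : mu.-integrable `[0, T] (EFin \o rate).
Proof.
apply: integrable_addR => //.
exact: (integrable_cst_itv (a := 0) (b := T)).
Qed.

Definition avg_norm N (z : 'I_N.+1 -> R -> 'rV[R]_n) t :=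
  N.+1%:R^-1 * \sum_(i < N.+1) `|z i t|.

Lemma avg_norm_ge0 N (z : 'I_N.+1 -> R -> 'rV[R]_n) t : 0 <= avg_norm z t.
Proof. by rewrite mulr_ge0 ?invr_ge0// sumr_ge0. Qed.

Lemma measurable_norm_ucont (z : R -> 'rV[R]_n) : ucont_on T z ->
  measurable_fun `[0, T] (fun t => `|z t|).
Proof. by apply: continuous_comp_measurable; exact: norm_continuous. Qed.

Lemma norm_itv_bounded (z : R -> 'rV[R]_n) : ucont_on T z ->
  exists2 B, 0 <= B & forall t, 0 <= t <= T -> `|z t| <= B.
Proof. exact: ucont_on_bounded. Qed.

Section one_system.
Variables (N : nat) (z : 'I_N.+1 -> R -> 'rV[R]_n).
Hypothesis hz : integral_solution T H f z.

Lemma measurable_avg_norm : measurable_fun `[0, T] (avg_norm z).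
Proof.
apply: measurable_funM => //; apply: measurable_sum => i.
by apply: measurable_norm_ucont; have [] := hz i.
Qed.

Lemma avg_norm_bounded : exists2 B, 0 <= B &
  forall t, 0 <= t <= T -> 0 <= avg_norm z t <= B.
Proof.
have /choice[B hB] : forall i, exists B, 0 <= B /\
    forall t, 0 <= t <= T -> `|z i t| <= B.
  by move=> i; have [B ? ?] := norm_itv_bounded (hz i).1; exists B.
exists (N.+1%:R^-1 * \sum_i B i).
  by rewrite mulr_ge0 ?invr_ge0// sumr_ge0// => i _; have [] := hB i.
move=> t tT; rewrite avg_norm_ge0/= ler_wpM2l ?invr_ge0//.
by apply: ler_sum => i _; exact: (hB i).2.
Qed.

Lemma integrable_rate_growth i :
  mu.-integrable `[0, T]
    (EFin \o (fun s => rate s * (1 + `|z i s| + avg_norm z s))).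
Proof.
have [B B0 hB] := norm_itv_bounded (hz i).1; have [C C0 hC] := avg_norm_bounded.
apply: (integrableM_bounded (B := 1 + B + C)) => //.
- exact: integrable_rate.
- apply: measurable_funD; last exact: measurable_avg_norm.
  by apply: measurable_funD => //; apply: measurable_norm_ucont; have [] := hz i.
- move=> x /=; rewrite in_itv/= => xT.
  have /andP[a0 aC] := hC x xT.
  by rewrite ger0_norm ?addr_ge0// !lerD// hB.
Qed.

Lemma particle_increment i s t : 0 <= s -> s <= t -> t <= T ->
  `|z i t - z i s| <=
  \int[mu]_(y in `]s, t]) (rate y * (1 + `|z i y| + avg_norm z y)).
Proof.
move=> s0 st tT; have sT := le_trans st tT; have t0 := le_trans s0 st.
have oc (g : R -> R) : mu.-integrable `[0, T] (EFin \o g) ->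
    mu.-integrable `]s, t] (EFin \o g).
  by apply: integrableS => //; apply: subset_itv; rewrite bnd_simp.
have ig := integrable_rate_growth i.
have g0 y : `]s, t]%classic y -> 0 <= rate y * (1 + `|z i y| + avg_norm z y).
  by move=> _; rewrite mulr_ge0 ?rate_ge0// !addr_ge0// avg_norm_ge0.
apply: norm_le_coord => [|j]; first exact: Rintegral_ge0.
have [_ /(_ j)[iw hw]] := hz i.
rewrite !mxE; rewrite (_ : z i t ord0 j - z i s ord0 j =
  (z i t ord0 j - z i 0 ord0 j) - (z i s ord0 j - z i 0 ord0 j)); last ring.
rewrite !hw ?t0 ?s0// Rintegral_itv_diff//; last exact: integrable_itvS iw.
apply: le_norm_Rintegral_ae => //; [exact: oc|exact: oc|].
have ? := ae_filter_ringOfSetsType mu.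
apply: filterS f_ae => y hy /=; rewrite in_itv/= => /andP[sy yt].
have [|hf _] := hy; first by rewrite (le_trans s0 (ltW sy)) (le_trans yt).
rewrite (le_trans (coord_le_norm _ _))//.
exact: (norm_wfield cH CH0 HC).
Qed.

Lemma particle_growth i t : 0 <= t <= T -> `|z i t| <= `|z i 0| +
  \int[mu]_(y in `[0, t]) (rate y * (1 + `|z i y| + avg_norm z y)).
Proof.
move=> /andP[t0 tT]; rewrite -[z i t](subrK (z i 0)) (le_trans (ler_normD _ _))//.
rewrite addrC lerD2l (le_trans (particle_increment _ _ _ _))//.
rewrite -(@Rintegral_itv_diff _ _ 0)//; last first.
  exact: integrable_itvS (integrable_rate_growth i).
by rewrite set_itv1 Rintegral_set1 subr0.
Qed.

End one_system.

(** For one particle the mean norm acts as a forcing. Averaging the resulting bounds gives a closed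
    inequality for the mean, bounded by [M] through a second Gronwall; reinserting [M] gives
    [A = K1 * (1 + M * Lam)]. Only the initial mean [m0] enters, so [A] serves all [N]. *)
Lemma apriori (m0 : R) : 0 <= m0 -> exists2 A : R, 1 <= A &
  forall N (z : 'I_N.+1 -> R -> 'rV[R]_n), integral_solution T H f z ->
  avg_norm z 0 <= m0 -> forall i t, 0 <= t <= T ->
    `|z i t| <= A * (1 + `|z i 0|).
Proof.
move=> m00.
have rate0 t : 0 <= t <= T -> 0 <= rate t by rewrite rate_ge0.
have [K1 K11 hK1] := gronwall_forced T0 integrable_rate rate0.
have K10 : 0 <= K1 by exact: le_trans K11.
have iK1 : mu.-integrable `[0, T] (EFin \o (fun t => K1 * rate t)).
  by apply: integrable_scaleR => //; exact: integrable_rate.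
have K1rate0 t : 0 <= t <= T -> 0 <= K1 * rate t by rewrite mulr_ge0 ?rate_ge0.
have [K2 K21 hK2] := gronwall T0 iK1 K1rate0.
have K20 : 0 <= K2 by exact: le_trans K21.
pose Lam := \int[mu]_(y in `[0, T]) rate y.
have Lam0 : 0 <= Lam by apply: Rintegral_ge0 => x _; exact: rate_ge0.
pose M := K2 * (1 + K1 * m0).
have M0 : 0 <= M by rewrite mulr_ge0// addr_ge0// mulr_ge0.
exists (K1 * (1 + M * Lam)) => [|N z hz hm].
  by rewrite -[leLHS]mulr1 ler_pM// lerDl mulr_ge0.
have [C C0 hC] := avg_norm_bounded hz.
have ia t : t <= T -> mu.-integrable `[0, t]
    (EFin \o (fun y => rate y * (1 + avg_norm z y))).
  move=> tT; apply: integrable_itvS (tT) _.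
  apply: (integrableM_bounded (B := 1 + C)) => //; first exact: integrable_rate.
    by apply: measurable_funD => //; exact: measurable_avg_norm.
  move=> x /=; rewrite in_itv/= => xT; have /andP[a0 aC] := hC x xT.
  by rewrite ger0_norm ?addr_ge0// lerD.
have step i t : 0 <= t <= T -> `|z i t| <=
    K1 * (`|z i 0| + \int[mu]_(y in `[0, t]) (rate y * (1 + avg_norm z y))).
  move=> tT; have [B B0 hB] := norm_itv_bounded (hz i).1.
  apply: (hK1 (fun t => `|z i t|) _ B) => //.
  - by apply: measurable_norm_ucont; have [] := hz i.
  - by move=> s sT; rewrite normr_ge0 hB.
  - exact: ia.
  - by move=> s sT; rewrite mulr_ge0 ?rate_ge0// addr_ge0// avg_norm_ge0.
  - move=> s sT; rewrite (le_trans (particle_growth hz i sT))// lerD2l.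
    rewrite le_eqVlt; apply/orP; left; apply/eqP.
    by apply: eq_Rintegral => y _; ring.
(* The mean of the bounds [step] is a Gronwall inequality for [1 + avg_norm z] with kernel
   [K1 * rate] and constant [1 + K1 * m0]. *)
have avgM t : 0 <= t <= T -> 1 + avg_norm z t <= M.
  move=> tT; apply: (hK2 (fun t => 1 + avg_norm z t) (1 + C)) => //.
  - by rewrite addr_ge0// mulr_ge0.
  - apply: measurable_funD => //; apply: measurable_funS (measurable_avg_norm hz) => //.
    by apply: subset_itvl; rewrite bnd_simp; case/andP : tT.
  - move=> s /andP[s0 st]; have /andP[a0 aC] := hC s (introT andP (conj s0 (le_trans st (elimT andP tT).2))).
    by rewrite addr_ge0//= lerD.
  - move=> s /andP[s0 st]; have sT : s <= T by case/andP : tT => _; exact: le_trans.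
    rewrite -addrA lerD2l.
    under eq_Rintegral do rewrite -mulrA.
    rewrite RintegralZl//; last exact: ia.
    rewrite -mulrDr /avg_norm.
    apply: (@le_trans _ _ (N.+1%:R^-1 * \sum_(i < N.+1)
       (K1 * (`|z i 0| + \int[mu]_(y in `[0, s]) (rate y * (1 + avg_norm z y)))))).
      rewrite ler_wpM2l ?invr_ge0//; apply: ler_sum => i _.
      by apply: step; rewrite s0.
    rewrite -mulr_sumr big_split/= sumr_const card_ord -[X in _ + X]mulr_natl.
    rewrite mulrCA ler_wpM2l// mulrDr mulKf ?pnatr_eq0// lerD2r//.
move=> i t /[dup] tT /step /le_trans; apply.
rewrite -mulrA ler_wpM2l//.
have : \int[mu]_(y in `[0, t]) (rate y * (1 + avg_norm z y)) <= M * Lam.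
  case/andP : tT => t0 tT.
  rewrite (@le_trans _ _ (\int[mu]_(y in `[0, t]) (M * rate y)))//.
    apply: le_Rintegral => //; first exact: ia.
      by apply: integrable_scaleR => //; exact: integrable_itvS integrable_rate.
    move=> x /=; rewrite in_itv/= => /andP[x0 xt].
    by rewrite mulrC ler_wpM2r ?rate_ge0// avgM// x0 (le_trans xt).
  rewrite RintegralZl//; last exact: integrable_itvS integrable_rate.
  by rewrite ler_wpM2l//; apply: le_Rintegral_itv integrable_rate _ => // x _; exact: rate_ge0.
move=> /(lerD (lexx `|z i 0|)) /le_trans; apply.
have := mulr_ge0 (mulr_ge0 M0 Lam0) (normr_ge0 (z i 0)); lra.
Qed.

(** Equicontinuity in time: once the norms are bounded, only the integral of [rate] over the time
    interval remains. The limit flow inherits this modulus. *)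
Lemma particle_time_modulus (A m0 : R) N (z : 'I_N.+1 -> R -> 'rV[R]_n) i s t :
  integral_solution T H f z -> avg_norm z 0 <= m0 -> 0 <= A ->
  (forall i t, 0 <= t <= T -> `|z i t| <= A * (1 + `|z i 0|)) ->
  0 <= s -> s <= t -> t <= T ->
  `|z i t - z i s| <= (1 + A * (1 + `|z i 0|) + A * (1 + m0)) *
    \int[mu]_(y in `]s, t]) rate y.
Proof.
move=> hz hm A0 hA s0 st tT; rewrite (le_trans (particle_increment hz _ _ _ _))//.
have oc (g : R -> R) : mu.-integrable `[0, T] (EFin \o g) ->
    mu.-integrable `]s, t] (EFin \o g).
  by apply: integrableS => //; apply: subset_itv; rewrite bnd_simp.
rewrite -RintegralZl//; last by apply: oc; exact: integrable_rate.
apply: le_Rintegral => //.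
- exact: oc (integrable_rate_growth hz i).
- by apply: integrable_scaleR => //; apply: oc; exact: integrable_rate.
move=> y /=; rewrite in_itv/= => /andP[sy yt].
have yT : 0 <= y <= T by rewrite (le_trans s0 (ltW sy)) (le_trans yt).
rewrite mulrC ler_wpM2r ?rate_ge0// -!addrA lerD2l lerD ?hA//.
rewrite /avg_norm (@le_trans _ _ (N.+1%:R^-1 * \sum_(j < N.+1) (A * (1 + `|z j 0|))))//.
  by rewrite ler_wpM2l ?invr_ge0//; apply: ler_sum => j _; exact: hA.
rewrite -mulr_sumr mulrCA ler_wpM2l// big_split/= sumr_const card_ord mulrDr.
by rewrite mulVf ?pnatr_eq0// lerD2l.
Qed.

(* Mass outside the good set is charged with [1 + |p| + |q|], which dominates
   the growth of [H] along the two trajectories. *)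
Definition escape (r : R) (p q : 'rV[R]_n) : R :=
  if (`|p| <= r) && (`|q| <= r) then 0 else 1 + `|p| + `|q|.

Lemma escape_ge0 r p q : 0 <= escape r p q.
Proof. by rewrite /escape; case: ifP => // _; rewrite !addr_ge0. Qed.

Definition plan_cost r N M (w : 'I_N.+1 -> 'I_M.+1 -> R)
    (p : 'I_N.+1 -> 'rV[R]_n) (q : 'I_M.+1 -> 'rV[R]_n) :=
  \sum_i \sum_j w i j * (`|p i - q j| + escape r (p i) (q j)).

Section two_systems.
Variables (A r : R) (A1 : 1 <= A) (r0 : 0 <= r).

(** Trajectories started in the [r]-ball never leave this radius. Forces depend on differences of
    two positions, hence the Lipschitz constant of [H] on radius [2 * rho]. *)
Let rho := A * (1 + r).

Let rho0 : 0 <= rho.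
Proof. by rewrite mulr_ge0 ?addr_ge0// (le_trans _ A1). Qed.

Let A0 : 0 <= A. Proof. exact: le_trans A1. Qed.

Variables (L : R) (L0 : 0 <= L).
Hypothesis hL : forall z z', `|z| <= 2 * rho -> `|z'| <= 2 * rho ->
  `|H z - H z'| <= L * `|z - z'|.

(** Linear growth of [H] at two differences gives [2 + |z_i| + |z_k| + |y_j| + |y_l|]. The good
    indices contribute at most [2 * rho], the other two at most [A * (1 + |z_k(0)|)] and
    [A * (1 + |y_l(0)|)]. *)
Let CB := CH * (2 + 2 * rho + 2 * A).

Let CB0 : 0 <= CB.
Proof. by rewrite mulr_ge0// !addr_ge0// mulr_ge0. Qed.

Variables (N M : nat).
Variables (z : 'I_N.+1 -> R -> 'rV[R]_n) (y : 'I_M.+1 -> R -> 'rV[R]_n).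
Hypothesis hz : integral_solution T H f z.
Hypothesis hy : integral_solution T H f y.
Hypothesis zA : forall i t, 0 <= t <= T -> `|z i t| <= A * (1 + `|z i 0|).
Hypothesis yA : forall i t, 0 <= t <= T -> `|y i t| <= A * (1 + `|y i 0|).
Variable w : 'I_N.+1 -> 'I_M.+1 -> R.
Hypothesis w0 : forall i j, 0 <= w i j.
Hypothesis w1 : forall i, \sum_j w i j = N.+1%:R^-1.
Hypothesis w2 : forall j, \sum_i w i j = M.+1%:R^-1.

Let total : \sum_k \sum_l w k l = 1.
Proof.
under eq_bigr do rewrite w1.
by rewrite sumr_const card_ord -[LHS]mulr_natl mulfV// pnatr_eq0.
Qed.

Let good k l := (`|z k 0| <= r) && (`|y l 0| <= r).

Let E t := \sum_k \sum_l w k l * (if good k l then `|z k t - y l t| else 0).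

Let tau := \sum_k \sum_l w k l * escape r (z k 0) (y l 0).

Let E_ge0 t : 0 <= E t.
Proof.
by apply: sumr_ge0 => k _; apply: sumr_ge0 => l _; rewrite mulr_ge0//; case: ifP.
Qed.

Let tau_ge0 : 0 <= tau.
Proof.
by apply: sumr_ge0 => k _; apply: sumr_ge0 => l _; rewrite mulr_ge0// escape_ge0.
Qed.

Let good_le k t : `|z k 0| <= r -> 0 <= t <= T -> `|z k t| <= rho.
Proof. by move=> kr /zA /le_trans; apply; rewrite ler_wpM2l// lerD2l. Qed.

Let good_le' k t : `|y k 0| <= r -> 0 <= t <= T -> `|y k t| <= rho.
Proof. by move=> kr /yA /le_trans; apply; rewrite ler_wpM2l// lerD2l. Qed.

(** The compared pair [(i, j)] is good, the source pair [(k, l)] arbitrary. A good source is handled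
    by the Lipschitz constant, any other by growth, with the cost put into [escape]. *)
Let force_pair i j k l t : good i j -> 0 <= t <= T ->
  `|H (z i t - z k t) - H (y j t - y l t)| <=
  L * `|z i t - y j t| + L * (if good k l then `|z k t - y l t| else 0) +
  CB * escape r (z k 0) (y l 0).
Proof.
move=> /andP[gi gj] tT; have hi := good_le gi tT; have hj := good_le' gj tT.
rewrite /escape -/(good k l); case: ifPn => [/andP[gk gl]|_].
  rewrite mulr0 addr0 -mulrDr.
  have hk := good_le gk tT; have hl := good_le' gl tT.
  rewrite (le_trans (hL _ _))//.
  - by rewrite (le_trans (ler_normB _ _))// mulr_natl mulr2n lerD.
  - by rewrite (le_trans (ler_normB _ _))// mulr_natl mulr2n lerD.
  rewrite ler_wpM2l// (_ : _ - _ = (z i t - y j t) - (z k t - y l t)).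
    exact: ler_normB.
  by apply/rowP => c; rewrite !mxE; ring.
rewrite mulr0 addr0 ler_wpDl ?mulr_ge0//.
rewrite (le_trans (ler_normB _ _))// (le_trans (lerD (HC _) (HC _)))//.
rewrite -mulrDr -mulrA ler_wpM2l//.
have h1 := ler_normB (z i t) (z k t); have h2 := ler_normB (y j t) (y l t).
have h3 := zA k tT; have h4 := yA l tT.
have h5 : 0 <= rho * `|z k 0| by rewrite mulr_ge0.
have h6 : 0 <= rho * `|y l 0| by rewrite mulr_ge0.
have h7 : 0 <= A * `|y l 0| by rewrite mulr_ge0.
have h8 : 0 <= A * `|z k 0| by rewrite mulr_ge0.
have h9 := normr_ge0 (z k 0); have h10 := normr_ge0 (y l 0).
lra.
Qed.

Let conv_diff i j t : good i j -> 0 <= t <= T ->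
  `|Defs.conv H (empirical (z^~ t)) (z i t) - Defs.conv H (empirical (y^~ t)) (y j t)|
  <= L * `|z i t - y j t| + L * E t + CB * tau.
Proof.
move=> gij tT; rewrite !conv_empirical//.
(* Both averages become double sums against the same plan [w], thanks to its marginals, and can then
   be compared term by term. *)
have -> : N.+1%:R^-1 *: \sum_(k < N.+1) H (z i t - z k t) =
    \sum_k \sum_l w k l *: H (z i t - z k t).
  by rewrite scaler_sumr; apply: eq_bigr => k _; rewrite -scaler_suml w1.
have -> : M.+1%:R^-1 *: \sum_(k < M.+1) H (y j t - y k t) =
    \sum_k \sum_l w k l *: H (y j t - y l t).
  rewrite exchange_big/= scaler_sumr; apply: eq_bigr => k _.
  by rewrite -scaler_suml w2.
rewrite -sumrB; under eq_bigr do rewrite -sumrB.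
apply: (@le_trans _ _ (\sum_k \sum_l w k l * (L * `|z i t - y j t| +
   L * (if good k l then `|z k t - y l t| else 0) +
   CB * escape r (z k 0) (y l 0)))).
  rewrite (le_trans (ler_norm_sum _ _ _))//; apply: ler_sum => k _.
  rewrite (le_trans (ler_norm_sum _ _ _))//; apply: ler_sum => l _.
  rewrite -scalerBr normrZ ger0_norm// ler_wpM2l//.
  exact: force_pair.
rewrite le_eqVlt; apply/orP; left; apply/eqP.
under eq_bigr do under eq_bigr do rewrite !mulrDr.
under eq_bigr do rewrite !big_split/=.
rewrite !big_split/=; congr (_ + _ + _).
- under eq_bigr do rewrite -mulr_suml.
  by rewrite -mulr_suml total mul1r.
- rewrite mulr_sumr; apply: eq_bigr => k _; rewrite mulr_sumr.
  by apply: eq_bigr => l _; rewrite mulrCA.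
- rewrite mulr_sumr; apply: eq_bigr => k _; rewrite mulr_sumr.
  by apply: eq_bigr => l _; ring.
Qed.

Let wfield_diff i j t : good i j -> 0 <= t <= T ->
  (forall z z', `|f t z - f t z'| <= kf t * `|z - z'|) ->
  `|wfield H (fun s => empirical (z^~ s)) f t (z i t) -
    wfield H (fun s => empirical (y^~ s)) f t (y j t)| <=
  (1 + L + kf t) * `|z i t - y j t| + (L * E t + CB * tau).
Proof.
move=> gij tT hf; rewrite /wfield opp_row_mx add_row_mx.
rewrite (le_trans (norm_row_mx _ _))//.
have := conv_diff gij tT; have := hf (z i t) (y j t).
have : `|rsubmx (z i t) - rsubmx (y j t)| <= `|z i t - y j t|.
  rewrite (_ : _ - _ = rsubmx (z i t - y j t)); first exact: norm_rsubmx.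
  by apply/rowP => c; rewrite !mxE.
set c1 := Defs.conv _ _ _; set c2 := Defs.conv _ _ _.
rewrite opprD addrACA => h1 h2 h3.
have := ler_normD (c1 - c2) (f t (z i t) - f t (y j t)); lra.
Qed.

(** A good pair satisfies a Gronwall inequality with kernel [1 + L + kf] forced by
    [L * E + CB * tau], where [E] is the mean distance over good pairs. Averaging against [w] closes
    an inequality for [E] with kernel [K3 * L]. The Gronwall properties are hypotheses so that [K3]
    and [K4] can be fixed before the systems and the plan. *)
Lemma particle_comparison (K3 K4 : R) :
  0 <= K3 -> 0 <= K4 ->
  (forall (u beta : R -> R) (B c t : R), 0 <= t <= T -> 0 <= c ->
    measurable_fun `[0, T] u ->
    (forall s, 0 <= s <= T -> 0 <= u s <= B) ->
    mu.-integrable `[0, T] (EFin \o beta) ->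
    (forall s, 0 <= s <= T -> 0 <= beta s) ->
    (forall s, 0 <= s <= T ->
      u s <= c + \int[mu]_(y in `[0, s]) ((1 + L + kf y) * u y + beta y)) ->
    u t <= K3 * (c + \int[mu]_(y in `[0, t]) beta y)) ->
  (forall (u : R -> R) (B c t : R), 0 <= t <= T -> 0 <= c ->
    measurable_fun `[0, t] u ->
    (forall s, 0 <= s <= t -> 0 <= u s <= B) ->
    (forall s, 0 <= s <= t ->
       u s <= c + \int[mu]_(y in `[0, s]) (K3 * L * u y)) ->
    u t <= K4 * c) ->
  forall i j t, `|z i 0| <= r -> `|y j 0| <= r -> 0 <= t <= T ->
  `|z i t - y j t| <= K3 * (1 + L * T * K4 * K3 * (1 + CB * T) + CB * T) *
    (`|z i 0 - y j 0| + plan_cost r w (z^~ 0) (y^~ 0)).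
Proof.
move=> K30 K40 hK3 hK4.
have uzy k l : ucont_on T (fun t => z k t - y l t).
  by apply: ucont_onB; [have [] := hz k|have [] := hy l].
have mu_zy k l : measurable_fun `[0, T] (fun t => `|z k t - y l t|).
  exact: measurable_norm_ucont (uzy k l).
have mE : measurable_fun `[0, T] E.
  rewrite /E; apply: measurable_sum => k.
  apply: measurable_sum => l; apply: measurable_funM => //.
  by case: (good k l).
have [BE hBE] : exists BE, forall t, 0 <= t <= T -> 0 <= E t <= BE.
  exists (\sum_(k < N.+1) \sum_(l < M.+1) w k l * (2 * rho)) => t tT.
  rewrite E_ge0/=; apply: ler_sum => k _; apply: ler_sum => l _.
  rewrite ler_wpM2l//; case: ifP => [/andP[gk gl]|_]; last by rewrite mulr_ge0.
  rewrite (le_trans (ler_normB _ _))// mulr_natl mulr2n.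
  by rewrite lerD ?good_le ?good_le'.
pose beta t := L * E t + CB * tau.
have beta0 t : 0 <= beta t by rewrite addr_ge0// mulr_ge0.
have ic (k : R) : mu.-integrable `[0, T] (EFin \o cst k).
  exact: (integrable_cst_itv (a := 0) (b := T)).
have iE : mu.-integrable `[0, T] (EFin \o E).
  refine (@dominated_integrableR R _ _ mu `[0, T] E (cst BE) _ mE _ (ic BE)) => //.
  by move=> t /=; rewrite in_itv/= => /hBE /andP[h1 h2]; rewrite ger0_norm.
have ibeta : mu.-integrable `[0, T] (EFin \o beta).
  by apply: integrable_addR; [by []|exact: integrable_scaleR|exact: ic].
have step i j t : good i j -> 0 <= t <= T ->
    `|z i t - y j t| <= K3 * (`|z i 0 - y j 0| + \int[mu]_(s in `[0, t]) beta s).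
  move=> gij tT; apply: (hK3 (fun t => `|z i t - y j t|) _ (2 * rho)) => //.
    move=> s sT; rewrite normr_ge0/= (le_trans (ler_normB _ _))//.
    have /andP[gi gj] := gij.
    by rewrite mulr_natl mulr2n lerD ?good_le ?good_le'.
  move=> s /andP[s0 sT].
  have ig : mu.-integrable `[0, T]
      (EFin \o (fun y0 => (1 + L + kf y0) * `|z i y0 - y j y0| + beta y0)).
    apply: integrable_addR => //; apply: (integrableM_bounded (B := 2 * rho)) => //.
      by apply: integrable_addR => //; exact: ic.
    move=> x /=; rewrite in_itv/= => xT; rewrite normr_id (le_trans (ler_normB _ _))//.
    have /andP[gi gj] := gij.
    by rewrite mulr_natl mulr2n lerD ?good_le ?good_le'.
  rewrite -[z i s - y j s](subrK (z i 0 - y j 0)) (le_trans (ler_normD _ _))// addrC lerD2l.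
  apply: norm_le_coord => [|c].
    by apply: Rintegral_ge0 => x _; rewrite addr_ge0// mulr_ge0// !addr_ge0.
  have [_ /(_ c)[iz hzc]] := hz i; have [_ /(_ c)[iy hyc]] := hy j.
  rewrite !mxE (_ : _ - _ = (z i s ord0 c - z i 0 ord0 c) - (y j s ord0 c - y j 0 ord0 c)); last ring.
  rewrite hzc ?s0// hyc ?s0// -RintegralB//; [|exact: integrable_itvS iz|exact: integrable_itvS iy].
  apply: le_norm_Rintegral_ae => //.
  - by apply: integrable_subR => //; [exact: integrable_itvS iz|exact: integrable_itvS iy].
  - exact: integrable_itvS ig.
  - by move=> x _; rewrite addr_ge0// mulr_ge0// !addr_ge0.
  - have ? := ae_filter_ringOfSetsType mu.
    apply: filterS f_ae => x hx /=; rewrite in_itv/= => /andP[x0 xs].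
    have xT : 0 <= x <= T by rewrite x0 (le_trans xs).
    have [_ hf] := hx xT.
    apply: le_trans (wfield_diff gij xT hf).
    have cB (u u' : 'rV[R]_n) : u ord0 c - u' ord0 c = (u - u') ord0 c.
      by rewrite !mxE.
    by rewrite cB; exact: coord_le_norm.
pose D0 := \sum_k \sum_l w k l * `|z k 0 - y l 0|.
have D00 : 0 <= D0 by apply: sumr_ge0 => k _; apply: sumr_ge0 => l _; rewrite mulr_ge0.
have Ibeta t : 0 <= t <= T ->
    \int[mu]_(s in `[0, t]) beta s = L * \int[mu]_(s in `[0, t]) E s + CB * tau * t.
  move=> /andP[t0 tT]; rewrite /beta RintegralD//; last 2 first.
  - by apply: integrable_scaleR => //; exact: integrable_itvS iE.
  - exact: integrable_itvS (ic _).
  rewrite RintegralZl//; last exact: integrable_itvS iE.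
  by rewrite Rintegral_cst_cc// subr0.
have CBt0 : 0 <= CB * tau := mulr_ge0 CB0 tau_ge0.
have K3D0 : 0 <= K3 * (D0 + CB * tau * T).
  exact: mulr_ge0 K30 (addr_ge0 D00 (mulr_ge0 CBt0 T0)).
(* Bad pairs contribute 0 to [E], so the bound for good pairs may be summed over all pairs; the
   total mass 1 of [w] keeps the forcing integral unchanged. *)
have Eb t : 0 <= t <= T -> E t <= K4 * (K3 * (D0 + CB * tau * T)).
  move=> tT; apply: (hK4 E BE) => //.
  - apply: measurable_funS mE => //; apply: subset_itvl; rewrite bnd_simp.
    by case/andP : tT.
  - move=> s /andP[s0 st]; apply: hBE; rewrite s0 (le_trans st)//.
    by case/andP : tT.
  - move=> s /andP[s0 st]; have sT : s <= T by case/andP : tT => _; exact: le_trans.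
    have I0 : 0 <= \int[mu]_(x in `[0, s]) beta x by exact: Rintegral_ge0.
    apply: (@le_trans _ _ (\sum_k \sum_l w k l *
        (K3 * (`|z k 0 - y l 0| + \int[mu]_(x in `[0, s]) beta x)))).
      apply: ler_sum => k _; apply: ler_sum => l _; rewrite ler_wpM2l//.
      case: ifP => gkl; last by rewrite mulr_ge0// addr_ge0.
      by rewrite step// s0.
    rewrite (_ : \sum_k _ = K3 * (D0 + \int[mu]_(x in `[0, s]) beta x)); last first.
      rewrite mulrDr /D0 mulr_sumr -[in RHS](mul1r (\int[mu]_(x in _) _)) -total.
      rewrite mulrA mulr_sumr mulr_suml -big_split/=; apply: eq_bigr => k _.
      rewrite !mulr_sumr mulr_suml -big_split/=; apply: eq_bigr => l _; ring.
    rewrite Ibeta ?s0// RintegralZl//; last exact: integrable_itvS iE.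
    have : K3 * (CB * tau * s) <= K3 * (CB * tau * T).
      by rewrite ler_wpM2l// ler_wpM2l.
    lra.
move=> i j t gi gj /[dup] tT /andP[t0 tT'].
have gij : good i j by rewrite /good gi.
rewrite (le_trans (step i j t gij tT))// -mulrA ler_wpM2l// Ibeta//.
have IE : \int[mu]_(s in `[0, t]) E s <= K4 * (K3 * (D0 + CB * tau * T)) * T.
  rewrite (@le_trans _ _ (\int[mu]_(s in `[0, t]) (K4 * (K3 * (D0 + CB * tau * T)))))//.
    apply: le_Rintegral => //; first exact: integrable_itvS iE.
      exact: integrable_itvS (ic _).
    by move=> x /=; rewrite in_itv/= => /andP[x0 xt]; rewrite Eb// x0 (le_trans xt).
  by rewrite Rintegral_cst_cc// subr0 ler_wpM2l// mulr_ge0.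
have -> : plan_cost r w (z^~ 0) (y^~ 0) = D0 + tau.
  rewrite /plan_cost /D0 /tau -big_split/=; apply: eq_bigr => k _.
  by rewrite -big_split/=; apply: eq_bigr => l _; rewrite mulrDr.
set u0 := `|_|; have u00 : 0 <= u0 by rewrite normr_ge0.
have h1 : L * \int[mu]_(s in `[0, t]) E s <= L * (K4 * (K3 * (D0 + CB * tau * T)) * T).
  by rewrite ler_wpM2l.
have h2 : CB * tau * t <= CB * tau * T by rewrite ler_wpM2l.
rewrite (le_trans (lerD (lexx u0) (lerD h1 h2)))//.
pose P := L * T * K4 * K3; have P0 : 0 <= P := mulr_ge0 (mulr_ge0 (mulr_ge0 L0 T0) K40) K30.
pose Q := CB * T; have Q0 : 0 <= Q := mulr_ge0 CB0 T0.
rewrite [leLHS](_ : _ = u0 + P * D0 + P * Q * tau + Q * tau); last by rewrite /P /Q; ring.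
rewrite -/P -/Q.
have e1 : 0 <= P * Q by rewrite mulr_ge0.
(* Explicit certificate: the difference of the two sides is a combination of [u0], [D0] and [tau]
   with non-negative coefficients. *)
rewrite -subr_ge0 (_ : _ - _ = (P * (1 + Q) + Q) * u0 + (1 + P * Q + Q) * D0 + (1 + P) * tau).
  by rewrite !addr_ge0// mulr_ge0// !addr_ge0// mulr_ge0// addr_ge0.
ring.
Qed.

End two_systems.

(** [L] depends on [A] and [r], and the Gronwall constants on [L], [kf] and [T]. Hence [K] is the
    same for all pairs of systems and all plans. *)
Lemma particle_stability (A r : R) : 1 <= A -> 0 <= r ->
  exists2 K : R, 0 <= K & forall N M (z : 'I_N.+1 -> R -> 'rV[R]_n)
    (y : 'I_M.+1 -> R -> 'rV[R]_n) (w : 'I_N.+1 -> 'I_M.+1 -> R),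
  integral_solution T H f z -> integral_solution T H f y ->
  (forall i t, 0 <= t <= T -> `|z i t| <= A * (1 + `|z i 0|)) ->
  (forall i t, 0 <= t <= T -> `|y i t| <= A * (1 + `|y i 0|)) ->
  (forall i j, 0 <= w i j) ->
  (forall i, \sum_j w i j = N.+1%:R^-1) ->
  (forall j, \sum_i w i j = M.+1%:R^-1) ->
  forall i j t, `|z i 0| <= r -> `|y j 0| <= r -> 0 <= t <= T ->
  `|z i t - y j t| <= K *
    (`|z i 0 - y j 0| + plan_cost r w (z^~ 0) (y^~ 0)).
Proof.
move=> A1 r0; have [L L0 hL] := HL (2 * (A * (1 + r))).
have A0 : 0 <= A by exact: le_trans A1.
have ilam : mu.-integrable `[0, T] (EFin \o (fun t => 1 + L + kf t)).
  apply: integrable_addR => //.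
  exact: (integrable_cst_itv (a := 0) (b := T)).
have lam0 t : 0 <= t <= T -> 0 <= 1 + L + kf t by rewrite !addr_ge0.
have [K3 K31 hK3] := gronwall_forced T0 ilam lam0.
have K30 : 0 <= K3 by exact: le_trans K31.
have iK : mu.-integrable `[0, T] (EFin \o cst (K3 * L)).
  exact: (integrable_cst_itv (a := 0) (b := T)).
have K3L0 t : 0 <= t <= T -> 0 <= cst (K3 * L) t by rewrite mulr_ge0.
have [K4 K41 hK4] := gronwall T0 iK K3L0.
have K40 : 0 <= K4 by exact: le_trans K41.
eexists; last first.
  move=> N M z y w hz hy zA yA w0 w1 w2 i j t gi gj tT.
  exact: (particle_comparison A1 r0 L0 hL hz hy zA yA w0 w1 w2 K30 K40 hK3 hK4).
rewrite mulr_ge0// !addr_ge0// ?mulr_ge0// ?addr_ge0// ?mulr_ge0// ?addr_ge0// ?mulr_ge0// ?addr_ge0//.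
Qed.

End estimates.

(** * Gluing of transport plans *)

Section finite_gluing.
Context {R : realType}.

(* Gluing two finite plans along a common marginal [a]; cells of zero mass
   carry no mass of [al] and [be], so the junk value [x / 0 = 0] is harmless. *)
Lemma glue_plans (N M m : nat) (al : 'I_N.+1 -> 'I_m -> R)
    (be : 'I_M.+1 -> 'I_m -> R) (a : 'I_m -> R) :
  (forall i k, 0 <= al i k) -> (forall j k, 0 <= be j k) ->
  (forall k, \sum_i al i k = a k) -> (forall k, \sum_j be j k = a k) ->
  (forall i, \sum_k al i k = N.+1%:R^-1) ->
  (forall j, \sum_k be j k = M.+1%:R^-1) ->
  exists w : 'I_N.+1 -> 'I_M.+1 -> R,
  [/\ forall i j, 0 <= w i j,
      forall i, \sum_j w i j = N.+1%:R^-1,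
      forall j, \sum_i w i j = M.+1%:R^-1 &
      forall (h : 'I_N.+1 -> 'I_M.+1 -> R) (u : 'I_N.+1 -> 'I_m -> R)
        (v : 'I_M.+1 -> 'I_m -> R), (forall i j k, h i j <= u i k + v j k) ->
      \sum_i \sum_j w i j * h i j <=
      \sum_i \sum_k al i k * u i k + \sum_j \sum_k be j k * v j k].
Proof.
move=> al0 be0 ala bea al1 be1.
have a0 k : 0 <= a k by rewrite -ala sumr_ge0.
have alz i k : a k = 0 -> al i k = 0.
  rewrite -ala => /eqP; rewrite psumr_eq0// => /allP /(_ i).
  by rewrite mem_index_enum => /(_ isT) /eqP.
have bez j k : a k = 0 -> be j k = 0.
  rewrite -bea => /eqP; rewrite psumr_eq0// => /allP /(_ j).
  by rewrite mem_index_enum => /(_ isT) /eqP.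
have alaK i k : al i k * a k / a k = al i k.
  have [ak0|ak0] := eqVneq (a k) 0; first by rewrite (alz i k ak0) !mul0r.
  by rewrite mulfK.
have beaK j k : be j k * a k / a k = be j k.
  have [ak0|ak0] := eqVneq (a k) 0; first by rewrite (bez j k ak0) !mul0r.
  by rewrite mulfK.
(* Conditionally on the cell [k], the two plans are made independent. *)
exists (fun i j => \sum_k al i k * be j k / a k); split.
- by move=> i j; apply: sumr_ge0 => k _; rewrite divr_ge0// mulr_ge0.
- move=> i; rewrite exchange_big/= -[RHS](al1 i); apply: eq_bigr => k _.
  by rewrite -mulr_suml -mulr_sumr bea alaK.
- move=> j; rewrite exchange_big/= -[RHS](be1 j); apply: eq_bigr => k _.
  rewrite -mulr_suml -[RHS](beaK j k); congr (_ / _).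
  by rewrite -mulr_suml ala mulrC.
move=> h u v huv.
apply: (@le_trans _ _ (\sum_i \sum_j \sum_k
    (al i k * be j k / a k * u i k + al i k * be j k / a k * v j k))).
  apply: ler_sum => i _; apply: ler_sum => j _; rewrite mulr_suml.
  apply: ler_sum => k _; rewrite -mulrDr ler_wpM2l//.
  by rewrite divr_ge0// mulr_ge0.
under eq_bigr do under eq_bigr do rewrite big_split/=.
under eq_bigr do rewrite big_split/=.
rewrite big_split/= le_eqVlt; apply/orP; left; apply/eqP; congr (_ + _).
- apply: eq_bigr => i _; rewrite exchange_big/=; apply: eq_bigr => k _.
  by rewrite -!mulr_suml -mulr_sumr bea alaK.
- rewrite exchange_big/=; apply: eq_bigr => j _; rewrite exchange_big/=.
  apply: eq_bigr => k _; rewrite -!mulr_suml; congr (_ * _).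
  by rewrite ala [a k * _]mulrC beaK.
Qed.

End finite_gluing.

Lemma Rintegral_sum {R : realType} d (X : measurableType d)
    (mu : {measure set X -> \bar R}) (D : set X) (I : Type) (s : seq I)
    (F : I -> X -> R) : measurable D ->
  (forall i, mu.-integrable D (EFin \o F i)) ->
  mu.-integrable D (EFin \o (fun x => \sum_(i <- s) F i x)) /\
  \int[mu]_(x in D) (\sum_(i <- s) F i x) = \sum_(i <- s) \int[mu]_(x in D) F i x.
Proof.
move=> mD iF; elim: s => [|i s [ih1 ih2]].
  split; first by under eq_fun do rewrite big_nil; exact: integrable0.
  by under eq_Rintegral do rewrite big_nil; rewrite big_nil Rintegral_cst// mul0r.
split.
  by under eq_fun do rewrite big_cons; exact: integrable_addR.
by under eq_Rintegral do rewrite big_cons; rewrite big_cons RintegralD// ih2.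
Qed.

Lemma ae_le_Rintegral {R : realType} d (X : measurableType d)
    (mu : {measure set X -> \bar R}) (f g : X -> R) :
  mu.-integrable setT (EFin \o f) -> mu.-integrable setT (EFin \o g) ->
  {ae mu, forall x, f x <= g x} ->
  \int[mu]_x f x <= \int[mu]_x g x.
Proof.
move=> fi gi fg; rewrite -subr_ge0 -RintegralB//.
have igf := integrable_subR measurableT gi fi.
rewrite (_ : \int[mu]_x (g x - f x) = \int[mu]_x `|g x - f x|).
  exact: Rintegral_ge0.
congr fine; apply: ae_eq_integral => //.
- by case/integrableP : igf.
- by case/integrableP : (integrable_normR igf).
- have ? := ae_filter_ringOfSetsType mu.
  by apply: filterS fg => x fgx _; rewrite ger0_norm// subr_ge0.
Qed.

Lemma integrable_bounded_probability {R : realType} d (X : measurableType d)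
    (P : probability X R) (g : X -> R) (B : R) : measurable_fun setT g ->
  (forall x, `|g x| <= B) -> P.-integrable setT (EFin \o g).
Proof.
move=> mg gB; apply: (@dominated_integrableR _ _ _ _ _ _ (cst B)) => //.
exact: finite_measure_integrable_cst.
Qed.

Section quantization.
Context {R : realType} {n : nat}.

(** A finite subcover by [e]-balls is made disjoint by removing the earlier balls from each. Sums of
    indicators express that the cells are disjoint and cover [S]. *)
Lemma compact_cells (S : set 'rV[R]_n) (e : R) : compact S -> 0 < e ->
  exists (m : nat) (A : 'I_m -> set (borelRn R n)) (c : 'I_m -> 'rV[R]_n),
  [/\ forall k, measurable (A k),
      forall z, S z -> \sum_k \1_(A k) z = 1 :> R,
      (forall z, \sum_k \1_(A k) z <= 1 :> R) &
      forall k z, A k z -> `|z - c k| <= e].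
Proof.
move=> cS e0; move: cS; rewrite compact_cover => /(_ _ S (fun z => ball z e)).
have h1 (z : 'rV[R]_n) : S z -> open (ball z e) by move=> _; exact: ball_open.
move=> /(_ h1) []; first by move=> z Sz; exists z => //; exact: ballxx.
move=> D' _ hS; pose s : seq 'rV[R]_n := finmap.enum_fset D'.
pose F (k : nat) : set 'rV[R]_n := ball (nth 0 s k) e.
pose A (k : 'I_(size s)) : set (borelRn R n) := seqDU F k.
have mF k : measurable (F k : set (borelRn R n)).
  by apply: open_measurable_borelRn; exact: ball_open.
have disj z (k l : 'I_(size s)) : A k z -> A l z -> k = l.
  move=> Ak Al; apply: val_inj; apply: (@trivIset_seqDU _ F) => //.
  by exists z.
have one z (k : 'I_(size s)) : A k z -> \sum_k \1_(A k) z = 1 :> R.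
  move=> Ak; rewrite (bigD1 k)//= big1 ?addr0; first by rewrite indicE mem_set.
  move=> l lk; rewrite indicE memNset// => Al.
  by move/eqP : lk; apply; exact: disj Al Ak.
have zero z : ~ (exists k, A k z) -> \sum_k \1_(A k) z = 0 :> R.
  move=> nA; rewrite big1// => l _; rewrite indicE memNset// => Al.
  by apply: nA; exists l.
exists (size s), A, (fun k => nth 0 s k); split.
- move=> k; rewrite /A /seqDU; apply: measurableD => //.
  by apply: bigsetU_measurable.
- move=> z /hS [c /= cD' zc].
  have [k kl kF] : exists2 k, (k < size s)%N & F k z.
    exists (index c s); first by rewrite index_mem.
    by rewrite /F nth_index.
  have [k' hk' Ak'] : exists2 k', (k' < size s)%N & seqDU F k' z.
    have : (\bigcup_(i < k.+1) F i) z by exists k => //=.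
    rewrite bigcup_mkord bigsetU_seqDU -bigcup_mkord => -[k' /= k'k Ak'].
    by exists k' => //; exact: leq_ltn_trans kl.
  exact: (one z (Ordinal hk')).
- move=> z; have [[k Ak]|nA] := pselect (exists k, A k z).
    by rewrite (one z k).
  by rewrite zero.
- move=> k z; rewrite /A /seqDU => -[+ _]; rewrite /F -ball_normE/=.
  by rewrite distrC => /ltW.
Qed.

End quantization.

Section coupling_plan.
Context {R : realType} {n : nat}.
Variables (N : nat) (p : 'I_N.+1 -> 'rV[R]_n) (mu0 : P1 R n).
Variable gamma : probability (borelRn R n * borelRn R n)%type R.
Hypothesis hgamma : is_coupling (empirical p) mu0 gamma.
Variable e : R.
Hypothesis cost_e : (\int[gamma]_x (enorm ((x.1 : 'rV[R]_n) - x.2))%:E < e%:E)%E.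
Variable S : set 'rV[R]_n.
Hypothesis mS : measurable (S : set (borelRn R n)).
Hypothesis S1 : mu0 (~` S) = 0%E.

Lemma integrable_cost : gamma.-integrable setT
  (EFin \o (fun x : borelRn R n * borelRn R n => enorm ((x.1 : 'rV[R]_n) - x.2))).
Proof.
apply/integrableP; split; first by apply/measurable_EFinP; exact: measurable_cost.
apply: (@lt_trans _ _ e%:E); last by rewrite ltry.
apply: le_lt_trans cost_e; rewrite le_eqVlt; apply/orP; left; apply/eqP.
by apply: eq_integral => x _ /=; rewrite ger0_norm// sqrtr_ge0.
Qed.

Lemma Rintegral_cost :
  \int[gamma]_x (enorm ((x.1 : 'rV[R]_n) - x.2)) <= e.
Proof.
rewrite -lee_fin fineK; first exact: ltW.
exact: integrable_fin_num integrable_cost.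
Qed.

Lemma empirical_range : empirical p (~` range p) = 0%E.
Proof.
transitivity (emp_measure p (~` range p)); first by [].
rewrite emp_measureE big1 ?mule0// => i _.
by rewrite diracE memNset//; apply; exists i.
Qed.

Lemma measurable_set1_borelRn (x : 'rV[R]_n) :
  measurable ([set x] : set (borelRn R n)).
Proof.
apply: closed_measurable_borelRn; apply: compact_closed; last exact: compact_set1.
exact: norm_hausdorff.
Qed.

Lemma measurable_range : measurable (range p : set (borelRn R n)).
Proof.
rewrite (_ : range p = \big[setU/set0]_(i < N.+1) [set p i]).
  by apply: bigsetU_measurable => i _; exact: measurable_set1_borelRn.
apply/seteqP; split=> [_ [i _ <-]|x].
  by rewrite -bigcup_seq; exists i => //=; rewrite mem_index_enum.
by rewrite -bigcup_seq => -[i _ ->]; exists i.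
Qed.

Lemma coupling_ae_range : {ae gamma, forall x, range p x.1 /\ S x.2}.
Proof.
by apply: (coupling_ae hgamma) => //; [exact: measurable_range|exact: empirical_range].
Qed.

(** Converts a pointwise bound by the distance to [S] into a bound on the mean over particles, since
    [gamma] sends almost all mass into [S]. It serves for the mean norm and for the mean tail. *)
Lemma coupling_mean_le (h : 'rV[R]_n -> R) (K b : R) :
  measurable_fun setT (h : borelRn R n -> R) -> 0 <= K ->
  (forall x y, S y -> `|h x| <= b + K * enorm (x - y)) ->
  N.+1%:R^-1 * \sum_(i < N.+1) h (p i) <= b + K * e.
Proof.
move=> mh K0 hb.
rewrite -Rintegral_empirical// -(Rintegral_coupling_fst hgamma)//.
have ic : gamma.-integrable setT (EFin \o (fun x : borelRn R n * borelRn R n =>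
    b + K * enorm ((x.1 : 'rV[R]_n) - x.2))).
  apply: integrable_addR => //; first exact: finite_measure_integrable_cst.
  by apply: integrable_scaleR => //; exact: integrable_cost.
apply: (@le_trans _ _ (\int[gamma]_x (b + K * enorm ((x.1 : 'rV[R]_n) - x.2)))).
  apply: ae_le_Rintegral => //.
  - apply: (@integrable_coupling_fst _ _ _ _ _ hgamma).
    have : exists B, forall i, `|h (p i)| <= B.
      exists (\sum_i `|h (p i)|) => i; rewrite (bigD1 i)//= lerDl.
      by apply: sumr_ge0.
    move=> [B hB]; apply: (P1_conull_integrable measurable_range empirical_range mh) => x [i _ <-].
    exact: hB.
  - have ? := ae_filter_ringOfSetsType gamma.
    apply: filterS coupling_ae_range => x [_ Sx].
    by rewrite (le_trans (ler_norm _))// hb.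
rewrite RintegralD//; [|exact: finite_measure_integrable_cst|
  by apply: integrable_scaleR => //; exact: integrable_cost].
rewrite RintegralZl//; last exact: integrable_cost.
rewrite [X in X + _](_ : _ = b); last by rewrite /Rintegral integral_probability_cst.
by rewrite lerD2l ler_wpM2l// Rintegral_cost.
Qed.

(* Coinciding particles share the mass at their common position evenly. *)
Let mult i : R := \sum_j (p j == p i)%:R.

Let mult_gt0 i : 0 < mult i.
Proof.
by rewrite /mult (bigD1 i)//= eqxx ltr_pwDl// sumr_ge0.
Qed.

Let theta i (x : borelRn R n) : R := \1_[set p i] x / mult i.

Let theta_ge0 i x : 0 <= theta i x.
Proof. by rewrite /theta divr_ge0 ?(ltW (mult_gt0 i))// indicE. Qed.

Let theta_le i x : theta i x <= (mult i)^-1.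
Proof.
rewrite -[leRHS]mul1r ler_wpM2r ?invr_ge0 ?(ltW (mult_gt0 i))// indicE.
Qed.

Let measurable_theta i : measurable_fun setT (theta i).
Proof.
apply: measurable_funM => //; apply: measurable_indic.
exact: measurable_set1_borelRn.
Qed.

Let theta_coord i j : theta i (p j) = (p j == p i)%:R / mult i.
Proof. rewrite /theta indicE; congr (_%:R / _); congr nat_of_bool.
by apply/idP/eqP => [/set_mem|->]; [|rewrite inE]. Qed.

Let sum_theta x : range p x -> \sum_i theta i x = 1.
Proof.
move=> [j _ <-]; under eq_bigr do rewrite theta_coord.
rewrite (eq_bigr (fun i => (p i == p j)%:R / mult j)).
  by rewrite -mulr_suml divff// (gt_eqF (mult_gt0 j)).
move=> i _; rewrite eq_sym; case: eqVneq => [pij|]; rewrite ?mul0r//.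
by congr (_ / _); rewrite /mult pij.
Qed.

(** [al i k] is the [gamma]-mass sent from particle [i] into the cell [A k]; the weights [theta]
    separate particles at the same position. Replacing the target by the centre [c k] costs at most
    [eta] per unit of mass. *)
Lemma coupling_plan (m : nat) (A : 'I_m -> set (borelRn R n)) (c : 'I_m -> 'rV[R]_n)
    (eta : R) : 0 <= eta ->
  (forall k, measurable (A k)) -> (forall z, S z -> \sum_k \1_(A k) z = 1 :> R) ->
  (forall k z, A k z -> `|z - c k| <= eta) ->
  exists al : 'I_N.+1 -> 'I_m -> R,
  [/\ forall i k, 0 <= al i k,
      forall k, \sum_i al i k = fine (mu0 (A k)),
      forall i, \sum_k al i k = N.+1%:R^-1 &
      \sum_i \sum_k al i k * `|p i - c k| <= e + eta].
Proof.
move=> eta0 mA A1 Ac.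
pose g i k (x : borelRn R n * borelRn R n) : R := theta i x.1 * \1_(A k) x.2.
have mg i k : measurable_fun setT (g i k).
  apply: measurable_funM; first exact: measurableT_comp (measurable_theta i) measurable_fst.
  exact: measurableT_comp (measurable_indic (mA k)) measurable_snd.
have g0 i k x : 0 <= g i k x by rewrite mulr_ge0// indicE.
have ig i k : gamma.-integrable setT (EFin \o g i k).
  apply: (@integrable_bounded_probability _ _ _ gamma _ ((mult i)^-1)) => // x.
  rewrite ger0_norm// -[leRHS]mulr1 ler_pM// ?indicE//.
have aer := coupling_ae_range.
have ? := ae_filter_ringOfSetsType gamma.
have aeE (u v : borelRn R n * borelRn R n -> R) :
    gamma.-integrable setT (EFin \o u) -> gamma.-integrable setT (EFin \o v) ->
    (forall x, range p x.1 -> S x.2 -> u x = v x) ->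
    \int[gamma]_x u x = \int[gamma]_x v x.
  move=> iu iv uv; apply/eqP; rewrite eq_le; apply/andP; split.
    apply: ae_le_Rintegral => //; apply: filterS aer => x [h1 h2].
    by rewrite uv.
  apply: ae_le_Rintegral => //; apply: filterS aer => x [h1 h2].
  by rewrite uv.
exists (fun i k => \int[gamma]_x g i k x); split.
- by move=> i k; exact: Rintegral_ge0.
- move=> k; have [isum <-] := @Rintegral_sum _ _ _ gamma setT _
    (index_enum 'I_N.+1) (fun i => g i k) measurableT (fun i => ig i k).
  have iA : gamma.-integrable setT (EFin \o (fun x => \1_(A k) x.2 : R)).
    apply: (@integrable_bounded_probability _ _ _ gamma _ (1)) => [|x].
      exact: measurableT_comp (measurable_indic (mA k)) measurable_snd.
    by rewrite indicE; case: (_ \in _); rewrite ?normr0 ?normr1.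
  rewrite (aeE _ (fun x => \1_(A k) x.2))//.
    rewrite (Rintegral_coupling_snd hgamma (g := \1_(A k)))//.
    by rewrite /Rintegral integral_indic// setIT.
  by move=> x px _; rewrite -mulr_suml sum_theta// mul1r.
- move=> i; have [isum <-] := @Rintegral_sum _ _ _ gamma setT _
    (index_enum 'I_m) (fun k => g i k) measurableT (fun k => ig i k).
  have iA : gamma.-integrable setT (EFin \o (fun x => theta i x.1)).
    apply: (@integrable_bounded_probability _ _ _ gamma _ ((mult i)^-1)) => [|x].
      exact: measurableT_comp (measurable_theta i) measurable_fst.
    by rewrite ger0_norm.
  rewrite (aeE _ (fun x => theta i x.1))//.
    rewrite (Rintegral_coupling_fst hgamma (g := theta i))//.
    rewrite Rintegral_empirical//; under eq_bigr do rewrite theta_coord.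
    by rewrite -mulr_suml divff ?mulr1// (gt_eqF (mult_gt0 i)).
  by move=> x _ Sx; rewrite -mulr_sumr A1// mulr1.
- have isc i k : gamma.-integrable setT (EFin \o (fun x => `|p i - c k| * g i k x)).
    exact: integrable_scaleR.
  have iin i : gamma.-integrable setT (EFin \o (fun x => \sum_k `|p i - c k| * g i k x)).
    by have [] := @Rintegral_sum _ _ _ gamma setT _
      (index_enum 'I_m) (fun k x => `|p i - c k| * g i k x) measurableT (isc i).
  have [isum sumE] := @Rintegral_sum _ _ _ gamma setT _ (index_enum 'I_N.+1)
    (fun i x => \sum_k `|p i - c k| * g i k x) measurableT iin.
  rewrite (_ : \sum_i _ = \int[gamma]_x (\sum_i \sum_k `|p i - c k| * g i k x)); last first.
    rewrite sumE; apply: eq_bigr => i _.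
    have [_ ->] := @Rintegral_sum _ _ _ gamma setT _
      (index_enum 'I_m) (fun k x => `|p i - c k| * g i k x) measurableT (isc i).
    by apply: eq_bigr => k _; rewrite RintegralZl// mulrC.
  have ic : gamma.-integrable setT (EFin \o (fun x : borelRn R n * borelRn R n =>
      enorm ((x.1 : 'rV[R]_n) - x.2) + eta)).
    apply: integrable_addR => //; first exact: integrable_cost.
    exact: finite_measure_integrable_cst.
  apply: (@le_trans _ _ (\int[gamma]_x (enorm ((x.1 : 'rV[R]_n) - x.2) + eta))).
    apply: ae_le_Rintegral => //; apply: filterS aer => x [px Sx].
    rewrite (@le_trans _ _ (\sum_i \sum_k (enorm ((x.1 : 'rV[R]_n) - x.2) + eta) * g i k x))//.
      apply: ler_sum => i _; apply: ler_sum => k _.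
      rewrite /g /theta !indicE.
      have [/set_mem ->|_] := boolP (x.1 \in [set p i]); last by rewrite !mul0r !mulr0.
      have [/set_mem Ak|_] := boolP (x.2 \in A k); last by rewrite !mulr0.
      rewrite ler_wpM2r ?mulr1 ?mul1r ?invr_ge0 ?(ltW (mult_gt0 _))//.
      rewrite -[p i - c k](subrK (p i - x.2)) addrC.
      rewrite (le_trans (ler_normD _ _))// lerD ?norm_le_enorm//.
      rewrite (_ : _ - _ = x.2 - c k); first exact: Ac.
      by apply/rowP => j; rewrite !mxE; ring.
    under eq_bigr do rewrite -mulr_sumr -mulr_sumr A1// mulr1.
    by rewrite -mulr_sumr sum_theta// mulr1.
  rewrite RintegralD//; [|exact: integrable_cost|exact: finite_measure_integrable_cst].
  rewrite [X in _ + X](_ : _ = eta); last by rewrite /Rintegral integral_probability_cst.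
  by rewrite lerD2r Rintegral_cost.
Qed.

End coupling_plan.

Section glue_empirical.
Context {R : realType} {d : nat}.
Notation n := (d + d)%N.
Variables (mu0 : P1 R n) (S : set 'rV[R]_n) (R0 : R).
Hypothesis cS : compact S.
Hypothesis S1 : mu0 (~` S) = 0%E.
Hypothesis R00 : 0 <= R0.
Hypothesis SR : forall z, S z -> `|z| <= R0.

Let mS : measurable (S : set (borelRn R n)).
Proof.
by apply: closed_measurable_borelRn; apply: compact_closed cS; exact: norm_hausdorff.
Qed.

(** The margin 1 around the ball of radius [R0] puts every point of positive weight at distance at
    least 1 from [S], so that its weight is at most [2 + R0] times that distance. *)
Definition tail_weight (x : 'rV[R]_n) : R :=
  if `|x| <= R0 + 1 then 0 else 1 + `|x|.

Lemma measurable_norm_borelRn : measurable_fun setT (fun x : borelRn R n => `|x : 'rV[R]_n|).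
Proof. by apply: continuous_measurable_borelRn; exact: norm_continuous. Qed.

Lemma measurable_tail_weight : measurable_fun setT (tail_weight : borelRn R n -> R).
Proof.
apply: measurable_fun_ifT => //.
  by apply: measurable_fun_ler => //; exact: measurable_norm_borelRn.
by apply: measurable_funD => //; exact: measurable_norm_borelRn.
Qed.

Lemma tail_weight_ge0 x : 0 <= tail_weight x.
Proof. by rewrite /tail_weight; case: ifP => // _; rewrite addr_ge0. Qed.

Lemma tail_weight_le x y : S y -> tail_weight x <= (2 + R0) * enorm (x - y).
Proof.
move=> /SR yR; rewrite /tail_weight; case: ifPn => [_|].
  by rewrite mulr_ge0 ?addr_ge0// sqrtr_ge0.
rewrite -ltNge => xR; have h1 : `|x| <= `|x - y| + R0.
  by rewrite -[x in leLHS](subrK y) (le_trans (ler_normD _ _))// lerD2l.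
have h2 : 1 <= `|x - y| by lra.
rewrite (@le_trans _ _ ((2 + R0) * `|x - y|))//; last first.
  by rewrite ler_wpM2l ?addr_ge0// norm_le_enorm.
have : (1 + R0) * 1 <= (1 + R0) * `|x - y| by rewrite ler_wpM2l// addr_ge0.
lra.
Qed.

(** If only one point is outside the ball, the other has the smaller norm, so [1 + |x| + |y|] is at
    most twice the weight of the outer point. *)
Lemma escape_le x y : escape (R0 + 1) x y <= 2 * tail_weight x + 2 * tail_weight y.
Proof.
rewrite /escape /tail_weight.
have := normr_ge0 x; have := normr_ge0 y.
case: ifPn; case: ifPn; case: ifPn => //=; move=> h1 h2 h3; try lra.
all: move: h1 h2 h3; rewrite -?ltNge; lra.
Qed.

Lemma mean_tail_weight N (p : 'I_N.+1 -> 'rV[R]_n) e :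
  (W1 (empirical p) mu0 < e%:E)%E ->
  N.+1%:R^-1 * \sum_(i < N.+1) tail_weight (p i) <= (2 + R0) * e.
Proof.
move=> /W1_lt_coupling[gamma hg he].
rewrite -[leRHS]add0r; apply: (coupling_mean_le hg he mS S1) => //.
- exact: measurable_tail_weight.
- exact: addr_ge0.
- by move=> x y Sy; rewrite add0r ger0_norm ?tail_weight_ge0// tail_weight_le.
Qed.

Lemma mean_norm N (p : 'I_N.+1 -> 'rV[R]_n) e :
  (W1 (empirical p) mu0 < e%:E)%E ->
  N.+1%:R^-1 * \sum_(i < N.+1) `|p i| <= R0 + e.
Proof.
move=> /W1_lt_coupling[gamma hg he].
rewrite -[X in _ + X]mul1r; apply: (coupling_mean_le hg he mS S1) => //.
- exact: measurable_norm_borelRn.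
- move=> x y /SR yR; rewrite normr_id mul1r -[x in leLHS](subrK y) addrC.
  by rewrite (le_trans (ler_normD _ _))// lerD// norm_le_enorm.
Qed.

(** With cells of size [e], each plan to the centres costs at most [2e], and each tail, doubled by
    [escape_le], at most [2 (2 + R0) e]; twice in all this gives [12 + 4 R0]. The bound on [h] goes
    through the common cell centre. *)
Lemma glue_empirical N M (p : 'I_N.+1 -> 'rV[R]_n) (q : 'I_M.+1 -> 'rV[R]_n) e :
  0 < e -> (W1 (empirical p) mu0 < e%:E)%E -> (W1 (empirical q) mu0 < e%:E)%E ->
  exists w : 'I_N.+1 -> 'I_M.+1 -> R,
  [/\ forall i j, 0 <= w i j, forall i, \sum_j w i j = N.+1%:R^-1,
      forall j, \sum_i w i j = M.+1%:R^-1 &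
      plan_cost (R0 + 1) w p q <= (12 + 4 * R0) * e].
Proof.
move=> e0 hp hq.
have [gam hgam cgam] := W1_lt_coupling hp.
have [gam' hgam' cgam'] := W1_lt_coupling hq.
have [m [A [c [mA A1 _ Ac]]]] := compact_cells cS e0.
have [al [al0 ala al1 alc]] := coupling_plan hgam cgam mS S1 (ltW e0) mA A1 Ac.
have [be [be0 bea be1 bec]] := coupling_plan hgam' cgam' mS S1 (ltW e0) mA A1 Ac.
have [w [w0 w1 w2 hw]] := glue_plans al0 be0 ala bea al1 be1.
exists w; split => //.
have := hw (fun i j => `|p i - q j| + escape (R0 + 1) (p i) (q j))
  (fun i k => `|p i - c k| + 2 * tail_weight (p i))
  (fun j k => `|q j - c k| + 2 * tail_weight (q j)).
have hyp i j k : `|p i - q j| + escape (R0 + 1) (p i) (q j) <=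
    `|p i - c k| + 2 * tail_weight (p i) + (`|q j - c k| + 2 * tail_weight (q j)).
  have := escape_le (p i) (q j).
  have := ler_normB (p i - c k) (q j - c k).
  rewrite (_ : p i - c k - _ = p i - q j); first lra.
  by apply/rowP => l; rewrite !mxE; ring.
move=> /(_ hyp) /le_trans; apply.
have split_sum K (be' : 'I_K.+1 -> 'I_m -> R) (u : 'I_K.+1 -> 'rV[R]_n) :
    (forall i, \sum_k be' i k = K.+1%:R^-1) ->
    \sum_i \sum_k be' i k * (`|u i - c k| + 2 * tail_weight (u i)) =
    \sum_i \sum_k be' i k * `|u i - c k| +
    2 * (K.+1%:R^-1 * \sum_i tail_weight (u i)).
  move=> hb; under eq_bigr do under eq_bigr do rewrite mulrDr.
  under eq_bigr do rewrite big_split/=.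
  rewrite big_split/=; congr (_ + _); rewrite !mulr_sumr.
  by apply: eq_bigr => i _; rewrite -mulr_suml hb; ring.
rewrite !split_sum//.
have h20 : 0 <= 2 :> R by [].
have h1 := ler_wpM2l h20 (mean_tail_weight hp).
have h2 := ler_wpM2l h20 (mean_tail_weight hq).
apply: (le_trans (lerD (lerD alc h1) (lerD bec h2))).
by rewrite le_eqVlt; apply/orP; left; apply/eqP; ring.
Qed.

End glue_empirical.

(** * The limit flow *)

Section image_measures.
Context {R : realType}.

Lemma probability_image d d' (X : measurableType d) (Y : measurableType d')
    (P : probability X R) (F : X -> Y) : measurable_fun setT F ->
  exists Q : probability Y R, (forall A, Q A = P (F @^-1` A)) /\
    forall g : Y -> \bar R, measurable_fun setT g -> (forall y, 0 <= g y)%E ->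
      (\int[Q]_y g y = \int[P]_x g (F x))%E.
Proof.
move=> mF.
pose FF : {mfun X >-> Y} := HB.pack F (isMeasurableFun.Build _ _ _ _ F mF).
exists (distribution P FF); split => // g mg g0.
by rewrite ge0_integral_distribution.
Qed.

Context {n : nat}.

Lemma P1_image (mu : P1 R n) (F : 'rV[R]_n -> 'rV[R]_n) (B : R) :
  measurable_fun setT (F : borelRn R n -> borelRn R n) ->
  (forall z, `|F z| <= B) ->
  exists nu : P1 R n, forall A, nu A = mu (F @^-1` A).
Proof.
move=> mF FB; have [Q [QE Qint]] := probability_image mu mF.
have moment : (\int[Q]_z (enorm (z : 'rV[R]_n))%:E < +oo)%E.
  rewrite Qint; last 2 first.
  - by apply/measurable_EFinP; exact: measurable_enorm.
  - by move=> y; rewrite lee_fin sqrtr_ge0.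
  apply: (@le_lt_trans _ _ (\int[mu]_x (n%:R * B)%:E)%E); last first.
    by rewrite integral_probability_cst ltry.
  apply: ge0_le_integral => //.
  - by move=> x _; rewrite lee_fin sqrtr_ge0.
  - apply/measurable_EFinP.
    by apply: measurableT_comp mF; exact: measurable_enorm.
  - by move=> x _; rewrite lee_fin (le_trans (enorm_le_norm _))// ler_wpM2l.
by exists (MkP1 moment).
Qed.

(** The joint law of [F] and [G] under [P] couples the two images. With [P = mu0] it compares two
    times of the flow; with [P] a plan it compares particles with the flow. *)
Lemma W1_image_le d (X : measurableType d) (P : probability X R)
    (F G : X -> borelRn R n) (mu nu : P1 R n) :
  measurable_fun setT F -> measurable_fun setT G ->
  (forall A : set (borelRn R n), measurable A -> mu A = P (F @^-1` A)) ->
  (forall A : set (borelRn R n), measurable A -> nu A = P (G @^-1` A)) ->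
  (W1 mu nu <= \int[P]_x (enorm ((F x : 'rV[R]_n) - G x))%:E)%E.
Proof.
move=> mF mG muE nuE.
have mFG : measurable_fun setT (fun x => (F x, G x)).
  exact: measurable_fun_pair.
have [Q [QE Qint]] := probability_image P mFG.
have hQ : is_coupling mu nu Q.
  move=> A mA; rewrite !QE muE// nuE//; split; congr (P _);
    by apply/seteqP; split => x //= [].
apply: (le_trans (W1_le_coupling hQ)).
rewrite Qint//; first by apply/measurable_EFinP; exact: measurable_cost.
by move=> y; rewrite lee_fin sqrtr_ge0.
Qed.

End image_measures.

Section vector_sequences.
Context {R : realType} {n : nat}.

Lemma cauchy_norm_cvg (u : nat -> 'rV[R]_n) :
  (forall e : R, 0 < e -> exists N0, forall N M, (N0 <= N)%N -> (N0 <= M)%N ->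
     `|u N - u M| < e) -> exists l : 'rV[R]_n, u @ \oo --> l.
Proof.
move=> h; suff : cvg (u @ \oo) by move=> /cvg_ex.
apply/cauchy_cvgP; apply: cauchy_exP => e e0.
have [N0 hN0] := h e e0; exists (u N0); exists N0 => // k /= N0k.
by rewrite -ball_normE/=; apply: hN0.
Qed.

Lemma norm_cvg_le (u : nat -> 'rV[R]_n) (l a : 'rV[R]_n) (B : R) :
  u @ \oo --> l -> (\forall k \near \oo, `|a - u k| <= B) -> `|a - l| <= B.
Proof.
move=> ul hB; have c : `|a - u k| @[k --> \oo] --> `|a - l|.
  by apply: cvg_norm; apply: cvgB => //; exact: cvg_cst.
rewrite -(cvg_lim _ c)//; apply: limr_le; last exact: hB.
by apply/cvg_ex; eexists; exact: c.
Qed.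

End vector_sequences.

Section limit_flow.
Context {R : realType} {d : nat} (T : R).
Variables (H : 'rV[R]_(d + d) -> 'rV[R]_d).
Variables (f : R -> 'rV[R]_(d + d) -> 'rV[R]_d) (CH : R) (kf : R -> R).
Notation mu := (@lebesgue_measure R).
Notation n := (d + d)%N.
Hypothesis T0 : 0 <= T.
Hypothesis cH : continuous H.
Hypothesis CH0 : 0 <= CH.
Hypothesis HC : forall z, `|H z| <= CH * (1 + `|z|).
Hypothesis HL : forall r : R, exists2 L : R, 0 <= L & forall z z', `|z| <= r ->
  `|z'| <= r -> `|H z - H z'| <= L * `|z - z'|.
Hypothesis kf0 : forall t, 0 <= kf t.
Hypothesis ikf : mu.-integrable `[0, T] (EFin \o kf).
Hypothesis f_ae : {ae mu, forall t, 0 <= t <= T ->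
  (forall z, `|f t z| <= kf t * (1 + `|z|)) /\
  (forall z z', `|f t z - f t z'| <= kf t * `|z - z'|)}.
Variables (mu0 : P1 R n) (S : set 'rV[R]_n) (R0 : R).
Hypothesis cS : compact S.
Hypothesis S1 : mu0 (~` S) = 0%E.
Hypothesis Spos : forall z, S z -> forall U : set 'rV[R]_n, open U -> U z ->
  (0 < mu0 U)%E.
Hypothesis R00 : 0 <= R0.
Hypothesis SR : forall z, S z -> `|z| <= R0.
Variable z : forall N : nat, 'I_N.+1 -> R -> 'rV[R]_n.
Hypothesis hz : forall N, integral_solution T H f (@z N).
Hypothesis hW : forall e : R, 0 < e -> \forall N \near \oo,
  (W1 (empirical (fun i => @z N i 0)) mu0 < e%:E)%E.

(** If all particles start at distance at least [e] from [zeta], the mass of the ball of radius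
    [e / 2] has to travel at least [e / 2], which costs [e / 2 * mu0 U]. A smaller W1 distance
    forbids this. *)
Lemma near_support_point (zeta : 'rV[R]_n) (e : R) : S zeta -> 0 < e ->
  \forall N \near \oo, exists i, `|@z N i 0 - zeta| < e.
Proof.
move=> Sz e0; have e20 : 0 < e / 2 by rewrite divr_gt0.
pose U : set 'rV[R]_n := ball zeta (e / 2).
have oU : open U by exact: ball_open.
have mU : measurable (U : set (borelRn R n)) by exact: open_measurable_borelRn.
have U0 : (0 < mu0 U)%E by apply: Spos Sz _ oU _; exact: ballxx.
have Ufin : mu0 U \is a fin_num.
  by rewrite ge0_fin_numE// (le_lt_trans (probability_le1 _ mU))// ltry.
have m0 : 0 < fine (mu0 U) by rewrite -lte_fin fineK.
have me0 : 0 < e / 2 * fine (mu0 U) by rewrite mulr_gt0.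
apply: filterS (hW me0) => N /W1_lt_coupling[gam hgam cgam].
apply: contrapT => /forallNP far.
have {}far i : e <= `|@z N i 0 - zeta| by rewrite leNgt; apply/negP/far.
have mrange := measurable_range (fun i => @z N i 0).
suff : (\int[gam]_x ((e / 2)%:E * (\1_U x.2)%:E) <=
    \int[gam]_p (enorm ((p.1 : 'rV[R]_n) - p.2))%:E)%E.
  rewrite ge0_integralZl//; last 2 first.
  - apply/measurable_EFinP.
    exact: measurableT_comp (measurable_indic mU) measurable_snd.
  - by rewrite lee_fin ltW.
  rewrite (ge0_integral_coupling_snd hgam (g := EFin \o \1_U))//; last 2 first.
  - by apply/measurable_EFinP; exact: measurable_indic.
  - by move=> x; rewrite lee_fin indicE.
  rewrite integral_indic// setIT => /le_lt_trans /(_ cgam).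
  move=> h; suff : ((e / 2 * fine (mu0 U))%:E < (e / 2 * fine (mu0 U))%:E)%E.
    by rewrite ltxx.
  by apply: le_lt_trans h; rewrite EFinM fineK.
apply: ae_ge0_le_integral => //.
- by move=> x _; rewrite -EFinM lee_fin mulr_ge0 ?(ltW e20)// indicE.
- apply: measurable_funeM; apply/measurable_EFinP.
  exact: measurableT_comp (measurable_indic mU) measurable_snd.
- by move=> x _; rewrite lee_fin sqrtr_ge0.
- by apply/measurable_EFinP; exact: measurable_cost.
have ? := ae_filter_ringOfSetsType gam.
have := coupling_ae hgam mrange measurableT (empirical_range _).
move=> /(_ _)[|]; first by rewrite setCT measure0.
move=> B [mB B0 BN]; exists B; split => // x nx; apply: BN => /= -[[i _ ix] _].
apply: nx => _; rewrite -EFinM lee_fin indicE.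
have [/set_mem xU|_] := boolP (x.2 \in U); last by rewrite mulr0 sqrtr_ge0.
rewrite mulr1 (le_trans _ (norm_le_enorm _))// -ix.
have := far i; move: xU; rewrite /U -ball_normE/= => xU.
have := ler_normD (@z N i 0 - x.2) (x.2 - zeta); rewrite addrA subrK.
by rewrite [`|x.2 - _|]distrC; lra.
Qed.

(** Once the W1 distance is below 1, the initial mean norm is at most [R0 + 1], which fixes one
    constant [A] for all large [N]. *)
Lemma eventually_apriori : exists2 A : R, 1 <= A &
  \forall N \near \oo, avg_norm (@z N) 0 <= R0 + 1 /\
    forall i t, 0 <= t <= T -> `|@z N i t| <= A * (1 + `|@z N i 0|).
Proof.
have m00 : 0 <= R0 + 1 by rewrite addr_ge0.
have [A A1 hA] := apriori T0 cH CH0 HC kf0 ikf f_ae m00.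
exists A => //; apply: filterS (hW ltr01) => N hN.
have hm := mean_norm cS S1 SR hN.
by split => //; exact: hA.
Qed.

Lemma eventually_cauchy (A : R) : 1 <= A ->
  (\forall N \near \oo, avg_norm (@z N) 0 <= R0 + 1 /\
    forall i t, 0 <= t <= T -> `|@z N i t| <= A * (1 + `|@z N i 0|)) ->
  exists2 K : R, 0 <= K & forall e : R, 0 < e -> exists N0, forall N M,
    (N0 <= N)%N -> (N0 <= M)%N -> forall i j t,
    `|@z N i 0| <= R0 + 1 -> `|@z M j 0| <= R0 + 1 -> 0 <= t <= T ->
    `|@z N i t - @z M j t| <= K * (`|@z N i 0 - @z M j 0| + e).
Proof.
move=> A1 [N1 _ hA].
have r0 : 0 <= R0 + 1 by rewrite addr_ge0.
have [K K0 hK] := particle_stability T0 cH CH0 HC HL kf0 ikf f_ae A1 r0.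
exists K => // e e0.
have C0 : 0 < 12 + 4 * R0 by rewrite ltr_pwDl// mulr_ge0.
have eC0 : 0 < e / (12 + 4 * R0) by rewrite divr_gt0.
have [N2 _ hN2] := hW eC0.
exists (maxn N1 N2) => N M; rewrite !geq_max => /andP[N1N N2N] /andP[N1M N2M].
move=> i j t gi gj tT.
have [w [w0 w1 w2 hw]] := glue_empirical cS S1 R00 SR eC0 (hN2 N N2N) (hN2 M N2M).
have := hK N M (@z N) (@z M) w (@hz N) (@hz M) (hA N N1N).2 (hA M N1M).2 w0 w1 w2
  i j t gi gj tT.
move=> /le_trans; apply; rewrite ler_wpM2l// lerD2l (le_trans hw)//.
by rewrite mulrC divfK// gt_eqF.
Qed.

(** [Z t zeta] is the limit of the trajectories of the particles starting nearest to [zeta]; these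
    starts converge to [zeta], and stability makes the sequence Cauchy. Every property of [Z] is
    read off one particle starting close enough to [zeta], up to an arbitrarily small error. *)
Lemma limit_flow : exists (A K : R) (Z : R -> 'rV[R]_n -> 'rV[R]_n),
  1 <= A /\ 0 <= K /\
  (\forall N \near \oo, forall i t, 0 <= t <= T ->
     `|@z N i t| <= A * (1 + `|@z N i 0|)) /\
  (forall e : R, 0 < e -> \forall N \near \oo, forall i t zeta,
    `|@z N i 0| <= R0 + 1 -> 0 <= t <= T -> S zeta ->
    `|@z N i t - Z t zeta| <= K * (`|@z N i 0 - zeta| + e)) /\
  (forall t zeta zeta', 0 <= t <= T -> S zeta -> S zeta' ->
    `|Z t zeta - Z t zeta'| <= K * `|zeta - zeta'|) /\
  (forall s t zeta, 0 <= s -> s <= t -> t <= T -> S zeta ->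
    `|Z t zeta - Z s zeta| <= K * \int[mu]_(y in `]s, t]) rate CH kf y) /\
  (forall t zeta, 0 <= t <= T -> S zeta -> `|Z t zeta| <= K).
Proof.
have [A A1 hA] := eventually_apriori.
have A0 : 0 <= A by exact: le_trans A1.
have [K K0 hK] := eventually_cauchy A1 hA.
(* The nearest particle is chosen at time 0 only, so that one index is followed through all
   times. *)
have nearest zeta N : exists i, forall j, `|@z N i 0 - zeta| <= `|@z N j 0 - zeta|.
  pose F (i : 'I_N.+1) := `|@z N i 0 - zeta|.
  have [i _ hi] := @Order.TotalTheory.arg_minP _ R 'I_N.+1 ord0 xpredT F isT.
  by exists i => j; exact: hi.
pose idx zeta N := sval (cid (nearest zeta N)).
have idx_cvg zeta e : S zeta -> 0 < e -> \forall N \near \oo, `|@z N (idx zeta N) 0 - zeta| < e.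
  move=> Sz e0; apply: filterS (near_support_point Sz e0) => N [i hi].
  by apply: le_lt_trans hi; exact: (svalP (cid (nearest zeta N))).
have idx_good zeta : S zeta -> \forall N \near \oo, `|@z N (idx zeta N) 0| <= R0 + 1.
  move=> Sz; apply: filterS (idx_cvg _ _ Sz ltr01) => N /ltW h.
  rewrite -[X in `|X|](subrK zeta) addrC (le_trans (ler_normD _ _))// lerD//.
  exact: SR.
have lim_ex t zeta : 0 <= t <= T -> S zeta ->
    exists l : 'rV[R]_n, (fun N => @z N (idx zeta N) t) @ \oo --> l.
  move=> tT Sz; apply: cauchy_norm_cvg => e e0.
  have K10 : 0 < K + 1 by rewrite ltr_wpDl.
  have e30 : 0 < e / (K + 1) / 3 by rewrite !divr_gt0.
  have [N0 hN0] := hK _ e30.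
  have [N1 _ hN1] := idx_cvg _ _ Sz e30.
  have [N2 _ hN2] := idx_good _ Sz.
  exists (maxn N0 (maxn N1 N2)) => N M; rewrite !geq_max.
  move=> /and3P[a1 a2 a3] /and3P[b1 b2 b3].
  rewrite (le_lt_trans (hN0 N M a1 b1 _ _ t (hN2 N a3) (hN2 M b3) tT))//.
  have h1 := hN1 N a2; have h2 := hN1 M b2.
  have h3 : `|@z N (idx zeta N) 0 - @z M (idx zeta M) 0| + e / (K + 1) / 3 < e / (K + 1).
    have := ler_normB (@z N (idx zeta N) 0 - zeta) (@z M (idx zeta M) 0 - zeta).
    rewrite (_ : @z N (idx zeta N) 0 - zeta - _ =
      @z N (idx zeta N) 0 - @z M (idx zeta M) 0); first by move: h1 h2; rewrite /=; lra.
    by apply/rowP => j; rewrite !mxE; ring.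
  apply: (@lt_le_trans _ _ ((K + 1) * (e / (K + 1)))); last first.
    by rewrite mulrC divfK// gt_eqF.
  apply: (@le_lt_trans _ _ (K * (e / (K + 1)))); first by rewrite ler_wpM2l// ltW.
  by rewrite ltr_pM2r ?divr_gt0// ltrDl.
pose Z t zeta : 'rV[R]_n := if pselect (0 <= t <= T /\ S zeta) is left h then
  sval (cid (lim_ex t zeta h.1 h.2)) else 0.
have ZE t zeta : 0 <= t <= T -> S zeta ->
    (fun N => @z N (idx zeta N) t) @ \oo --> Z t zeta.
  move=> tT Sz; rewrite /Z; case: pselect => [h|]; last by case.
  exact: (svalP (cid (lim_ex t zeta h.1 h.2))).
have limE e : 0 < e -> \forall N \near \oo, forall i t zeta,
    `|@z N i 0| <= R0 + 1 -> 0 <= t <= T -> S zeta ->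
    `|@z N i t - Z t zeta| <= K * (`|@z N i 0 - zeta| + e).
  move=> e0; have e20 : 0 < e / 2 by rewrite divr_gt0.
  have [N0 hN0] := hK _ e20; exists N0 => // N /= N0N i t zeta gi tT Sz.
  apply: (norm_cvg_le (ZE t zeta tT Sz)).
  near=> M.
  have gM : `|@z M (idx zeta M) 0| <= R0 + 1 by near: M; exact: idx_good.
  have cM : `|@z M (idx zeta M) 0 - zeta| < e / 2 by near: M; exact: idx_cvg.
  have N0M : (N0 <= M)%N by near: M; exact: nbhs_infty_ge.
  rewrite (le_trans (hN0 N M N0N N0M _ _ t gi gM tT))// ler_wpM2l//.
  have := ler_normB (@z N i 0 - zeta) (@z M (idx zeta M) 0 - zeta).
  rewrite (_ : @z N i 0 - zeta - _ = @z N i 0 - @z M (idx zeta M) 0); first by move: cM; lra.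
  by apply/rowP => j; rewrite !mxE; ring.
(* One particle for which all needed estimates hold at once. The last clause compares it with every
   [zeta'] of the support, which yields the Lipschitz bound in space. *)
have close zeta (e : R) : S zeta -> 0 < e -> exists N (i : 'I_N.+1),
    [/\ `|@z N i 0| <= R0 + 1,
      `|@z N i 0 - zeta| < e, avg_norm (@z N) 0 <= R0 + 1,
      (forall i t, 0 <= t <= T -> `|@z N i t| <= A * (1 + `|@z N i 0|)) &
      forall t zeta', 0 <= t <= T -> S zeta' ->
      `|@z N i t - Z t zeta'| <= K * (`|@z N i 0 - zeta'| + e)].
  move=> Sz e0; near \oo => N; exists N, (idx zeta N).
  have gN : `|@z N (idx zeta N) 0| <= R0 + 1 by near: N; exact: idx_good.
  have [h1 h2] : avg_norm (@z N) 0 <= R0 + 1 /\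
    forall i t, 0 <= t <= T -> `|@z N i t| <= A * (1 + `|@z N i 0|).
    by near: N.
  split => //; first by near: N; exact: idx_cvg.
  have hN : forall i t zeta, `|@z N i 0| <= R0 + 1 -> 0 <= t <= T -> S zeta ->
    `|@z N i t - Z t zeta| <= K * (`|@z N i 0 - zeta| + e).
    by near: N; exact: limE.
  by move=> t zeta'; exact: hN.
(* Constant of the time modulus for a particle starting in radius [R0 + 1] within a system of mean
   norm at most [R0 + 1]. *)
pose B := 1 + A * (2 + R0) + A * (2 + R0).
have B0 : 0 <= B by rewrite !addr_ge0// mulr_ge0// addr_ge0.
(* One constant for everything: [K] for stability, [B] for the time modulus, [A * (2 + R0)] for the
   size of [Z]. *)
exists A, (K + B + A * (2 + R0)), Z; split => //; split.
  by rewrite !addr_ge0// mulr_ge0// addr_ge0.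
have KK : K <= K + B + A * (2 + R0).
  by rewrite -addrA lerDl addr_ge0// mulr_ge0// addr_ge0.
split; first by apply: filterS hA => N [].
split.
  move=> e e0; apply: filterS (limE e e0) => N hN i t zeta gi tT Sz.
  rewrite (le_trans (hN i t zeta gi tT Sz))// ler_wpM2r//; exact: addr_ge0 (normr_ge0 _) (ltW e0).
split.
  move=> t zeta zeta' tT Sz Sz'; apply/ler_addgt0Pr => e e0.
  have K40 : 0 < 4 * (K + 1) by rewrite mulr_gt0// ltr_wpDl.
  have e40 : 0 < e / (4 * (K + 1)) by rewrite divr_gt0.
  have [N [i [gi ci _ _ hi]]] := close zeta _ Sz e40.
  have h1 := hi t zeta tT Sz; have h2 := hi t zeta' tT Sz'.
  have := ler_normB (@z N i t - Z t zeta') (@z N i t - Z t zeta).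
  rewrite (_ : @z N i t - Z t zeta' - _ = Z t zeta - Z t zeta'); last first.
    by apply/rowP => j; rewrite !mxE; ring.
  move=> /le_trans; apply; rewrite (le_trans (lerD h2 h1))//.
  have h3 : `|@z N i 0 - zeta'| <= `|@z N i 0 - zeta| + `|zeta - zeta'|.
    by rewrite (le_trans _ (ler_normD _ _))// addrA subrK.
  set del := e / _ in e40 ci *.
  have h4 : K * (`|@z N i 0 - zeta'| + del) <= K * (del + `|zeta - zeta'| + del).
    by rewrite ler_wpM2l// lerD2r (le_trans h3)// lerD2r ltW.
  have h5 : K * (`|@z N i 0 - zeta| + del) <= K * (del + del).
    by rewrite ler_wpM2l// lerD2r ltW.
  rewrite (le_trans (lerD h4 h5))//.
  have h6 : K * `|zeta - zeta'| <= (K + B + A * (2 + R0)) * `|zeta - zeta'|.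
    by rewrite ler_wpM2r.
  have h7 : 4 * (K + 1) * del = e by rewrite /del mulrC divfK// gt_eqF.
  move: h6 h7 e40; lra.
split.
  move=> s t zeta s0 st tT Sz; apply/ler_addgt0Pr => e e0.
  have K40 : 0 < 4 * (K + 1) by rewrite mulr_gt0// ltr_wpDl.
  have e40 : 0 < e / (4 * (K + 1)) by rewrite divr_gt0.
  have [N [i [gi ci hm hN hi]]] := close zeta _ Sz e40.
  have tT' : 0 <= t <= T by rewrite (le_trans s0).
  have sT' : 0 <= s <= T by rewrite s0 (le_trans st).
  have h1 := hi t zeta tT' Sz; have h2 := hi s zeta sT' Sz.
  have h3 := particle_time_modulus T0 cH CH0 HC kf0 ikf f_ae i (@hz N) hm A0 hN s0 st tT.
  set I := \int[mu]_(y in _) _ in h3 *.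
  have I0 : 0 <= I by apply: Rintegral_ge0 => y _; exact: rate_ge0.
  have h4 : (1 + A * (1 + `|@z N i 0|) + A * (1 + (R0 + 1))) * I <= B * I.
    rewrite ler_wpM2r// /B -!addrA lerD2l lerD// ler_wpM2l//; move: gi; lra.
  have := ler_normD (@z N i s - Z s zeta - (@z N i t - Z t zeta)) (@z N i t - @z N i s).
  rewrite (_ : @z N i s - Z s zeta - _ + _ = Z t zeta - Z s zeta); last first.
    by apply/rowP => j; rewrite !mxE; ring.
  have := ler_normB (@z N i s - Z s zeta) (@z N i t - Z t zeta).
  set del := e / _ in e40 ci h1 h2 *.
  have h5 : K * (`|@z N i 0 - zeta| + del) <= K * (del + del).
    by rewrite ler_wpM2l// lerD2r ltW.
  have h7 : 4 * (K + 1) * del = e by rewrite /del mulrC divfK// gt_eqF.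
  have h8 : B * I <= (K + B + A * (2 + R0)) * I.
    by rewrite ler_wpM2r// addrAC lerDr addr_ge0// mulr_ge0// addr_ge0.
  move: h1 h2 h3 h4 h7 h8 e40; lra.
move=> t zeta tT Sz; apply/ler_addgt0Pr => e e0.
have K20 : 0 < 2 * (K + 1) by rewrite mulr_gt0// ltr_wpDl.
have e20 : 0 < e / (2 * (K + 1)) by rewrite divr_gt0.
have [N [i [gi ci hm hN hi]]] := close zeta _ Sz e20.
have h1 := hi t zeta tT Sz; have h2 := hN i t tT.
have := ler_normB (@z N i t) (@z N i t - Z t zeta).
rewrite opprB addrC subrK.
set del := e / _ in e20 ci h1 *.
have h5 : K * (`|@z N i 0 - zeta| + del) <= K * (del + del).
  by rewrite ler_wpM2l// lerD2r ltW.
have h7 : 2 * (K + 1) * del = e by rewrite /del mulrC divfK// gt_eqF.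
have h8 : A * (1 + `|@z N i 0|) <= A * (2 + R0).
  by rewrite ler_wpM2l//; move: gi; lra.
move: h1 h2 h7 h8 e20 B0 K0; lra.
Unshelve. all: by end_near. Qed.

End limit_flow.

Section ereal_cvg0.
Context {R : realType} {X : Type}.

Lemma cvge0_near_lt (F : set_system X) (u : X -> \bar R) : Filter F ->
  (forall x, 0 <= u x)%E ->
  (forall e : R, 0 < e -> \forall x \near F, (u x < e%:E)%E) -> u @ F --> 0%E.
Proof.
move=> FF u0 h; apply/fine_cvgP; split.
  apply: filterS (h 1 ltr01) => x ux.
  by rewrite ge0_fin_numE// (lt_trans ux)// ltry.
apply/cvgrPdist_lt => e e0; apply: filterS (h e e0) => x ux.
have ufin : u x \is a fin_num by rewrite ge0_fin_numE// (lt_trans ux)// ltry.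
by rewrite /= sub0r normrN ger0_norm ?fine_ge0// -lte_fin fineK.
Qed.

Lemma near_lt_cvge0 (F : set_system X) (u : X -> \bar R) (e : R) : Filter F ->
  u @ F --> 0%E -> 0 < e -> \forall x \near F, (u x < e%:E)%E.
Proof.
move=> FF /fine_cvgP[ufin /cvgrPdist_lt h] /h.
apply: filterS2 ufin => x ux /=; rewrite sub0r normrN => hx.
by rewrite -(fineK ux) lte_fin (le_lt_trans (ler_norm _)).
Qed.

End ereal_cvg0.

Lemma W1_ge0 {R : realType} {n : nat} (mu nu : P1 R n) : (0 <= W1 mu nu)%E.
Proof.
apply: le_ereal_inf_tmp => _ [gamma _ <-]; apply: integral_ge0 => x _.
by rewrite lee_fin sqrtr_ge0.
Qed.

Section measurable_extension.
Context {R : realType} {n : nat}.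

(** On [S] the preimage of an open [U] is the trace of an open set, the points close to some [y] of
    [S] for which [F y] lies deep enough in [U]. The extension by 0 adds the complement of [S] or
    nothing. *)
Lemma measurable_lipschitz_restrict (S : set 'rV[R]_n) (F : 'rV[R]_n -> 'rV[R]_n) (K : R) :
  closed S -> 0 <= K -> (forall x y, S x -> S y -> `|F x - F y| <= K * `|x - y|) ->
  measurable_fun setT
    ((fun x => if x \in S then F x else 0) : borelRn R n -> borelRn R n).
Proof.
move=> cS K0 hF; have mS := closed_measurable_borelRn cS.
apply: (@measurability _ _ (borelRn R n) (borelRn R n) setT _ (@open 'rV[R]_n) erefl).
move=> _ [U oU <-].
rewrite setTI (_ : _ @^-1` U = (S `&` [set x | exists2 y, S y /\ U (F y) &
    exists r : R, [/\ 0 < r, ball (F y) (K * r) `<=` U & `|x - y| < r]])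
    `|` (~` S `&` [set x | U 0])).
  apply: measurableU; apply: measurableI => //.
  - apply: open_measurable_borelRn; rewrite openE => x [y Sy [r [r0 bU xy]]].
    apply/nbhs_ballP; exists (r - `|x - y|); first by rewrite /= subr_gt0.
    move=> x' bx'; have xx' : `|x - x'| < r - `|x - y| by move: bx'; rewrite -ball_normE.
    exists y => //; exists r; split => //.
    have := ler_normD (x' - x) (x - y); rewrite addrA subrK [`|x' - x|]distrC.
    by move: xx'; lra.
  - exact: measurableC.
  - rewrite (_ : [set _ | _] = if pselect (U 0) then setT else set0).
      by case: (pselect (U 0)) => U0 /=; [exact: measurableT|exact: measurable0].
    by case: (pselect (U 0)) => U0 /=; apply/seteqP; split.
apply/seteqP; split=> x /=.
  case: ifPn => [/set_mem Sx UFx|/negP xS U0]; last first.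
    by right; split => // Sx; apply: xS; rewrite inE.
  left; split => //; exists x => //.
  have : nbhs (F x) U by exact: open_nbhs_nbhs.
  move=> /nbhs_ballP[e /= e0 heU].
  exists (e / (K + 1)); have K10 : 0 < K + 1 by rewrite ltr_wpDl.
  split; first by rewrite divr_gt0.
    apply: subset_trans heU; apply: le_ball.
    by rewrite mulrCA ler_piMr ?(ltW e0)// ler_pdivrMr// mul1r lerDl.
  by rewrite subrr normr0 divr_gt0.
move=> [[Sx [y [Sy UFy] [r [r0 bU xy]]]]|[nSx U0]]; last first.
  by rewrite memNset.
rewrite mem_set//.
(* For [K = 0] the ball of radius [K * r] is empty and its inclusion says nothing, but then [F] is
   constant on [S]. *)
have [K00|Kpos] := eqVneq K 0.
  have : `|F x - F y| <= 0 by rewrite (le_trans (hF _ _ Sx Sy))// K00 mul0r.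
  by rewrite normr_le0 subr_eq0 => /eqP ->.
apply: bU; rewrite -ball_normE/= distrC (le_lt_trans (hF _ _ Sx Sy))//.
by rewrite ltr_pM2l// lt_neqAle eq_sym Kpos.
Qed.

(** Turns the map from initial to current particle positions into a Borel map of space. For
    coincident starts it picks one index; uniqueness of trajectories later makes the choice
    harmless. *)
Lemma measurable_finite_map N (p q : 'I_N.+1 -> 'rV[R]_n) :
  exists2 G : 'rV[R]_n -> 'rV[R]_n,
    measurable_fun setT (G : borelRn R n -> borelRn R n) &
    forall i, exists2 j, p j = p i & G (p i) = q j.
Proof.
pose G x := if pselect (exists i, p i = x) is left h then q (sval (cid h)) else 0.
exists G => [_ A mA|i]; last first.
  rewrite /G; case: pselect => [h|]; last by case; exists i.
  by exists (sval (cid h)) => //; exact: (svalP (cid h)).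
rewrite setTI (_ : G @^-1` A = \big[setU/set0]_(i < N.+1)
    (if pselect (A (G (p i))) then [set p i] else set0) `|`
    (~` range p `&` (if pselect (A 0) then setT else set0))).
  apply: measurableU.
    apply: bigsetU_measurable => i _; case: (pselect (A (G (p i)))) => _ /=.
      exact: measurable_set1_borelRn.
    exact: measurable0.
  apply: measurableI; first by apply: measurableC; exact: measurable_range.
  by case: (pselect (A 0)) => _ /=; [exact: measurableT|exact: measurable0].
rewrite -bigcup_seq; apply/seteqP; split=> [x /= Ax|x].
  have [[i ix]|nx] := pselect (exists i, p i = x).
    left; exists i => /=; first by rewrite mem_index_enum.
    by rewrite ix; case: pselect.
  right; split; first by move=> [i _ ix]; apply: nx; exists i.
  move: Ax; rewrite /G; case: pselect => [//|_] A0.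
  by case: pselect.
move=> [[i _]|[nx]].
  by case: pselect => //= Ai ->.
case: pselect => // A0 _; rewrite /= /G; case: pselect => // -[i ix].
by exfalso; apply: nx; exists i.
Qed.

End measurable_extension.

Section uniqueness.
Context {R : realType} {d : nat} (T : R).
Variables (H : 'rV[R]_(d + d) -> 'rV[R]_d).
Variables (f : R -> 'rV[R]_(d + d) -> 'rV[R]_d) (CH : R) (kf : R -> R).
Notation mu := (@lebesgue_measure R).
Notation n := (d + d)%N.
Hypothesis T0 : 0 <= T.
Hypothesis cH : continuous H.
Hypothesis CH0 : 0 <= CH.
Hypothesis HC : forall z, `|H z| <= CH * (1 + `|z|).
Hypothesis HL : forall r : R, exists2 L : R, 0 <= L & forall z z', `|z| <= r ->
  `|z'| <= r -> `|H z - H z'| <= L * `|z - z'|.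
Hypothesis kf0 : forall t, 0 <= kf t.
Hypothesis ikf : mu.-integrable `[0, T] (EFin \o kf).
Hypothesis f_ae : {ae mu, forall t, 0 <= t <= T ->
  (forall z, `|f t z| <= kf t * (1 + `|z|)) /\
  (forall z z', `|f t z - f t z'| <= kf t * `|z - z'|)}.

(* Stability of the system against itself along the diagonal plan. *)
Lemma particle_unique N (z : 'I_N.+1 -> R -> 'rV[R]_n) :
  integral_solution T H f z -> forall i j t, 0 <= t <= T ->
  z i 0 = z j 0 -> z i t = z j t.
Proof.
move=> hz i j t tT ij.
have [A A1 hA] := apriori T0 cH CH0 HC kf0 ikf f_ae (avg_norm_ge0 z 0).
have zA := hA N z hz (lexx _).
pose r := \sum_i `|z i 0|.
have r0 : 0 <= r by exact: sumr_ge0.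
have zr k : `|z k 0| <= r by rewrite /r (bigD1 k)//= lerDl sumr_ge0.
have [K K0 hK] := particle_stability T0 cH CH0 HC HL kf0 ikf f_ae A1 r0.
pose w (k l : 'I_N.+1) : R := (k == l)%:R * N.+1%:R^-1.
have w0 k l : 0 <= w k l by rewrite mulr_ge0// invr_ge0.
have w1 k : \sum_l w k l = N.+1%:R^-1.
  rewrite (bigD1 k)//= big1 ?addr0; first by rewrite /w eqxx mul1r.
  by move=> l lk; rewrite /w eq_sym (negbTE lk) mul0r.
have w2 l : \sum_k w k l = N.+1%:R^-1.
  rewrite (bigD1 l)//= big1 ?addr0; first by rewrite /w eqxx mul1r.
  by move=> k kl; rewrite /w (negbTE kl) mul0r.
have := hK N N z z w hz hz zA zA w0 w1 w2 i j t (zr i) (zr j) tT.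
rewrite ij subrr normr0 add0r (_ : plan_cost _ _ _ _ = 0) ?mulr0.
  by rewrite normr_le0 subr_eq0 => /eqP.
apply: big1 => k _; apply: big1 => l _; rewrite /w.
case: eqVneq => [->|_]; last by rewrite mul0r mul0r.
by rewrite subrr normr0 /escape zr/= addr0 mulr0.
Qed.

End uniqueness.

(** * The limit measure and uniform convergence in W1 *)

Section limit_measure.
Context {R : realType} {n : nat} (T : R).
Notation lm := (@lebesgue_measure R).
Variables (mu0 : P1 R n) (S : set 'rV[R]_n) (R0 : R).
Hypothesis cS : compact S.
Hypothesis S1 : mu0 (~` S) = 0%E.
Hypothesis R00 : 0 <= R0.
Hypothesis SR : forall z, S z -> `|z| <= R0.
Variable z : forall N : nat, 'I_N.+1 -> R -> 'rV[R]_n.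
Hypothesis hW : forall e : R, 0 < e -> \forall N \near \oo,
  (W1 (empirical (fun i => @z N i 0)) mu0 < e%:E)%E.
Variables (A K : R) (Z : R -> 'rV[R]_n -> 'rV[R]_n) (rt : R -> R).
Hypothesis A1 : 1 <= A.
Hypothesis K0 : 0 <= K.
Hypothesis zA : \forall N \near \oo, forall i t, 0 <= t <= T ->
     `|@z N i t| <= A * (1 + `|@z N i 0|).
Hypothesis zZ : forall e : R, 0 < e -> \forall N \near \oo, forall i t zeta,
    `|@z N i 0| <= R0 + 1 -> 0 <= t <= T -> S zeta ->
    `|@z N i t - Z t zeta| <= K * (`|@z N i 0 - zeta| + e).
Hypothesis ZL : forall t zeta zeta', 0 <= t <= T -> S zeta -> S zeta' ->
    `|Z t zeta - Z t zeta'| <= K * `|zeta - zeta'|.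
Hypothesis irt : lm.-integrable `[0, T] (EFin \o rt).
Hypothesis rt0 : forall t, 0 <= rt t.
Hypothesis Zt : forall s t zeta, 0 <= s -> s <= t -> t <= T -> S zeta ->
    `|Z t zeta - Z s zeta| <= K * \int[lm]_(y in `]s, t]) rt y.
Hypothesis ZK : forall t zeta, 0 <= t <= T -> S zeta -> `|Z t zeta| <= K.
Hypothesis z_unique : forall N i j t, 0 <= t <= T ->
  @z N i 0 = @z N j 0 -> @z N i t = @z N j t.

(** The value 0 off [S] and for times outside [[0, T]] gives a bounded Borel map for every real [t],
    so the limit measure and its support bound need no restriction on time. *)
Let Zs (t : R) x := if x \in S then (if 0 <= t <= T then Z t x else 0) else 0.

Let closed_S : closed S.
Proof. by apply: compact_closed cS; exact: norm_hausdorff. Qed.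

Let measurable_Zs t : measurable_fun setT (Zs t : borelRn R n -> borelRn R n).
Proof.
apply: (measurable_lipschitz_restrict (F := fun x => if 0 <= t <= T then Z t x else 0)
  closed_S K0) => x y Sx Sy.
case: ifP => tT; first exact: ZL.
by rewrite subrr normr0 mulr_ge0.
Qed.

Let Zs_le t x : `|Zs t x| <= K.
Proof.
rewrite /Zs; case: ifPn => [/set_mem Sx|]; rewrite ?normr0//.
by case: ifPn => [tT|]; rewrite ?normr0// ZK.
Qed.

Let flow_measure t : {nu : P1 R n | forall B, nu B = mu0 (Zs t @^-1` B)}.
Proof. by apply: cid; exact: (P1_image mu0 (measurable_Zs t) (Zs_le t)). Qed.

Definition limit_measure t : P1 R n := sval (flow_measure t).

Let limit_measureE t B : limit_measure t B = mu0 (Zs t @^-1` B).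
Proof. exact: (svalP (flow_measure t)). Qed.

Lemma limit_measure_ball t : limit_measure t (~` [set x | `|x| <= K]) = 0%E.
Proof.
rewrite limit_measureE (_ : _ @^-1` _ = set0); first exact: measure0.
by apply/seteqP; split => // x /=; apply; exact: Zs_le.
Qed.

Lemma msupport_limit_measure t : msupport (limit_measure t) `<=` [set x | `|x| <= K].
Proof.
move=> x hx /=; rewrite leNgt; apply/negP => Kx.
have oU : open (~` [set x : 'rV[R]_n | `|x| <= K]).
  apply: closed_openC; apply: compact_closed; last exact: compact_norm_ball.
  exact: norm_hausdorff.
have := hx _ oU; rewrite limit_measure_ball ltxx => h.
by apply: notF; apply: h => /=; rewrite leNgt Kx.
Qed.

(** The images at times [s] and [t] are coupled by moving each point along the flow. The cost is at
    most [n * K] times the integral of [rt] between the two times. *)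
Lemma limit_measure_time (e : R) : 0 < e -> exists2 del : R, 0 < del &
  forall s t, 0 <= s <= T -> 0 <= t <= T -> `|t - s| < del ->
    (W1 (limit_measure s) (limit_measure t) < e%:E)%E.
Proof.
move=> e0.
have C0 : 0 < n%:R * K + 1 by rewrite ltr_wpDl// mulr_ge0.
have eC0 : 0 < e / (n%:R * K + 1) by rewrite divr_gt0.
have mT : measurable `[0, T] by exact: measurable_itv.
have [del del0 hdel] := integrable_small_set mT irt eC0.
exists del => // s t sT tT st.
have key a b zeta : 0 <= a -> a <= b -> b <= T -> b - a < del -> S zeta ->
    `|Z b zeta - Z a zeta| <= K * (e / (n%:R * K + 1)).
  move=> a0 ab bT bad Sz; rewrite (le_trans (Zt a0 ab bT Sz))// ler_wpM2l//.
  rewrite (@eq_Rintegral _ _ _ lm _ (fun y => `|rt y|)); last first.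
    by move=> y _; rewrite ger0_norm.
  rewrite ltW// hdel//; first by apply: subset_itv; rewrite bnd_simp.
  by rewrite lebesgue_measure_itv/= lte_fin; case: ifP => _; rewrite -?EFinB lte_fin.
have hZ x : S x -> `|Z s x - Z t x| <= K * (e / (n%:R * K + 1)).
  move=> Sx; move: sT tT => /andP[s0 sT] /andP[t0 tT].
  have [ab|/ltW ba] := leP s t.
    rewrite distrC; apply: key => //.
    by move: st; rewrite ger0_norm// subr_ge0.
  by apply: key => //; move: st; rewrite distrC ger0_norm// subr_ge0.
apply: (@le_lt_trans _ _ (\int[mu0]_x (enorm (Zs s x - Zs t x))%:E)%E).
  exact: (W1_image_le (P := mu0)).
apply: (@le_lt_trans _ _ (n%:R * (K * (e / (n%:R * K + 1))))%:E); last first.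
  rewrite lte_fin mulrA mulrCA gtr_pMr// ltr_pdivrMr// mul1r ltrDl.
  by [].
rewrite -[leRHS](integral_probability_cst mu0); apply: ge0_le_integral => //.
- by move=> x _; rewrite lee_fin sqrtr_ge0.
- by apply/measurable_EFinP; exact: measurable_fun_enorm_sub.
move=> x _; rewrite lee_fin (le_trans (enorm_le_norm _))// ler_wpM2l//.
rewrite /Zs sT tT; case: ifPn => [/set_mem Sx|_]; first exact: hZ.
by rewrite subrr normr0 mulr_ge0// ltW.
Qed.

(** A nearly optimal plan between the initial data is pushed forward by the particle map and by the
    flow. Starts within radius [R0 + 1] use the closeness to [Z]; farther ones use growth, paid for
    by their distance of at least 1 from [S]. *)
Lemma empirical_cvg_limit_measure (e : R) : 0 < e -> \forall N \near \oo,
  forall t, 0 <= t <= T ->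
    (W1 (empirical (fun i => @z N i t)) (limit_measure t) < e%:E)%E.
Proof.
(* [K] serves near starts and [(A + K) * (2 + R0)] far ones; [n] converts norms. The total cost is
   at most [C * (eta + eta)], below [e] by the choice of [eta]. *)
move=> e0; pose C := n%:R * (K + (A + K) * (2 + R0)).
have A0 : 0 <= A by exact: le_trans A1.
have C10 : 0 <= (A + K) * (2 + R0) by rewrite mulr_ge0 ?addr_ge0.
have C0 : 0 <= C by rewrite mulr_ge0 ?addr_ge0.
have C20 : 0 < 2 * (C + 1) by rewrite mulr_gt0// ltr_wpDl.
have eta0 : 0 < e / (2 * (C + 1)) by rewrite divr_gt0.
set eta := e / _ in eta0.
near=> N => t tT.
have hN : (W1 (empirical (fun i => @z N i 0)) mu0 < eta%:E)%E by near: N; exact: hW.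
have hA : forall i t, 0 <= t <= T -> `|@z N i t| <= A * (1 + `|@z N i 0|).
  by near: N.
have hZ : forall i t zeta, `|@z N i 0| <= R0 + 1 -> 0 <= t <= T -> S zeta ->
    `|@z N i t - Z t zeta| <= K * (`|@z N i 0 - zeta| + eta).
  by near: N; exact: zZ.
have [gam hgam cgam] := W1_lt_coupling hN.
have [G mG hG] := measurable_finite_map (fun i => @z N i 0) (fun i => @z N i t).
have GE i : G (@z N i 0) = @z N i t.
  by have [j pj ->] := hG i; exact: z_unique.
have mS := closed_measurable_borelRn closed_S.
apply: (@le_lt_trans _ _ (\int[gam]_x (enorm (G x.1 - Zs t x.2))%:E)%E).
  apply: (W1_image_le (P := gam) (F := fun x => G x.1) (G := fun x => Zs t x.2)).
  - exact: measurableT_comp mG measurable_fst.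
  - exact: measurableT_comp (measurable_Zs t) measurable_snd.
  - move=> B mB.
    have mGB : measurable (G @^-1` B : set (borelRn R n)).
      by rewrite -[X in measurable X]setTI; exact: mG.
    transitivity (empirical (fun i => @z N i 0) (G @^-1` B)).
      transitivity (emp_measure (fun i => @z N i t) B); first by [].
      transitivity (emp_measure (fun i => @z N i 0) (G @^-1` B)); last by [].
      rewrite !emp_measureE; congr (_ * _)%E; apply: eq_bigr => i _.
      have inE' : (@z N i t \in B) = (@z N i 0 \in G @^-1` B).
        by apply/idP/idP => /set_mem h; apply/mem_set; move: h; rewrite /= GE.
      by rewrite !diracE inE'.
    rewrite -(hgam _ mGB).1; congr (gam _).
    by apply/seteqP; split => [x []|x].
  - move=> B mB; rewrite limit_measureE.
    have mZB : measurable (Zs t @^-1` B : set (borelRn R n)).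
      by rewrite -[X in measurable X]setTI; exact: (measurable_Zs t).
    rewrite -(hgam _ mZB).2; congr (gam _).
    by apply/seteqP; split => [x []|x].
have mcost : measurable_fun setT (fun x : borelRn R n * borelRn R n =>
    C%:E * ((enorm ((x.1 : 'rV[R]_n) - x.2))%:E + eta%:E))%E.
  apply: measurable_funeM; apply: emeasurable_funD => //.
  by apply/measurable_EFinP; exact: measurable_cost.
apply: (@le_lt_trans _ _ (\int[gam]_x
    (C%:E * ((enorm ((x.1 : 'rV[R]_n) - x.2))%:E + eta%:E)))%E).
  apply: ae_ge0_le_integral => //.
  - by move=> x _; rewrite lee_fin sqrtr_ge0.
  - apply/measurable_EFinP; apply: measurable_fun_enorm_sub.
      exact: measurableT_comp mG measurable_fst.
    exact: measurableT_comp (measurable_Zs t) measurable_snd.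
  - move=> x _; rewrite -EFinD -EFinM lee_fin mulr_ge0// addr_ge0 ?sqrtr_ge0//.
    exact: ltW.
  have ? := ae_filter_ringOfSetsType gam.
  apply: filterS (coupling_ae_range hgam mS S1) => x [[i _ ix] Sx] _.
  rewrite -EFinD -EFinM lee_fin -ix GE (le_trans (enorm_le_norm _))// /C -mulrA.
  rewrite ler_wpM2l// /Zs mem_set// tT.
  have dpos : 0 <= enorm (@z N i 0 - x.2) + eta.
    by rewrite addr_ge0 ?sqrtr_ge0// ltW.
  have [gi|bi] := leP `|@z N i 0| (R0 + 1).
    rewrite (le_trans (hZ i t x.2 gi tT Sx))//.
    rewrite (@le_trans _ _ (K * (enorm (@z N i 0 - x.2) + eta)))//.
      by rewrite ler_wpM2l// lerD2r norm_le_enorm.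
    by rewrite ler_wpM2r// lerDl.
  have h1 := hA i t tT; have h2 := ZK tT Sx; have h3 := SR Sx.
  have h4 : 1 + `|@z N i 0| <= (2 + R0) * enorm (@z N i 0 - x.2).
    have k1 : `|@z N i 0| <= `|@z N i 0 - x.2| + R0.
      by rewrite -[X in `|X| <= _](subrK x.2) (le_trans (ler_normD _ _))// lerD2l.
    have k2 : 1 <= `|@z N i 0 - x.2| by lra.
    rewrite (@le_trans _ _ ((2 + R0) * `|@z N i 0 - x.2|))//; last first.
      by rewrite ler_wpM2l ?addr_ge0// norm_le_enorm.
    have : (1 + R0) * 1 <= (1 + R0) * `|@z N i 0 - x.2| by rewrite ler_wpM2l// addr_ge0.
    lra.
  rewrite (le_trans (ler_normB _ _))// (le_trans (lerD h1 h2))//.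
  rewrite (@le_trans _ _ ((A + K) * (1 + `|@z N i 0|)))//.
    by rewrite mulrDl lerD2l ler_peMr// lerDl.
  rewrite (@le_trans _ _ ((A + K) * ((2 + R0) * enorm (@z N i 0 - x.2))))//.
    by rewrite ler_wpM2l// addr_ge0.
  rewrite mulrA (@le_trans _ _ ((A + K) * (2 + R0) * (enorm (@z N i 0 - x.2) + eta)))//.
    by rewrite ler_wpM2l// lerDl ltW.
  by rewrite ler_wpM2r// lerDr.
have c0 : forall p : borelRn R n * borelRn R n, setT p ->
    (0 <= (enorm ((p.1 : 'rV[R]_n) - p.2))%:E)%E.
  by move=> p _; rewrite lee_fin sqrtr_ge0.
have mc : measurable_fun setT (fun p : borelRn R n * borelRn R n =>
    (enorm ((p.1 : 'rV[R]_n) - p.2))%:E).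
  by apply/measurable_EFinP; exact: measurable_cost.
have eta0' : (0 <= eta%:E)%E by rewrite lee_fin ltW.
rewrite ge0_integralZl//; last 2 first.
- by apply: emeasurable_funD.
- by move=> x xT; rewrite adde_ge0// c0.
rewrite ge0_integralD// integral_probability_cst.
apply: (@le_lt_trans _ _ (C%:E * (eta%:E + eta%:E))%E).
  by apply: lee_wpmul2l => //; rewrite leeD2r// ltW.
rewrite -EFinD -EFinM lte_fin.
have hC : 2 * (C + 1) * eta = e by rewrite /eta mulrC divfK// gt_eqF.
by have := hC; have := eta0; lra.
Unshelve. all: by end_near. Qed.

End limit_measure.

(** * Test functions and the weak formulation *)

Section directional_calculus.
Context {R : realType}.

Lemma MVT_signed (phi dphi : R -> R) (a : R) :
  (forall s, is_derive (s : R^o) 1 (phi : R^o -> R^o) (dphi s)) ->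
  exists2 c, `|c| <= `|a| & phi a - phi 0 = a * dphi c.
Proof.
move=> hd; have cphi : continuous phi.
  move=> s; apply: differentiable_continuous; apply/derivable1_diffP.
  by have [] := hd s.
have wc (x y : R) : {within `[x, y], continuous phi}.
  by apply: continuous_subspaceT.
have hd' x y : forall s : R, s \in `]x, y[%R -> is_derive (s : R^o) 1 (phi : R^o -> R^o) (dphi s).
  by move=> s _; exact: hd.
have [a0|a0] := leP 0 a.
  have [c] := MVT_segment a0 (@hd' _ _) (wc _ _).
  rewrite in_itv/= => /andP[c0 ca] ->.
  by exists c; [rewrite !ger0_norm|rewrite subr0 mulrC].
have [c] := MVT_segment (ltW a0) (@hd' _ _) (wc _ _).
rewrite in_itv/= => /andP[c0 ca] e.
exists c; first by rewrite (ler0_norm ca) (ler0_norm (ltW a0)) lerN2.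
by rewrite -opprB e; ring.
Qed.

Lemma is_derive_line {V : normedModType R} (g : V -> R) (u y : V) s :
  derivable (g : V -> R^o) (y + s *: u) u ->
  is_derive (s : R^o) 1 ((fun r => g (y + r *: u)) : R^o -> R^o)
    ('D_u (g : V -> R^o) (y + s *: u)).
Proof.
have E : (fun h : R => h^-1 *: ((g \o shift (y + s *: u)) (h *: u) -
      g (y + s *: u) : R^o)) =
    (fun h : R => h^-1 *: (((fun r => g (y + r *: u)) \o shift s) (h *: (1 : R^o)) -
      g (y + s *: u) : R^o)).
  apply/funext => h /=; congr (_ *: (g _ - _)).
  by rewrite [_ *: 1]mulr1 scalerDl addrCA addrC -addrA.
rewrite /derivable E => dg; apply: DeriveDef; first exact: dg.
by rewrite /derive E.
Qed.

Context {n : nat}.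
Implicit Types (g : 'rV[R]_n -> R) (z h : 'rV[R]_n).

(** The coordinates are changed one at a time, with the one-dimensional mean value theorem on each
    edge. This links the directional derivatives in [Ck] to increments without a total
    derivative. *)
Lemma C1_increment g z h :
  (forall u y, derivable (g : 'rV[R]_n -> R^o) y u) ->
  exists2 xi : 'I_n -> 'rV[R]_n, forall k, `|xi k - z| <= `|h| &
    g (z + h) - g z = \sum_k h ord0 k * grad g (xi k) ord0 k.
Proof.
(* [p k] has its first [k] coordinates moved: [p 0 = z], [p n = z + h], and the increments
   telescope. *)
move=> dg; pose p (k : nat) : 'rV[R]_n :=
  \row_(j < n) (z ord0 j + if (j < k)%N then h ord0 j else 0).
have step (k : 'I_n) : exists2 c : R, `|c| <= `|h ord0 k| &
    g (p k.+1) - g (p k) = h ord0 k * grad g (p k + c *: delta_mx ord0 k) ord0 k.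
  have [//|c hc e] := @MVT_signed (fun r => g (p k + r *: delta_mx ord0 k))
    (fun r => 'D_(delta_mx ord0 k) (g : _ -> R^o) (p k + r *: delta_mx ord0 k))
    (h ord0 k).
    by move=> s; apply: is_derive_line; exact: dg.
  exists c => //; rewrite /grad mxE -e scale0r addr0; congr (g _ - _).
  apply/rowP => j; rewrite !mxE /= -addrA; congr (_ + _).
  have [jk|jk|/val_inj ->] := ltngtP j k.
  - rewrite (ltn_trans jk)// (_ : (j == k) = false) ?mulr0 ?addr0//.
    by apply/negbTE; rewrite neq_ltn jk.
  - rewrite ltnS leqNgt jk/= (_ : (j == k) = false) ?mulr0 ?addr0//.
    by apply/negbTE; rewrite neq_ltn jk orbT.
  - by rewrite eqxx ltnSn mulr1 add0r.
have /choice[c hc] : forall k, exists c : R, `|c| <= `|h ord0 k| /\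
    g (p k.+1) - g (p k) = h ord0 k * grad g (p k + c *: delta_mx ord0 k) ord0 k.
  by move=> k; have [c ? ?] := step k; exists c.
exists (fun k : 'I_n => p k + c k *: delta_mx ord0 k).
  move=> k; apply: norm_le_coord => // j; rewrite !mxE /= addrAC [z _ _ + _]addrC addrK.
  have [jk|jk] := ltnP j k.
    rewrite (_ : (j == k) = false) ?mulr0 ?addr0 ?coord_le_norm//.
    by apply/negbTE; rewrite neq_ltn jk.
  rewrite add0r; case: eqP => _; last by rewrite mulr0 normr0.
  by rewrite mulr1 (le_trans (proj1 (hc k)))// coord_le_norm.
rewrite (eq_bigr (fun k : 'I_n => g (p k.+1) - g (p k))); last first.
  by move=> k _; rewrite (proj2 (hc k)).
rewrite -(big_mkord xpredT (fun k => g (p k.+1) - g (p k))) telescope_sumr//.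
by congr (g _ - g _); apply/rowP => j; rewrite !mxE ?ltn_ord ?addr0.
Qed.

End directional_calculus.

Section test_functions.
Context {R : realType}.

(** Continuous functions are bounded on the compact set; off it [g] is zero in a neighbourhood, so
    its derivatives vanish there too. *)
Lemma test_function_bounds {V : normedModType R} (Omega : set V) (g : V -> R) (u : V) :
  test_function Omega g ->
  exists2 G, 0 <= G & exists2 r, 0 <= r & forall z,
    [/\ `|g z| <= G, `|'D_u (g : V -> R^o) z| <= G,
     ~ Omega z -> g z = 0 & r < `|z| -> 'D_u (g : V -> R^o) z = 0].
Proof.
move=> [hC [B [cB BO gB]]].
have [_ cD] := hC 1%N.
have cg : continuous g := hC 0%N.
have oB : open (~` B).
  by apply: closed_openC; apply: compact_closed => //; exact: norm_hausdorff.
have D0 z : ~ B z -> 'D_u (g : V -> R^o) z = 0.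
  move=> Bz.
  have nB : \forall y \near z, ~ B y by exact: open_nbhs_nbhs.
  have [->|u0] := eqVneq u 0.
    rewrite /derive; under eq_fun do rewrite /= scaler0 add0r subrr scaler0.
    exact: lim_cst.
  rewrite (@near_eq_derive _ _ _ _ (cst 0)) ?derive_cst//.
  by apply: filterS nB => y /gB ->.
have [r [_ hr]] := compact_bounded cB.
have Br z : B z -> `|z| <= `|r| + 1.
  by move=> Bz; apply: (hr (`|r| + 1)) => //; rewrite ltr_pwDr// ler_norm.
have bd (w : V -> R) : continuous w -> exists2 M, 0 <= M & forall z, B z -> `|w z| <= M.
  move=> cw; have cwB : compact (w @` B).
    by apply: continuous_compact => //; exact: continuous_subspaceT.
  have [M [_ hM]] := compact_bounded cwB; exists (`|M| + 1); first exact: addr_ge0.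
  by move=> z Bz; apply: (hM (`|M| + 1)); [rewrite ltr_pwDr// ler_norm|exists z].
have [G0 G00 hG0] := bd _ cg.
have [G1 G10 hG1] := bd _ (cD u).
exists (G0 + G1); first exact: addr_ge0.
exists (`|r| + 1); first exact: addr_ge0.
move=> z; split => [| |Oz|rz].
- have [Bz|Bz] := pselect (B z); last by rewrite gB// normr0 addr_ge0.
  by rewrite (le_trans (hG0 z Bz))// lerDl.
- have [Bz|Bz] := pselect (B z); last by rewrite D0// normr0 addr_ge0.
  by rewrite (le_trans (hG1 z Bz))// lerDr.
- by apply: gB => /BO.
- by apply: D0 => /Br; rewrite leNgt rz.
Qed.

Context {n : nat}.

Lemma test_function_grad (Omega : set 'rV[R]_n) (g : 'rV[R]_n -> R) :
  test_function Omega g ->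
  exists2 G, 0 <= G & exists2 r, 0 <= r & forall z,
    [/\ `|g z| <= G, forall k, `|grad g z ord0 k| <= G &
    r < `|z| -> forall k, grad g z ord0 k = 0].
Proof.
move=> tg; have [G0 G00 [r0 r00 h0]] := test_function_bounds 0 tg.
have /choice[Gr hGr] : forall k : 'I_n, exists Gr : R * R, [/\ 0 <= Gr.1, 0 <= Gr.2 &
    forall z, `|grad g z ord0 k| <= Gr.1 /\ (Gr.2 < `|z| -> grad g z ord0 k = 0)].
  move=> k; have [G ? [r ? h]] := test_function_bounds (delta_mx ord0 k) tg.
  by exists (G, r); split => // z; rewrite mxE; have [] := h z.
have s0 (F : 'I_n -> R) : (forall k, 0 <= F k) -> forall k, F k <= \sum_j F j.
  by move=> F0 k; rewrite (bigD1 k)//= lerDl sumr_ge0.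
have G10 k : 0 <= (Gr k).1 by have [] := hGr k.
have G20 k : 0 <= (Gr k).2 by have [] := hGr k.
exists (G0 + \sum_k (Gr k).1); first by rewrite addr_ge0// sumr_ge0.
exists (\sum_k (Gr k).2); first by rewrite sumr_ge0.
move=> z; split => [|k|rz k].
- by have [h _ _ _] := h0 z; rewrite (le_trans h)// lerDl sumr_ge0.
- have [_ _ /(_ z)[h _]] := hGr k; rewrite (le_trans h)//.
  by rewrite (le_trans (s0 _ G10 k))// lerDr.
- by have [_ _ /(_ z)[_ ->//]] := hGr k; exact: le_lt_trans (s0 _ G20 k) rz.
Qed.

Lemma continuous_grad (Omega : set 'rV[R]_n) (g : 'rV[R]_n -> R) k :
  test_function Omega g -> continuous (fun z => grad g z ord0 k).
Proof.
move=> [/(_ 1%N)[_ cD] _].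
have -> : (fun z => grad g z ord0 k) =
    (fun z => 'D_(delta_mx ord0 k) (g : _ -> R^o) z).
  by apply/funext => z; rewrite mxE.
exact: cD.
Qed.

Lemma test_function_lipschitz (Omega : set 'rV[R]_n) (g : 'rV[R]_n -> R) :
  test_function Omega g ->
  exists2 G, 0 <= G & forall z z', `|g z - g z'| <= G * `|z - z'|.
Proof.
move=> tg; have [G G0 [r _ hG]] := test_function_grad tg.
have [/(_ 1%N)[dg _] _] := tg.
exists (n%:R * G); first by rewrite mulr_ge0.
move=> z z'; have [xi _] := C1_increment z' (z - z') dg.
rewrite [z' + _]addrC subrK => ->; rewrite (le_trans (ler_norm_sum _ _ _))//.
rewrite (@le_trans _ _ (\sum_(k < n) (`|z - z'| * G)))//.
  apply: ler_sum => k _; rewrite normrM ler_pM// ?coord_le_norm//.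
  by have [_ /(_ k)] := hG (xi k).
by rewrite sumr_const card_ord -[leLHS]mulr_natl [`|_| * G]mulrC mulrA.
Qed.

Lemma diff_at_norm {V : normedModType R} (F : R -> V) c l : diff_at F c l ->
  exists2 del, 0 < del & forall x, `|x - c| < del ->
    `|F x - F c| <= (`|l| + 1) * `|x - c|.
Proof.
move=> /(_ _ ltr01)[del del0 h]; exists del => // x /h hx.
rewrite -[F x - F c](subrK ((x - c) *: l)) (le_trans (ler_normD _ _))// mulrDl addrC.
by rewrite lerD// normrZ mulrC.
Qed.

Lemma diff_atM (F G : R -> R) c k l :
  diff_at (F : R -> R^o) c k -> diff_at (G : R -> R^o) c l ->
  diff_at ((fun x => F x * G x) : R -> R^o) c (k * G c + F c * l).
Proof.
move=> hF hG e e0.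
have [d1 d10 h1] := diff_at_norm hF; have [d2 d20 h2] := diff_at_norm hG.
pose C := 1 + `|G c| + `|F c| + (`|k| + 1) * (`|l| + 1).
have C0 : 0 < C by rewrite /C ltr_pwDl// ?ltr_pwDl// ?mulr_ge0// ?addr_ge0.
have eC : 0 < e / C by rewrite divr_gt0.
have [d3 d30 h3] := hF _ eC; have [d4 d40 h4] := hG _ eC.
exists (Num.min (Num.min d1 d2) (Num.min (Num.min d3 d4) (e / C))).
  by rewrite !lt_min d10 d20 d30 d40.
move=> x; rewrite !lt_min => /andP[/andP[/h1 x1 /h2 x2] /andP[/andP[/h3 x3 /h4 x4] x5]].
rewrite /GRing.scale/= in x3 x4 *.
have -> : F x * G x - F c * G c - (x - c) * (k * G c + F c * l) =
    (F x - F c - (x - c) * k) * G c + F c * (G x - G c - (x - c) * l)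
    + (F x - F c) * (G x - G c) :> R by ring.
rewrite (le_trans (ler_normD _ _))// (le_trans (lerD (ler_normD _ _) (lexx _)))// !normrM.
have -> : e = (e / C) * (1 + `|G c| + `|F c| + (`|k| + 1) * (`|l| + 1)).
  by rewrite divfK// gt_eqF.
have y1 : `|F x - F c - (x - c) * k| * `|G c| <= e / C * `|x - c| * `|G c|.
  by rewrite ler_wpM2r.
have y2 : `|F c| * `|G x - G c - (x - c) * l| <= `|F c| * (e / C * `|x - c|).
  by rewrite ler_wpM2l.
have y3 : `|F x - F c| * `|G x - G c| <= (`|k| + 1) * (e / C) * ((`|l| + 1) * `|x - c|).
  rewrite ler_pM// (le_trans x1)// ler_wpM2l ?addr_ge0//; exact: ltW.
have y4 : 0 <= e / C * `|x - c| by rewrite mulr_ge0// ltW.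
rewrite (le_trans (lerD (lerD y1 y2) y3))// -subr_ge0.
by rewrite [leRHS](_ : _ = e / C * `|x - c|)//; ring.
Qed.

(** Chain rule along a curve that is only differentiable at [t]: in each coordinate the increment
    formula leaves one error from continuity of the gradient, of size [|w| + 1], and one from the
    curve, of size [G]. This explains [C]. *)
Lemma diff_at_test_function (Omega : set 'rV[R]_n) (g : 'rV[R]_n -> R)
    (z : R -> 'rV[R]_n) t w : test_function Omega g -> diff_at z t w ->
  diff_at ((fun s => g (z s)) : R -> R^o) t (edot (grad g (z t)) w).
Proof.
move=> tg dz e e0.
have [G G0 [r _ hG]] := test_function_grad tg.
have [/(_ 1%N)[dg _] _] := tg.
have [d1 d10 h1] := diff_at_norm dz.
pose C := 1 + n%:R * (`|w| + 1) + n%:R * G.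
have C0 : 0 < C by rewrite /C ltr_pwDl// ?ltr_pwDl// ?mulr_ge0// ?addr_ge0.
have eC : 0 < e / C by rewrite divr_gt0.
have [d2 d20 h2] := dz _ eC.
pose near_grad k y := `|grad g (z t) ord0 k - grad g y ord0 k| < e / C.
have hk k : \forall y \near z t, near_grad k y.
  by have /cvgrPdist_lt /(_ _ eC) := @continuous_grad _ _ k tg (z t).
have /nbhs_ballP[d3 /= d30 h3] : \forall y \near z t, forall k, near_grad k y.
  by apply: (@filter_forall _ _ near_grad (nbhs (z t)) (nbhs_filter _) hk).
pose W := `|w| + 1.
have W0 : 0 < W by rewrite ltr_wpDl.
exists (Num.min (Num.min d1 d2) (d3 / W)).
  by rewrite !lt_min d10 d20 divr_gt0.
move=> x; rewrite !lt_min => /andP[/andP[/h1 x1 /h2 x2]].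
rewrite ltr_pdivlMr// mulrC => x3.
have [xi hxi] := C1_increment (z t) (z x - z t) dg.
rewrite [z t + _]addrC subrK => ->; rewrite /edot /GRing.scale/= mulr_sumr -sumrB.
have term k : `|(z x - z t) ord0 k * grad g (xi k) ord0 k -
    (x - t) * (grad g (z t) ord0 k * w ord0 k)| <= (e / C * W + e / C * G) * `|x - t|.
  rewrite [X in `|X|](_ : _ = (z x - z t) ord0 k * (grad g (xi k) ord0 k - grad g (z t) ord0 k)
    + (z x - z t - (x - t) *: w) ord0 k * grad g (z t) ord0 k); last first.
    by rewrite !mxE; ring.
  rewrite (le_trans (ler_normD _ _))// mulrDl !normrM lerD//.
    rewrite -mulrA mulrC ler_pM//; last first.
      by rewrite (le_trans (coord_le_norm _ _)).
    rewrite distrC ltW//; apply: h3; rewrite -ball_normE /ball_/= distrC.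
    by rewrite (le_lt_trans (hxi k))// (le_lt_trans x1).
  rewrite mulrAC ler_pM//; first by rewrite (le_trans (coord_le_norm _ _)).
  by have [_ /(_ k)] := hG (z t).
rewrite (le_trans (ler_norm_sum _ _ _))// (le_trans (ler_sum _ (fun k _ => term k)))//.
rewrite sumr_const card_ord -[leLHS]mulr_natl mulrA ler_wpM2r//.
have -> : e = e / C * C by rewrite divfK// gt_eqF.
rewrite -mulrDr mulrCA mulfK ?gt_eqF// ler_wpM2l ?(ltW eC)//.
by rewrite /C mulrDr -addrA lerDr.
Qed.

End test_functions.

Section particle_weak_formulation.
Context {R : realType} {d : nat} (T : R).
Variables (H : 'rV[R]_(d + d) -> 'rV[R]_d).
Variables (f : R -> 'rV[R]_(d + d) -> 'rV[R]_d) (CH : R) (kf : R -> R).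
Notation mu := (@lebesgue_measure R).
Hypothesis T0 : 0 <= T.
Hypothesis cH : continuous H.
Hypothesis CH0 : 0 <= CH.
Hypothesis HC : forall z, `|H z| <= CH * (1 + `|z|).
Hypothesis cf : Caratheodory T f.
Hypothesis kf0 : forall t, 0 <= kf t.
Hypothesis ikf : mu.-integrable `[0, T] (EFin \o kf).
Hypothesis f_ae : {ae mu, forall t, 0 <= t <= T ->
  (forall z, `|f t z| <= kf t * (1 + `|z|)) /\
  (forall z z', `|f t z - f t z'| <= kf t * `|z - z'|)}.
Variables (N : nat) (x0 v0 : 'I_N.+1 -> 'rV[R]_d) (x v : 'I_N.+1 -> R -> 'rV[R]_d).
Hypothesis hp : particle_solution T H f x0 v0 x v.
Variables (g : 'rV[R]_(d + d) -> R).
Hypothesis tg : test_function setT g.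
Let z i t := row_mx (x i t) (v i t).
Let W := wfield H (fun s => empirical (z^~ s)) f.
Let rho i t := edot (grad g (z i t)) (W t (z i t)).

Let hz : integral_solution T H f z.
Proof. exact: (particle_integral_solution T0 cH CH0 HC cf kf0 ikf f_ae hp). Qed.

Let mT : measurable (`[0, T]%classic : set R).
Proof. exact: measurable_itv. Qed.

Let diff_z : {ae mu, forall t, 0 <= t <= T -> forall i,
  diff_at (z i) t (W t (z i t))}.
Proof.
have ? := ae_filter_ringOfSetsType mu.
have : {ae mu, forall t, forall i, t \in `[0, T] ->
    is_derive (t : R^o) 1 (x i : R^o -> 'rV[R]_d) (v i t) /\
    is_derive (t : R^o) 1 (v i : R^o -> 'rV[R]_d)
      (Defs.conv H (empirical (fun k => row_mx (x k t) (v k t)))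
         (row_mx (x i t) (v i t)) + f t (row_mx (x i t) (v i t)))}.
  by apply: filter_forall => i; have [] := hp i.
apply: filterS => t ht tT i.
have tT' : t \in `[0, T] by rewrite in_itv.
have [/is_derive_diff_at hx /is_derive_diff_at hv] := ht i tT'.
rewrite /W /wfield /z row_mxKr => e e0.
have e20 : 0 < e / 2 by rewrite divr_gt0.
have [d1 d10 h1] := hx _ e20; have [d2 d20 h2] := hv _ e20.
exists (Num.min d1 d2); first by rewrite lt_min d10.
move=> s; rewrite lt_min => /andP[/h1 k1 /h2 k2].
rewrite scale_row_mx !opp_row_mx !add_row_mx (le_trans (norm_row_mx _ _))//.
by rewrite (le_trans (lerD k1 k2))// -mulrDl -splitr.
Qed.

Let g_z_measurable (F : 'rV[R]_(d + d) -> R) i : continuous F ->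
  measurable_fun `[0, T] (fun t => F (z i t)).
Proof. by move=> cF; apply: continuous_comp_measurable => //; have [] := hz i. Qed.

Lemma integrable_test_particle i :
  mu.-integrable `[0, T] (EFin \o (fun t => g (z i t))).
Proof.
have [G G0 [r _ hG]] := test_function_grad tg.
apply: (@dominated_integrableR _ _ _ mu _ _ (cst G)) => //.
- by apply: g_z_measurable; have [/(_ 0%N)] := tg.
- by move=> t _; have [] := hG (z i t).
- exact: (integrable_cst_itv (a := 0) (b := T)).
Qed.

Lemma integrable_test_field i : mu.-integrable `[0, T] (EFin \o rho i).
Proof.
have [G G0 [r _ hG]] := test_function_grad tg.
have h k : mu.-integrable `[0, T]
    (EFin \o (fun t => W t (z i t) ord0 k * grad g (z i t) ord0 k)).
  apply: (@integrableM_bounded _ _ _ _ G) => //.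
  - by have [_ /(_ k)[]] := hz i.
  - by apply: (g_z_measurable (F := fun y => grad g y ord0 k)); exact: continuous_grad tg.
  - by move=> t _; have [_ /(_ k)] := hG (z i t).
have [+ _] := @Rintegral_sum _ _ _ mu _ _ (index_enum 'I_(d + d)) _ mT h.
congr (mu.-integrable _ (EFin \o _)); apply/funext => t.
by rewrite /rho /edot; apply: eq_bigr => k _; rewrite mulrC.
Qed.

(** The integrand is almost everywhere the derivative of [g (z i t) * phi t], which is absolutely
    continuous and vanishes at both ends since [phi] is supported inside the open interval. *)
Lemma particle_weak (phi : R -> R) i : test_function (`]0, T[%classic : set R^o) phi ->
  \int[mu]_(t in `[0, T]) (g (z i t) * 'D_1 (phi : R^o -> R^o) t + rho i t * phi t) = 0.
Proof.
move=> tphi; have [P P0 [rp _ hP]] := test_function_bounds (1 : R^o) tphi.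
have [/(_ 1%N)[dphi cD] _] := tphi.
have cphi : continuous (phi : R^o -> R^o) by have [/(_ 0%N)] := tphi.
have mphi : measurable_fun `[0, T] phi.
  by apply: measurable_funTS; exact: continuous_measurable_fun.
have mDphi : measurable_fun `[0, T] (fun t => 'D_1 (phi : R^o -> R^o) t).
  by apply: measurable_funTS; apply: continuous_measurable_fun; exact: cD.
have dphi' t : diff_at (phi : R -> R^o) t ('D_1 (phi : R^o -> R^o) t).
  by apply: is_derive_diff_at; apply: derivableP; exact: dphi.
have phiL s t : `|phi t - phi s| <= `|t - s| * P.
  have hd (r : R) : is_derive (r : R^o) 1 ((fun r => phi (s + r *: (1 : R^o))) : R^o -> R^o)
      ('D_1 (phi : R^o -> R^o) (s + r *: (1 : R^o))).
    by apply: is_derive_line; exact: dphi.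
  have [c _] := MVT_signed (t - s) hd.
  rewrite scale0r addr0 [_ *: 1]mulr1 [s + _]addrC subrK => ->.
  by rewrite normrM ler_wpM2l//; have [] := hP (s + c *: 1).
have [G G0 hG] := test_function_lipschitz tg.
have [B B0 [r _ hB]] := test_function_grad tg.
have acF : abs_continuous_real 0 T (fun t => g (z i t) * phi t).
  move=> e e0; have [acx acv _ _ _] := hp i.
  (* Position and velocity increments each cost [G * P], the increment of [phi] costs [B * P]; the
     final 1 makes the inequality strict. *)
  pose C := 2 * (G * P) + B * P + 1.
  have C0 : 0 < C by rewrite ltr_wpDl// addr_ge0 ?mulr_ge0// mulr_ge0.
  have eC : 0 < e / C by rewrite divr_gt0.
  have [d1 d10 h1] := acx _ eC; have [d2 d20 h2] := acv _ eC.
  exists (Num.min (Num.min d1 d2) (e / C)); first by rewrite !lt_min d10 d20.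
  move=> m s t hst dst; rewrite !lt_min => /andP[/andP[/(h1 _ _ _ hst dst) k1]].
  move=> /(h2 _ _ _ hst dst) k2 k3.
  have term k : `|g (z i (t k)) * phi (t k) - g (z i (s k)) * phi (s k)| <=
      G * P * (enorm (x i (t k) - x i (s k)) + enorm (v i (t k) - v i (s k))) +
      B * P * (t k - s k).
    have [_ [stk _]] := hst k.
    rewrite [X in `|X|](_ : _ = (g (z i (t k)) - g (z i (s k))) * phi (t k)
      + g (z i (s k)) * (phi (t k) - phi (s k))); last ring.
    rewrite (le_trans (ler_normD _ _))// !normrM lerD//.
      rewrite mulrAC ler_pM//; last by have [] := hP (t k).
      rewrite (le_trans (hG _ _))// ler_wpM2l// /z opp_row_mx add_row_mx.
      by rewrite (le_trans (norm_row_mx _ _))// lerD// norm_le_enorm.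
    rewrite -mulrA ler_pM//; first by have [] := hB (z i (s k)).
    by rewrite (le_trans (phiL _ _))// mulrC ger0_norm// subr_ge0.
  rewrite (le_lt_trans (ler_sum _ (fun k _ => term k)))// big_split/= -!mulr_sumr big_split/=.
  have GP : 0 <= G * P by rewrite mulr_ge0.
  have BP : 0 <= B * P by rewrite mulr_ge0.
  rewrite (@le_lt_trans _ _ (G * P * (e / C + e / C) + B * P * (e / C)))//.
    by rewrite lerD// ler_wpM2l// ?lerD// ltW.
  have -> : e = C * (e / C) by rewrite mulrC divfK// gt_eqF.
  by rewrite -subr_gt0 [ltRHS](_ : _ = e / C)// /C; field; rewrite gt_eqF.
have ig : mu.-integrable `[0, T]
    (EFin \o (fun t => g (z i t) * 'D_1 (phi : R^o -> R^o) t + rho i t * phi t)).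
  apply: integrable_addR => //.
    apply: (@integrableM_bounded _ _ _ _ P) => //; first exact: integrable_test_particle.
    by move=> t _; have [] := hP t.
  apply: (@integrableM_bounded _ _ _ _ P) => //; first exact: integrable_test_field.
  by move=> t _; have [] := hP t.
rewrite -(@ac_FTC _ 0 T _ _ T0 acF ig); last first.
  have ? := ae_filter_ringOfSetsType mu.
  apply: filterS diff_z => t ht tT; rewrite addrC.
  by apply: diff_atM; [apply: diff_at_test_function tg _; exact: ht|exact: dphi'].
have phi_out t : ~ (0 < t < T) -> phi t = 0.
  by move=> tT; have [_ _ h _] := hP t; apply: h; rewrite /= in_itv.
by rewrite !phi_out ?mulr0 ?subrr// ltxx// andbF.
Qed.

End particle_weak_formulation.

(** The domination is available only from [N0] on, so dominated convergence is applied to the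
    shifted sequence. *)
Lemma dominated_cvgR {R : realType} d (X : measurableType d)
    (mu : {measure set X -> \bar R}) (D : set X) (F_ : nat -> X -> R) (F G : X -> R)
    (N0 : nat) :
  measurable D -> (forall N, measurable_fun D (F_ N)) ->
  (forall x, D x -> F_ ^~ x @ \oo --> F x) ->
  {ae mu, forall x, D x -> forall N, (N0 <= N)%N -> `|F_ N x| <= G x} ->
  mu.-integrable D (EFin \o G) ->
  mu.-integrable D (EFin \o F) /\
  \int[mu]_(x in D) F_ N x @[N --> \oo] --> \int[mu]_(x in D) F x.
Proof.
move=> mD mF cF leG iG.
have mF' : measurable_fun D F.
  by apply: (@measurable_fun_cvg _ _ _ _ F_) => // x Dx; exact: cF.
have ? := ae_filter_ringOfSetsType mu.
have cF' : {ae mu, forall x, D x -> EFin (F_ (N + N0)%N x) @[N --> \oo] --> EFin (F x)}.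
  apply: aeW => x Dx; apply: cvg_EFin; first exact: nearW.
  by have := cF x Dx; rewrite -(@cvg_shiftn N0).
have leG' : {ae mu, forall x N, D x -> (`|EFin (F_ (N + N0)%N x)| <= EFin (G x))%E}.
  apply: filterS leG => x hx N Dx /=; rewrite lee_fin; apply: hx => //.
  by rewrite leq_addl.
have mFN N : measurable_fun D (EFin \o F_ (N + N0)%N) by exact/measurable_EFinP.
have [iF _ cI] := dominated_convergence mD mFN
  ((measurable_EFinP _ _).2 mF') cF' iG leG'.
split => //; rewrite -(@cvg_shiftn N0); apply: fine_cvg.
by rewrite fineK ?integrable_fin_num.
Qed.

(** Lets the vector-valued modulus lemmas apply to scalar functions. *)
Lemma continuous_const_mx {R : realType} {n : nat} (G : 'rV[R]_n -> R) :
  continuous G -> continuous ((fun z => const_mx (G z)) : 'rV[R]_n -> 'rV[R]_1).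
Proof.
move=> cG z; have ? := nbhs_filter z.
apply/cvgrPdist_lt => a a0; have /cvgrPdist_lt /(_ _ a0) := cG z.
apply: filterS => y; apply: le_lt_trans; apply: norm_le_coord => // i.
by rewrite !mxE.
Qed.

Lemma half_add_quotient_lt {R : realFieldType} (e C : R) : 0 < e -> 0 <= C ->
  e / 2 + C * (e / 2 / (C + 1)) < e.
Proof.
move=> e0 C0; have C1 : 0 < C + 1 by rewrite ltr_wpDl.
have : (C + 1) * (e / 2 / (C + 1)) = e / 2 by rewrite mulrC divfK// gt_eqF.
have : 0 < e / 2 / (C + 1) by rewrite !divr_gt0.
by have := splitr e; lra.
Qed.

(** * Integrals and convolutions under W1 convergence *)

Section integral_closeness.
Context {R : realType} {n : nat}.
Implicit Types (mu nu : P1 R n).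

Definition norm_ball (r : R) : set 'rV[R]_n := [set z | `|z| <= r].

Lemma measurable_norm_ball r : measurable (norm_ball r : set (borelRn R n)).
Proof.
apply: closed_measurable_borelRn; apply: compact_closed; first exact: norm_hausdorff.
exact: compact_norm_ball.
Qed.

Lemma empirical_norm_ball N (z : 'I_N.+1 -> 'rV[R]_n) r :
  (forall i, `|z i| <= r) -> empirical z (~` norm_ball r) = 0%E.
Proof.
move=> zr; transitivity (emp_measure z (~` norm_ball r)); first by [].
rewrite emp_measureE big1 ?mule0// => i _.
rewrite diracE memNset//= => h; apply: h; exact: zr.
Qed.

(* The modulus a + C |z - z'| with a arbitrarily small replaces Lipschitz
   continuity in Kantorovich's inequality. *)
Lemma W1_integral_close {I : Type} (P : I -> Prop) (G : I -> 'rV[R]_n -> R) K e :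
  (forall i, continuous (G i)) -> 0 <= K ->
  (forall a, 0 < a -> exists2 C, 0 <= C & forall i z z', P i -> `|z'| <= K ->
     `|G i z - G i z'| <= a + C * `|z - z'|) ->
  0 < e -> exists2 del, 0 < del & forall i mu nu, P i ->
    nu (~` norm_ball K) = 0%E -> (W1 mu nu < del%:E)%E ->
    `|\int[mu]_z G i z - \int[nu]_z G i z| < e.
Proof.
move=> cG K0 hG e0; have e20 : 0 < e / 2 by rewrite divr_gt0.
have [C C0 hC] := hG _ e20.
exists (e / 2 / (C + 1)); first by rewrite divr_gt0// ltr_wpDl.
move=> i mu nu Pi nuK W1d.
have mG : measurable_fun setT (G i : borelRn R n -> R).
  exact: continuous_measurable_borelRn.
have iG la : (P1_probability la).-integrable setT (EFin \o (G i : borelRn R n -> R)).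
  apply: (P1_integrable _ (M := `|G i 0| + e / 2 + C)) => // z.
  rewrite -[G i z](subrK (G i 0)) (le_trans (ler_normD _ _))//.
  have h : `|G i z - G i 0| <= e / 2 + C * `|z - 0| by apply: hC; rewrite ?normr0.
  have h2 := norm_le_enorm z; rewrite subr0 in h.
  have h3 : C * `|z| <= C * enorm z by rewrite ler_wpM2l.
  have h4 : 0 <= (`|G i 0| + e / 2) * enorm z.
    by rewrite mulr_ge0 ?sqrtr_ge0// addr_ge0// ltW.
  rewrite (le_trans (lerD h (lexx _)))// mulrDr mulr1 mulrDl.
  by have := C0; lra.
apply: le_lt_trans (half_add_quotient_lt e0 C0).
apply: (W1_integral_dist (A := setT) (B := norm_ball K)) => //.
- exact: measurable_norm_ball.
- by rewrite setCT; exact: measure0.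
- exact: ltW.
- move=> z z' _ z'K; rewrite (le_trans (hC i z z' Pi z'K))// lerD2l ler_wpM2l//.
  exact: norm_le_enorm.
Qed.

Lemma W1_integral_close1 (G : 'rV[R]_n -> R) M K e :
  0 <= K -> continuous G -> (forall z, `|G z| <= M * (1 + `|z|)) ->
  0 < e -> exists2 del, 0 < del & forall mu nu,
    nu (~` norm_ball K) = 0%E -> (W1 mu nu < del%:E)%E ->
    `|\int[mu]_z G z - \int[nu]_z G z| < e.
Proof.
move=> K0 cG GM e0.
have cG' := continuous_const_mx cG.
have GM' z : `|const_mx (G z) : 'rV[R]_1| <= M * (1 + `|z|).
  apply: le_trans (GM z); apply: norm_le_coord => // i.
  by rewrite !mxE.
have hG a : 0 < a -> exists2 C, 0 <= C & forall (i : unit) z z', True -> `|z'| <= K ->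
    `|G z - G z'| <= a + C * `|z - z'|.
  move=> a0; have [C C0 hC] := continuous_modulus cG' GM' K0 a0.
  exists C => // _ z z' _ z'K; apply: le_trans (hC z z' z'K).
  by apply: le_trans (coord_le_norm _ ord0); rewrite !mxE.
have [del del0 h] := W1_integral_close (fun=> cG) K0 hG e0.
by exists del => // mu nu nuK W; exact: (h tt mu nu I nuK W).
Qed.

End integral_closeness.

Section convolution.
Context {R : realType} {n d : nat} (H : 'rV[R]_n -> 'rV[R]_d) (CH : R).
Hypothesis cH : continuous H.
Hypothesis CH0 : 0 <= CH.
Hypothesis HC : forall z, `|H z| <= CH * (1 + `|z|).
Implicit Types (mu nu : P1 R n).

Let cHc y j : continuous (fun z : 'rV[R]_n => H (y - z) ord0 j).
Proof.
move=> z; have ? := nbhs_filter z.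
apply: (@continuous_comp _ _ _ (fun z : 'rV[R]_n => y - z) (fun z => H z ord0 j)).
  by apply: cvgB; [exact: cvg_cst|exact: cvg_id].
exact: (continuous_coord cH).
Qed.

Let integrable_conv nu r y j : nu (~` norm_ball r) = 0%E ->
  (P1_probability nu).-integrable setT (EFin \o (fun z : borelRn R n => H (y - z) ord0 j)).
Proof.
move=> nur.
apply: (P1_conull_integrable (measurable_norm_ball r) nur (M := CH * (1 + (`|y| + r)))).
  by apply: continuous_measurable_borelRn; exact: cHc.
move=> z zr; rewrite (le_trans (coord_le_norm _ _))// (le_trans (HC _))// ler_wpM2l// lerD2l.
by rewrite (le_trans (ler_normB _ _))// lerD2l.
Qed.

Let conull_cst_bound nu r (F : 'rV[R]_n -> R) (M : R) : nu (~` norm_ball r) = 0%E ->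
  (P1_probability nu).-integrable setT (EFin \o (F : borelRn R n -> R)) ->
  0 <= M -> (forall z, `|z| <= r -> `|F z| <= M) -> `|\int[nu]_z F z| <= M.
Proof.
move=> nur iF M0 hF.
rewrite (le_trans (le_norm_Rintegral_ae (g := cst M) _ iF _ _ _))//.
- apply: (integrable_cst_lty M (D := setT) (mu := P1_probability nu)) => //.
  exact: le_lt_trans (probability_le1 _ measurableT) (ltry _).
- exists (~` norm_ball r); split => //.
    by apply: measurableC; exact: measurable_norm_ball.
  by move=> z /= h zr; apply: h => _; exact: hF.
- by rewrite /Rintegral integral_probability_cst.
Qed.

Lemma norm_conv nu r y : 0 <= r -> nu (~` norm_ball r) = 0%E ->
  `|Defs.conv H nu y| <= CH * (1 + (`|y| + r)).
Proof.
move=> r0 nur; have M0 : 0 <= CH * (1 + (`|y| + r)) by rewrite mulr_ge0// !addr_ge0.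
apply: norm_le_coord => // j; rewrite mxE.
apply: (conull_cst_bound nur (integrable_conv _ _ nur)) => // z zr.
rewrite (le_trans (coord_le_norm _ _))// (le_trans (HC _))// ler_wpM2l// lerD2l.
by rewrite (le_trans (ler_normB _ _))// lerD2l.
Qed.

(** As [nu] lives in a ball, all differences at [y] stay in the radius [|y| + r]; one modulus of [H]
    there survives integration. *)
Lemma continuous_conv nu r : 0 <= r -> nu (~` norm_ball r) = 0%E ->
  continuous (Defs.conv H nu).
Proof.
move=> r0 nur y; have ? := nbhs_filter y.
apply/cvgrPdist_le => e e0; have e20 : 0 < e / 2 by rewrite divr_gt0.
have r10 : 0 <= `|y| + r by rewrite addr_ge0.
have [C C0 hC] := continuous_modulus cH HC r10 e20.
have [dl dl0 hdl] : exists2 dl, 0 < dl & C * dl <= e / 2.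
  exists (e / 2 / (C + 1)); first by rewrite divr_gt0// ltr_wpDl.
  by rewrite mulrCA ler_piMr// ?(ltW e20)// ler_pdivrMr ?ltr_wpDl// mul1r lerDl.
have : \forall y' \near y, `|y' - y| < dl.
  have /cvgrPdist_lt /(_ _ dl0) := cvg_dist0 y.
  by apply: filterS => y'; rewrite sub0r normrN normr_id distrC.
apply: filterS => y' y'd; apply: norm_le_coord; first exact: ltW.
move=> j; rewrite !mxE -RintegralB//; last 2 first.
- exact: integrable_conv nur.
- exact: integrable_conv nur.
apply: (conull_cst_bound nur _ (ltW e0)).
  exact: integrable_subR (integrable_conv _ _ nur) (integrable_conv _ _ nur).
move=> z zr; have := coord_le_norm (H (y - z) - H (y' - z)) j; rewrite !mxE.
move=> /le_trans; apply; rewrite distrC (le_trans (hC _ _ _))//.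
  by rewrite (le_trans (ler_normB _ _))// lerD2l.
rewrite opprB addrA subrK [leRHS](splitr e) lerD2l (le_trans _ hdl)// ler_wpM2l//.
exact: ltW.
Qed.

(** The functions [H (y - z)], for [y] in a ball and each coordinate, share one modulus, so a single
    [del] serves all [y]. Only [nu] has to be confined: the modulus allows one far point. *)
Lemma conv_close r K e : 0 <= r -> 0 <= K -> 0 < e -> exists2 del, 0 < del &
  forall mu nu, nu (~` norm_ball K) = 0%E -> (W1 mu nu < del%:E)%E ->
  forall y, `|y| <= r -> `|Defs.conv H mu y - Defs.conv H nu y| <= e.
Proof.
move=> r0 K0 e0.
pose G (i : 'rV[R]_n * 'I_d) (z : 'rV[R]_n) : R := H (i.1 - z) ord0 i.2.
have rK : 0 <= r + K by rewrite addr_ge0.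
have hG a : 0 < a -> exists2 C, 0 <= C & forall i z z', `|i.1| <= r -> `|z'| <= K ->
    `|G i z - G i z'| <= a + C * `|z - z'|.
  move=> a0; have [C C0 hC] := continuous_modulus cH HC rK a0.
  exists C => // i z z' ir z'K.
  have := coord_le_norm (H (i.1 - z) - H (i.1 - z')) i.2; rewrite !mxE.
  move=> /le_trans; apply; rewrite (le_trans (hC _ _ _))//.
    by rewrite (le_trans (ler_normB _ _))// lerD.
  by rewrite opprB [X in `|X|]addrC addrA subrK distrC.
have cG i : continuous (G i) by exact: cHc.
have [del del0 h] := W1_integral_close cG K0 hG e0.
exists del => // mu nu nuK W y yr; apply: norm_le_coord; first exact: ltW.
by move=> j; rewrite !mxE ltW//; exact: (h (y, j) mu nu yr nuK W).
Qed.

End convolution.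

Lemma continuous_sumM {R : realType} {n : nat} (I : finType)
    (a b : I -> 'rV[R]_n -> R) : (forall i, continuous (a i)) ->
  (forall i, continuous (b i)) -> continuous (fun z => \sum_i a i z * b i z).
Proof.
move=> ca cb z; have ? := nbhs_filter z.
apply: (@cvg_big _ _ _ _ _ _ _ _ _ (fun i z => a i z * b i z)) => [x|i _].
  exact: (@add_continuous R^o).
by apply: (@cvgM R); [exact: ca|exact: cb].
Qed.

Section field_pairing.
Context {R : realType} {d : nat} (H : 'rV[R]_(d + d) -> 'rV[R]_d) (CH : R).
Hypothesis cH : continuous H.
Hypothesis CH0 : 0 <= CH.
Hypothesis HC : forall z, `|H z| <= CH * (1 + `|z|).
Variable g : 'rV[R]_(d + d) -> R.
Hypothesis tg : test_function setT g.

(** Integrand of the weak equation at a frozen time, with the measure and the forcing as separate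
    arguments so that they can be varied independently. *)
Definition pairing (nu : P1 R (d + d)) (u : 'rV[R]_(d + d) -> 'rV[R]_d) z :=
  edot (grad g z) (row_mx (rsubmx z) (Defs.conv H nu z + u z)).

Let pairingE nu u z : pairing nu u z =
  \sum_(i < d) grad g z ord0 (lshift d i) * z ord0 (rshift d i) +
  \sum_(i < d) grad g z ord0 (rshift d i) * (Defs.conv H nu z ord0 i + u z ord0 i).
Proof.
rewrite /pairing /edot big_split_ord/=; congr (_ + _); apply: eq_bigr => i _.
  by rewrite row_mxEl; congr (_ * _); rewrite mxE.
by rewrite row_mxEr; congr (_ * _); rewrite mxE.
Qed.

Lemma continuous_pairing (nu : P1 R (d + d)) r (u : 'rV[R]_(d + d) -> 'rV[R]_d) : 0 <= r -> nu (~` norm_ball r) = 0%E ->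
  continuous u -> continuous (pairing nu u).
Proof.
move=> r0 nur cu.
have cc := continuous_conv cH CH0 HC r0 nur.
have -> : pairing nu u = (fun z =>
  \sum_(i < d) grad g z ord0 (lshift d i) * z ord0 (rshift d i) +
  \sum_(i < d) grad g z ord0 (rshift d i) * (Defs.conv H nu z ord0 i + u z ord0 i)).
  by apply/funext => z; exact: pairingE.
move=> z; have ? := nbhs_filter z.
have cs := @continuous_sumM R (d + d) 'I_d; apply: (@cvgD R R^o).
  apply: (cs (fun i z => grad g z ord0 (lshift d i)) (fun i z => z ord0 (rshift d i))).
    by move=> i; exact: (continuous_grad tg).
  by move=> i; exact: coord_continuous.
apply: (cs (fun i z => grad g z ord0 (rshift d i))
  (fun i z => Defs.conv H nu z ord0 i + u z ord0 i)).
  by move=> i; exact: (continuous_grad tg).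
move=> i y; have ? := nbhs_filter y.
by apply: (@cvgD R R^o); [exact: (continuous_coord cc)|exact: (continuous_coord cu)].
Qed.

(** The gradient vanishes outside a ball, so far particles do not contribute and bounds on that ball
    suffice. *)
Lemma pairing_close : exists2 r, 0 <= r & exists2 B, 0 <= B &
  (forall nu nu' u e, 0 <= e ->
     (forall y, `|y| <= r -> `|Defs.conv H nu y - Defs.conv H nu' y| <= e) ->
     forall z, `|pairing nu u z - pairing nu' u z| <= B * e) /\
  (forall nu u k c, 0 <= c -> 0 <= k -> (forall y, `|y| <= r -> `|Defs.conv H nu y| <= c) ->
     (forall y, `|y| <= r -> `|u y| <= k) ->
     forall z, `|pairing nu u z| <= B * (c + k + r)).
Proof.
have [G G0 [r r0 hG]] := test_function_grad tg.
have dG0 : 0 <= d%:R * G by rewrite mulr_ge0.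
exists r => //; exists (d%:R * G) => //; split => [nu nu' u e e0 hnu z|nu u k c c0 k0 hc hu z].
  have [_ hGz gz0] := hG z.
  rewrite !pairingE opprD addrACA subrr add0r -sumrB (le_trans (ler_norm_sum _ _ _))//.
  rewrite (@le_trans _ _ (\sum_(i < d) (G * e)))//; last first.
    by rewrite sumr_const card_ord -[leLHS]mulr_natl mulrA.
  apply: ler_sum => i _; rewrite -mulrBr opprD addrACA subrr addr0 normrM.
  have [zr|zr] := leP `|z| r; last by rewrite gz0// normr0 mul0r mulr_ge0.
  rewrite ler_pM// (le_trans _ (hnu z zr))//.
  by have := coord_le_norm (Defs.conv H nu z - Defs.conv H nu' z) i; rewrite !mxE.
have [_ hGz gz0] := hG z; rewrite pairingE.
have [zr|zr] := leP `|z| r; last first.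
  rewrite !big1 ?addr0 ?normr0; last 2 first.
  - by move=> i _; rewrite gz0// mul0r.
  - by move=> i _; rewrite gz0// mul0r.
  by rewrite mulr_ge0// !addr_ge0.
rewrite (le_trans (ler_normD _ _))// addrC mulrDr.
have bound (F : 'I_d -> 'I_(d + d)) (w : 'I_d -> R) b : (forall i, `|w i| <= b) ->
    `|\sum_(i < d) grad g z ord0 (F i) * w i| <= d%:R * G * b.
  move=> wb; rewrite (le_trans (ler_norm_sum _ _ _))//.
  rewrite (@le_trans _ _ (\sum_(i < d) (G * b)))//; last first.
    by rewrite sumr_const card_ord -[leLHS]mulr_natl mulrA.
  by apply: ler_sum => i _; rewrite normrM ler_pM.
rewrite lerD//; apply: bound => i.
  rewrite (le_trans (ler_normD _ _))// lerD// (le_trans (coord_le_norm _ _))//.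
    exact: hc.
  exact: hu.
exact: le_trans (coord_le_norm _ _) zr.
Qed.

End field_pairing.

Section weak_limit.
Context {R : realType} {d : nat} (T : R).
Variables (H : 'rV[R]_(d + d) -> 'rV[R]_d).
Variables (f : R -> 'rV[R]_(d + d) -> 'rV[R]_d) (CH : R) (kf : R -> R).
Notation mu := (@lebesgue_measure R).
Hypothesis T0 : 0 <= T.
Hypothesis cH : continuous H.
Hypothesis CH0 : 0 <= CH.
Hypothesis HC : forall z, `|H z| <= CH * (1 + `|z|).
Hypothesis cf : Caratheodory T f.
Hypothesis kf0 : forall t, 0 <= kf t.
Hypothesis ikf : mu.-integrable `[0, T] (EFin \o kf).
Hypothesis f_ae : {ae mu, forall t, 0 <= t <= T ->
  (forall z, `|f t z| <= kf t * (1 + `|z|)) /\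
  (forall z z', `|f t z - f t z'| <= kf t * `|z - z'|)}.
Variables (x0 v0 : forall N, 'I_N.+1 -> 'rV[R]_d).
Variables (x v : forall N, 'I_N.+1 -> R -> 'rV[R]_d).
Hypothesis hp : forall N, particle_solution T H f (@x0 N) (@v0 N) (@x N) (@v N).
Let z N i t := row_mx (@x N i t) (@v N i t).
Let nu N t := empirical (fun i => @z N i t).
Variables (m : R -> P1 R (d + d)) (K : R).
Hypothesis K0 : 0 <= K.
Hypothesis mK : forall t, m t (~` norm_ball K) = 0%E.
Hypothesis num : forall e : R, 0 < e -> \forall N \near \oo, forall t, 0 <= t <= T ->
  (W1 (nu N t) (m t) < e%:E)%E.

Let mT : measurable (`[0, T]%classic : set R).
Proof. exact: measurable_itv. Qed.

Let nu_ball N t : exists2 r, 0 <= r & nu N t (~` norm_ball r) = 0%E.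
Proof.
exists (\sum_i `|@z N i t|); first exact: sumr_ge0.
by apply: empirical_norm_ball => i; rewrite (bigD1 i)//= lerDl sumr_ge0.
Qed.

Lemma integral_cvg G M t : continuous G -> (forall y, `|G y| <= M * (1 + `|y|)) ->
  0 <= t <= T -> \int[nu N t]_y G y @[N --> \oo] --> \int[m t]_y G y.
Proof.
move=> cG GM tT; apply/cvgrPdist_lt => e e0.
have [del del0 h] := W1_integral_close1 K0 cG GM e0.
apply: filterS (num del0) => N /(_ t tT); rewrite distrC; exact: h.
Qed.

Variable g : 'rV[R]_(d + d) -> R.
Hypothesis tg : test_function setT g.

Let cft t : 0 <= t <= T -> continuous (f t).
Proof. by move=> tT; apply: cf.2; rewrite in_itv. Qed.

Let cg : continuous g. Proof. by have [/(_ 0%N)] := tg. Qed.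

Let cpairing_nu N t : 0 <= t <= T -> continuous (pairing H g (nu N t) (f t)).
Proof.
move=> tT; have [r r0 nur] := nu_ball N t.
exact: (continuous_pairing cH CH0 HC tg r0 nur (cft tT)).
Qed.

Let cpairing_m t : 0 <= t <= T -> continuous (pairing H g (m t) (f t)).
Proof.
by move=> tT; exact: (continuous_pairing cH CH0 HC tg K0 (mK t) (cft tT)).
Qed.

(** First the limit integrand is kept fixed and only the measure varies; then the convolution inside
    is exchanged, uniformly on the ball that carries the gradient. *)
Lemma pairing_cvg t : 0 <= t <= T ->
  \int[nu N t]_y pairing H g (nu N t) (f t) y @[N --> \oo] -->
  \int[m t]_y pairing H g (m t) (f t) y.
Proof.
move=> tT; have [r r0 [B B0 [h1 h2]]] := pairing_close H tg.
have [C C0 hC] := continuous_modulus_ball r (cft tT) ltr01.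
pose k := `|f t 0| + (1 + C * r).
have fk y : `|y| <= r -> `|f t y| <= k.
  move=> yr; rewrite -[f t y](subrK (f t 0)) (le_trans (ler_normD _ _))// addrC lerD2l.
  rewrite (le_trans (hC y 0 yr _)) ?normr0// subr0 lerD2l ler_wpM2l//.
have k0 : 0 <= k by rewrite !addr_ge0// mulr_ge0.
have c0 : 0 <= CH * (1 + (r + K)) by rewrite mulr_ge0// !addr_ge0.
have cm y : `|y| <= r -> `|Defs.conv H (m t) y| <= CH * (1 + (r + K)).
  by move=> yr; rewrite (le_trans (norm_conv cH CH0 HC y K0 (mK t)))// ler_wpM2l// lerD2l lerD2r.
have hM y : `|pairing H g (m t) (f t) y| <= B * (CH * (1 + (r + K)) + k + r) * (1 + `|y|).
  rewrite (le_trans (h2 _ _ _ _ c0 k0 cm fk y))// ler_peMr ?lerDl//.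
  exact: mulr_ge0 B0 (addr_ge0 (addr_ge0 c0 k0) r0).
have := integral_cvg (cpairing_m tT) hM tT.
move=> /cvgrPdist_lt hlim; apply/cvgrPdist_le => e e0.
have e20 : 0 < e / 2 by rewrite divr_gt0.
have eB0 : 0 < e / 2 / (B + 1) by rewrite divr_gt0// ltr_wpDl.
have [del del0 hdel] := conv_close cH HC r0 K0 eB0.
apply: filterS2 (hlim _ e20) (num del0) => N k1 /(_ t tT) W.
rewrite -(subrK (\int[nu N t]_y pairing H g (m t) (f t) y) (\int[m t]_y _)) -addrA.
apply: le_trans (ler_normD _ _) _.
rewrite [leRHS](splitr e); apply: lerD; first exact: ltW.
rewrite !Rintegral_empirical; last 2 first.
- by apply: continuous_measurable_borelRn; exact: cpairing_nu.
- by apply: continuous_measurable_borelRn; exact: cpairing_m.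
rewrite -mulrBr -sumrB normrM ger0_norm ?invr_ge0//.
rewrite (le_trans (ler_wpM2l _ (ler_norm_sum _ _ _))) ?invr_ge0//.
rewrite ler_pdivrMl// (@le_trans _ _ (\sum_(i < N.+1) (B * (e / 2 / (B + 1)))))//.
  apply: ler_sum => i _; rewrite distrC; apply: h1; first exact: ltW.
  by move=> y; exact: hdel.
rewrite sumr_const card_ord -[leLHS]mulr_natl ler_wpM2l// mulrCA ler_piMr ?(ltW e20)//.
by rewrite ler_pdivrMr ?ltr_wpDl// mul1r lerDl.
Qed.

(** From some [N0] on, the convolution with [nu N t] is within 1 of that with [m t], which is
    bounded on the ball since [m t] has bounded support. The forcing contributes [kf t]. *)
Lemma pairing_bound : exists C N0, {ae mu, forall t, `[0, T]%classic t ->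
  forall N, (N0 <= N)%N ->
  `|\int[nu N t]_y pairing H g (nu N t) (f t) y| <= C * (1 + kf t)}.
Proof.
have [r r0 [B B0 [_ h2]]] := pairing_close H tg.
have [del del0 hdel] := conv_close cH HC r0 K0 ltr01.
have [N0 _ hN0] := num del0.
pose c := CH * (1 + (r + K)) + 1.
have c0 : 0 <= c by rewrite addr_ge0// mulr_ge0// !addr_ge0.
exists (B * (c + (1 + r) + r)), N0.
have ? := ae_filter_ringOfSetsType mu.
apply: filterS f_ae => t + tT N N0N.
have tT' : 0 <= t <= T by move: tT; rewrite /= in_itv.
move=> /(_ tT')[hf _].
have fk y : `|y| <= r -> `|f t y| <= kf t * (1 + r).
  by move=> yr; rewrite (le_trans (hf y))// ler_wpM2l// lerD2l.
have k0 : 0 <= kf t * (1 + r) by rewrite mulr_ge0// addr_ge0.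
have cN y : `|y| <= r -> `|Defs.conv H (nu N t) y| <= c.
  move=> yr; rewrite -[Defs.conv _ _ _](subrK (Defs.conv H (m t) y)).
  rewrite (le_trans (ler_normD _ _))// addrC lerD//.
    by rewrite (le_trans (norm_conv cH CH0 HC y K0 (mK t)))// ler_wpM2l// lerD2l lerD2r.
  by apply: hdel => //; exact: hN0.
have hpair := h2 _ _ _ _ c0 k0 cN fk.
rewrite Rintegral_empirical; last first.
  by apply: continuous_measurable_borelRn; exact: cpairing_nu.
rewrite normrM ger0_norm ?invr_ge0// ler_pdivrMl//.
rewrite (le_trans (ler_norm_sum _ _ _))//.
rewrite (@le_trans _ _ (\sum_(i < N.+1) (B * (c + kf t * (1 + r) + r))))//.
  by apply: ler_sum => i _; exact: hpair.
rewrite sumr_const card_ord -[leLHS]mulr_natl ler_wpM2l// -mulrA ler_wpM2l//.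
have : 0 <= kf t * (c + r) by rewrite mulr_ge0// addr_ge0.
have : 0 <= r := r0.
by lra.
Qed.

(** The weak identity is exact for every [N], so its limit is again 0. Dominated convergence also
    yields the integrability of the two limit functions of time. *)
Lemma weak_limit : distributional_derivative T (fun t => \int[m t]_y g y)
  (fun t => \int[m t]_y edot (grad g y) (wfield H m f t y)).
Proof.
have [G G0 [r _ hG]] := test_function_grad tg.
have gG y : `|g y| <= G by have [] := hG y.
have mg : measurable_fun setT (g : borelRn R (d + d) -> R).
  exact: continuous_measurable_borelRn.
have uE N t : \int[nu N t]_y g y = N.+1%:R^-1 * \sum_i g (@z N i t).
  exact: Rintegral_empirical.
have gE N t : 0 <= t <= T -> \int[nu N t]_y pairing H g (nu N t) (f t) y =
    N.+1%:R^-1 * \sum_i pairing H g (nu N t) (f t) (@z N i t).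
  move=> tT; apply: Rintegral_empirical.
  by apply: continuous_measurable_borelRn; exact: cpairing_nu.
pose u N t := N.+1%:R^-1 * \sum_i g (@z N i t).
pose w N t := N.+1%:R^-1 * \sum_i pairing H g (nu N t) (f t) (@z N i t).
have iu N : mu.-integrable `[0, T] (EFin \o u N).
  apply: integrable_scaleR => //.
  have [//] := @Rintegral_sum _ _ _ mu _ _ (index_enum 'I_N.+1) _ mT
    (integrable_test_particle T0 cH CH0 HC cf kf0 ikf f_ae (@hp N) tg).
have iw N : mu.-integrable `[0, T] (EFin \o w N).
  apply: integrable_scaleR => //.
  have [//] := @Rintegral_sum _ _ _ mu _ _ (index_enum 'I_N.+1) _ mT
    (integrable_test_field T0 cH CH0 HC cf kf0 ikf f_ae (@hp N) tg).
have u_cvg t : `[0, T]%classic t -> u ^~ t @ \oo --> \int[m t]_y g y.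
  rewrite /= in_itv/= => tT.
  have := @integral_cvg g G t cg _ tT; under eq_cvg do rewrite uE; apply.
  by move=> y; rewrite (le_trans (gG y))// ler_peMr// lerDl.
have w_cvg t : `[0, T]%classic t -> w ^~ t @ \oo --> \int[m t]_y pairing H g (m t) (f t) y.
  rewrite /= in_itv/= => tT; have := pairing_cvg tT.
  by under eq_cvg do rewrite gE//.
have icst c : mu.-integrable `[0, T] (EFin \o (cst c : R -> R)).
  exact: (integrable_cst_itv (a := 0) (b := T)).
have ub N t : `|u N t| <= G.
  rewrite normrM ger0_norm ?invr_ge0// ler_pdivrMl//.
  rewrite (le_trans (ler_norm_sum _ _ _))//.
  rewrite (@le_trans _ _ (\sum_(i < N.+1) G))//; first exact: ler_sum.
  by rewrite sumr_const card_ord -[leLHS]mulr_natl.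
have [Cw [N0 w_ae]] := pairing_bound.
have w_ae' : {ae mu, forall t, `[0, T]%classic t -> forall N, (N0 <= N)%N ->
    `|w N t| <= Cw * (1 + kf t)}.
  have ? := ae_filter_ringOfSetsType mu.
  apply: filterS w_ae => t ht tT N N0N; have := ht tT N N0N.
  by rewrite gE//; move: tT; rewrite /= in_itv.
have ib : mu.-integrable `[0, T] (EFin \o (fun t => Cw * (1 + kf t))).
  by apply: integrable_scaleR => //; apply: integrable_addR => //; exact: icst.
have u_ae : {ae mu, forall t, `[0, T]%classic t -> forall N, (0 <= N)%N -> `|u N t| <= cst G t}.
  by apply: aeW => t _ N _; exact: ub.
have [iU _] := @dominated_cvgR _ _ _ mu _ u _ (cst G) 0%N mT (fun N => integrable_measurableR (iu N)) u_cvg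
  u_ae (icst G).
have [iW _] := @dominated_cvgR _ _ _ mu _ w _ _ N0 mT (fun N => integrable_measurableR (iw N)) w_cvg w_ae' ib.
split.
- apply: open_integrable_locally; first exact: interval_open.
  by apply: integrableS iU => //; apply: subset_itv; rewrite bnd_simp.
- apply: open_integrable_locally; first exact: interval_open.
  by apply: integrableS iW => //; apply: subset_itv; rewrite bnd_simp.
move=> phi tphi; have [P P0 [rp _ hP]] := test_function_bounds (1 : R^o) tphi.
have cphi : continuous (phi : R^o -> R^o) by have [/(_ 0%N)] := tphi.
have cD : continuous (fun t => 'D_1 (phi : R^o -> R^o) t).
  by have [/(_ 1%N)[_ cD] _] := tphi; exact: cD.
have mphi : measurable_fun `[0, T] phi.
  by apply: measurable_funTS; exact: continuous_measurable_fun.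
have mDphi : measurable_fun `[0, T] (fun t => 'D_1 (phi : R^o -> R^o) t).
  by apply: measurable_funTS; apply: continuous_measurable_fun; exact: cD.
have iM (F : R -> R) (p : R -> R) : mu.-integrable `[0, T] (EFin \o F) ->
    measurable_fun `[0, T] p -> (forall t, `|p t| <= P) ->
    mu.-integrable `[0, T] (EFin \o (fun t => F t * p t)).
  by move=> iF mp hp'; apply: (@integrableM_bounded _ _ _ _ P).
have phiP t : `|phi t| <= P by have [] := hP t.
have DphiP t : `|'D_1 (phi : R^o -> R^o) t| <= P by have [] := hP t.
(* Average of the identities of the single particles; the empirical integrals are finite means. *)
have IN N : \int[mu]_(t in `[0, T]) (u N t * 'D_1 (phi : R^o -> R^o) t + w N t * phi t) = 0.
  have -> : (fun t => u N t * 'D_1 (phi : R^o -> R^o) t + w N t * phi t) =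
    (fun t => N.+1%:R^-1 * \sum_i (g (@z N i t) * 'D_1 (phi : R^o -> R^o) t +
      pairing H g (nu N t) (f t) (@z N i t) * phi t)).
    by apply/funext => t; rewrite /u /w -!mulrA -mulrDr big_split/= !mulr_suml.
  have h i : mu.-integrable `[0, T] (EFin \o (fun t => g (@z N i t) * 'D_1 (phi : R^o -> R^o) t +
      pairing H g (nu N t) (f t) (@z N i t) * phi t)).
    apply: integrable_addR => //; apply: iM => //.
      exact: (integrable_test_particle T0 cH CH0 HC cf kf0 ikf f_ae (@hp N) tg).
    exact: (integrable_test_field T0 cH CH0 HC cf kf0 ikf f_ae (@hp N) tg).
  have [h1 h2] := @Rintegral_sum _ _ _ mu _ _ (index_enum 'I_N.+1) _ mT h.
  rewrite RintegralZl// h2 big1 ?mulr0// => i _.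
  exact: (particle_weak T0 cH CH0 HC cf kf0 ikf f_ae (@hp N) tg i tphi).
have iN N : mu.-integrable `[0, T]
    (EFin \o (fun t => u N t * 'D_1 (phi : R^o -> R^o) t + w N t * phi t)).
  by apply: integrable_addR => //; exact: iM.
pose U t := \int[m t]_y g y.
pose V t := \int[m t]_y pairing H g (m t) (f t) y.
have E_cvg t : `[0, T]%classic t -> (u N t * 'D_1 (phi : R^o -> R^o) t + w N t * phi t)
    @[N --> \oo] --> U t * 'D_1 (phi : R^o -> R^o) t + V t * phi t.
  move=> tT; apply: (@cvgD R R^o); apply: (@cvgM R); [|exact: cvg_cst| |exact: cvg_cst].
    exact: u_cvg.
  exact: w_cvg.
have E_ae : {ae mu, forall t, `[0, T]%classic t -> forall N, (N0 <= N)%N ->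
    `|u N t * 'D_1 (phi : R^o -> R^o) t + w N t * phi t| <= P * (G + Cw * (1 + kf t))}.
  have ? := ae_filter_ringOfSetsType mu.
  apply: filterS w_ae' => t ht tT N N0N.
  rewrite (le_trans (ler_normD _ _))// (normrM (u N t)) (normrM (w N t)).
  rewrite mulrDr [P * G]mulrC [P * (Cw * _)]mulrC.
  by apply: lerD; apply: ler_pM => //; exact: ht.
have iE : mu.-integrable `[0, T] (EFin \o (fun t => P * (G + Cw * (1 + kf t)))).
  by apply: integrable_scaleR => //; apply: integrable_addR => //; exact: icst.
have [_ lim0] := @dominated_cvgR _ _ _ mu _ _ _ _ N0 mT (fun N => integrable_measurableR (iN N)) E_cvg E_ae iE.
have iUD := iM _ _ iU mDphi DphiP; have iVp := iM _ _ iW mphi phiP.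
have : \int[mu]_(t in `[0, T]) (U t * 'D_1 (phi : R^o -> R^o) t + V t * phi t) = 0.
  apply/esym; apply: cvg_unique lim0; first exact: Rhausdorff.
  by rewrite /=; under eq_cvg do rewrite IN; exact: cvg_cst.
have oc (F : R -> R) : mu.-integrable `[0, T] (EFin \o F) ->
    \int[mu]_(t in `]0, T[) F t = \int[mu]_(t in `[0, T]) F t.
  move=> iF; rewrite Rintegral_itv_bndo_bndc ?Rintegral_itv_obnd_cbnd//.
    by apply: integrableS iF => //; apply: subset_itv; rewrite bnd_simp.
  by apply: integrableS iF => //; apply: subset_itv; rewrite bnd_simp.
rewrite RintegralD// => /eqP; rewrite addr_eq0 => /eqP h.
by rewrite (oc _ iUD) (oc _ iVp).
Qed.

End weak_limit.

(** * Convergence of the costs *)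

Lemma continuous_norm_le {R : realType} {n : nat} (g : 'rV[R]_n -> R) r :
  continuous g -> exists2 M, 0 <= M & forall y, `|y| <= r -> `|g y| <= M.
Proof.
move=> cg; have cB : compact (g @` norm_ball r).
  apply: continuous_compact; last exact: compact_norm_ball.
  exact: continuous_subspaceT.
have [M [_ hM]] := compact_bounded cB; exists (`|M| + 1); first exact: addr_ge0.
by move=> y yr; apply: (hM (`|M| + 1)); [rewrite ltr_pwDr// ler_norm|exists y].
Qed.

(** The cost has no growth bound in space, so both measures have to live in a common ball, where the
    modulus on balls suffices. *)
Lemma W1_integral_close_ball {R : realType} {n : nat} (G : 'rV[R]_n -> R) r e :
  continuous G -> 0 < e -> exists2 del, 0 < del & forall mu nu : P1 R n,
    mu (~` norm_ball r) = 0%E -> nu (~` norm_ball r) = 0%E ->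
    (W1 mu nu < del%:E)%E -> `|\int[mu]_z G z - \int[nu]_z G z| < e.
Proof.
move=> cG e0; have e20 : 0 < e / 2 by rewrite divr_gt0.
have cG' := continuous_const_mx cG.
have [C C0 hC] := continuous_modulus_ball r cG' e20.
have [M _ hM] := continuous_norm_le r cG.
exists (e / 2 / (C + 1)); first by rewrite divr_gt0// ltr_wpDl.
move=> mu nu mur nur W.
have mG : measurable_fun setT (G : borelRn R n -> R).
  exact: continuous_measurable_borelRn.
have mB := @measurable_norm_ball R n r.
apply: le_lt_trans (half_add_quotient_lt e0 C0).
apply: (W1_integral_dist (A := norm_ball r) (B := norm_ball r)) => //.
- exact: P1_conull_integrable hM.
- exact: P1_conull_integrable hM.
- exact: ltW.
- move=> z z' zr z'r.
  rewrite (@le_trans _ _ (e / 2 + C * `|z - z'|))//; last first.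
    by rewrite lerD2l ler_wpM2l// norm_le_enorm.
  apply: le_trans (hC z z' zr z'r).
  by apply: le_trans (coord_le_norm _ ord0); rewrite !mxE.
Qed.

Section cost_limit.
Context {R : realType} {d : nat} (T : R).
Notation mu := (@lebesgue_measure R).
Notation n := (d + d)%N.
Variables (f : R -> 'rV[R]_n -> 'rV[R]_d) (psi : 'rV[R]_d -> R).
Variable L : 'rV[R]_n -> P1 R n -> R.
Hypothesis T0 : 0 <= T.
Hypothesis cf : Caratheodory T f.
Hypothesis hL : admissible_cost L.
Hypothesis psi0 : forall w, 0 <= psi w.
Hypothesis cpsi : continuous psi.
Hypothesis psi_ae : forall r, 0 <= r -> exists2 D : R -> R,
  mu.-integrable `[0, T] (EFin \o D) &
  {ae mu, forall t, 0 <= t <= T -> forall y, `|y| <= r -> psi (f t y) <= D t}.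
Variable z : forall N, 'I_N.+1 -> R -> 'rV[R]_n.
Hypothesis uz : forall N i, ucont_on T (@z N i).
Let nu N t := empirical (fun i => @z N i t).
Variables (m : R -> P1 R n) (K rho : R).
Hypothesis K0 : 0 <= K.
Hypothesis rho0 : 0 <= rho.
Hypothesis mK : forall t, m t (~` norm_ball K) = 0%E.
Hypothesis num : forall e : R, 0 < e -> \forall N \near \oo, forall t, 0 <= t <= T ->
  (W1 (nu N t) (m t) < e%:E)%E.
Hypothesis mt : forall e : R, 0 < e -> exists2 del, 0 < del & forall s t,
  0 <= s <= T -> 0 <= t <= T -> `|t - s| < del -> (W1 (m s) (m t) < e%:E)%E.
Hypothesis z_rho : \forall N \near \oo, forall i t, 0 <= t <= T -> `|@z N i t| <= rho.

Let mT : measurable (`[0, T]%classic : set R).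
Proof. exact: measurable_itv. Qed.

Let cL nu' : continuous (fun y => L y nu'). Proof. by have [_ + _] := hL; exact. Qed.

Let cpf t : 0 <= t <= T -> continuous (fun y => psi (f t y)).
Proof.
move=> tT y; apply: (@continuous_comp _ _ _ (f t) psi); last exact: cpsi.
by apply: cf.2; rewrite in_itv.
Qed.

(** The cost is continuous only along sequences of measures, so uniformity in time is tested along
    moving times: W1 closeness uniform in time handles [N k], and time continuity of [m] handles
    [s k]. *)
Lemma narrow_cvg_joint t (s : nat -> R) (N : nat -> nat) : 0 <= t <= T ->
  (forall k, 0 <= s k <= T) -> s @ \oo --> t -> (forall k, (k <= N k)%N) ->
  narrow_cvg (fun k => nu (N k) (s k)) (m t).
Proof.
move=> tT sT st kN g cg [M gM]; apply/cvgrPdist_lt => e e0.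
have e20 : 0 < e / 2 by rewrite divr_gt0.
have gM' y : `|g y| <= M * (1 + `|y|).
  rewrite (le_trans (gM y))// ler_peMr ?lerDl//.
  exact: le_trans (normr_ge0 _) (gM y).
have [del del0 h] := W1_integral_close1 K0 cg gM' e20.
have [eta eta0 heta] := mt del0.
have [N0 _ hN0] := num del0.
move/cvgrPdist_lt : st => /(_ _ eta0) st.
near=> k.
have k1 : `|\int[m t]_y g y - \int[m (s k)]_y g y| < e / 2.
  rewrite distrC; apply: h => //; apply: heta => //.
  by near: k.
have k2 : `|\int[m (s k)]_y g y - \int[nu (N k) (s k)]_y g y| < e / 2.
  rewrite distrC; apply: h => //; apply: hN0 => //=.
  by rewrite (leq_trans _ (kN k))//; near: k; exists N0.
rewrite -(subrK (\int[m (s k)]_y g y) (\int[m t]_y g y)) -addrA.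
by rewrite (le_lt_trans (ler_normD _ _))// [ltRHS](splitr e) ltrD.
Unshelve. all: by end_near. Qed.

Lemma narrow_cvg_empirical N t (s : nat -> R) : 0 <= t <= T ->
  (forall k, 0 <= s k <= T) -> s @ \oo --> t ->
  narrow_cvg (fun k => nu N (s k)) (nu N t).
Proof.
move=> tT sT st g cg _.
have mg : measurable_fun setT (g : borelRn R n -> R) by exact: continuous_measurable_borelRn.
rewrite Rintegral_empirical//; under eq_cvg do rewrite Rintegral_empirical//.
apply: (@cvgM R); first exact: cvg_cst.
apply: (@cvg_big _ _ _ _ _ _ _ _ _ (fun i k => g (@z N i (s k)))) => [y|i _].
  exact: (@add_continuous R^o).
exact: (cvg_comp _ _ (ucont_on_cvg (@uz N i) tT sT st) (cg (@z N i t))).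
Qed.

Let narrow_cvg_at t : 0 <= t <= T -> narrow_cvg (nu ^~ t) (m t).
Proof.
move=> tT; apply: (@narrow_cvg_joint t (fun=> t) id) => //; exact: cvg_cst.
Qed.

(** A failure of local boundedness gives indices at least [k], times within [1 / (k + 1)] of [t] and
    points of the ball with cost above [B + 1]. The measures then converge narrowly to [m t], whose
    cost is at most [B] on the ball. *)
Let cost_bound_near t : 0 <= t <= T -> exists (del : R) N0 (B : R), 0 < del /\
  forall N s y, (N0 <= N)%N -> 0 <= s <= T -> `|s - t| < del -> `|y| <= rho ->
    L y (nu N s) <= B.
Proof.
move=> tT; have [B B0 hB] := continuous_norm_le rho (@cL (m t)).
apply: contrapT => hn.
have /choice[w hw] : forall k, exists w : nat * R * 'rV[R]_n, [/\ (k <= w.1.1)%N,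
    0 <= w.1.2 <= T, `|w.1.2 - t| < k.+1%:R^-1, `|w.2| <= rho & B + 1 < L w.2 (nu w.1.1 w.1.2)].
  move=> k; apply: contrapT => hk; apply: hn.
  exists k.+1%:R^-1, k, (B + 1); split => // N s y kN sT st yr.
  rewrite leNgt; apply/negP => h; apply: hk.
  by exists (N, s, y).
have st : (fun k => (w k).1.2) @ \oo --> t.
  apply/cvgrPdist_lt => e e0; have [k0 _ hk0] := near_infty_natSinv_lt (PosNum e0).
  exists k0 => // k /hk0 /= ke; have [_ _ h _ _] := hw k.
  by rewrite distrC (lt_trans h).
have nc : narrow_cvg (fun k => nu (w k).1.1 (w k).1.2) (m t).
  by apply: narrow_cvg_joint => // k; have [] := hw k.
have [_ _ hLc] := hL; have := hLc _ _ nc _ (@compact_norm_ball R n rho) _ ltr01.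
move=> [k0 _ /(_ k0 (leqnn _)) h].
have [_ _ _ wr] := hw k0; apply/negP; rewrite -leNgt.
have := h _ wr; have := hB _ wr.
rewrite ltr_distl ler_norml => /andP[_ h1] /andP[_ /ltW h2].
by rewrite (le_trans h2)// lerD2r.
Qed.

(** The local bounds are chained by real induction; each step takes the larger threshold and the
    larger bound. *)
Lemma cost_bound : exists N0 (B : R), 0 <= B /\ forall N t y, (N0 <= N)%N -> 0 <= t <= T ->
  `|y| <= rho -> L y (nu N t) <= B.
Proof.
pose P c := exists N0 (B : R), 0 <= B /\ forall N s y, (N0 <= N)%N -> 0 <= s <= c ->
  `|y| <= rho -> L y (nu N s) <= B.
suff : P T by [].
have cover c : 0 <= c <= T -> exists2 e, 0 < e & forall s t,
    0 <= s <= c -> c <= t <= T -> c - e < s -> t < c + e -> P s -> P t.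
  move=> cT; have [del [N1 [B1 [del0 h1]]]] := cost_bound_near cT.
  exists del => // s t /andP[s0 sc] /andP[ct tT] cs tc [N2 [B2 [B20 h2]]].
  exists (maxn N1 N2), (Num.max B1 B2); split; first by rewrite le_max B20 orbT.
  move=> N r y; rewrite geq_max => /andP[hN1 hN2] /andP[r0 rt] yr.
  have [rs|sr] := leP r s.
    by rewrite (le_trans (h2 N r y hN2 _ yr)) ?r0// le_max lexx orbT.
  rewrite (le_trans (h1 N r y hN1 _ _ yr)) ?r0 ?(le_trans rt)//; last by rewrite le_max lexx.
  by rewrite ltr_distl (lt_trans cs sr) (le_lt_trans rt tc).
apply: (real_induction T0 _ cover).
have T00 : 0 <= (0 : R) <= T by rewrite lexx.
have [del [N1 [B1 [del0 h1]]]] := cost_bound_near T00.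
exists N1, (Num.max B1 0); split; first by rewrite le_max lexx orbT.
move=> N s y hN /andP[s0 s1] yr; have -> : s = 0 by apply/eqP; rewrite eq_le s1.
by rewrite (le_trans (h1 N 0 y hN T00 _ yr)) ?subrr ?normr0// le_max lexx.
Qed.

Let F N t := N.+1%:R^-1 * \sum_i (L (@z N i t) (nu N t) + psi (f t (@z N i t))).

Let measurable_F N : measurable_fun `[0, T] (F N).
Proof.
apply: measurable_funM => //; apply: measurable_sum => i; apply: measurable_funD.
  (* The cost along a trajectory is known only to be sequentially continuous in time; the diagonal
     lemma converts this into measurability. *)
  apply: (diagonal_measurable (a := fun s _ => L (@z N i s) (nu N s))) => // t s tT sT st.
  have [B _ hB] := ucont_on_bounded T0 (@uz N i).
  have [_ _ hLc] := hL.
  have := hLc _ _ (@narrow_cvg_empirical N t s tT sT st) _ (@compact_norm_ball R n B).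
  move=> hLB; have := cvg_comp _ _ (ucont_on_cvg (@uz N i) tT sT st) (@cL (nu N t) (@z N i t)).
  move=> /cvgrPdist_lt hLz; apply/cvgrPdist_lt => e e0.
  have e20 : 0 < e / 2 by rewrite divr_gt0.
  apply: filterS2 (hLB _ e20) (hLz _ e20) => k /(_ _ (hB _ (sT k))) k1 /= k2.
  rewrite -(subrK (L (@z N i (s k)) (nu N t)) (L (@z N i t) _)) -addrA.
  by rewrite (le_lt_trans (ler_normD _ _))// [ltRHS](splitr e) ltrD// distrC.
apply: (caratheodory_comp_measurable (f := fun t y => psi (f t y))) => //.
move=> y; apply: (measurableT_comp (f := (psi : borelRn R d -> R))); last exact: cf.1.
exact: continuous_measurable_borelRn.
Qed.

Let limit_cost t := \int[m t]_y (L y (m t) + psi (f t y)).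

Let continuous_cost nu' t : 0 <= t <= T -> continuous (fun y => L y nu' + psi (f t y)).
Proof.
move=> tT y; have ? := nbhs_filter y.
by apply: (@cvgD R R^o); [exact: cL|exact: cpf].
Qed.

Let F_cvg t : `[0, T]%classic t -> F ^~ t @ \oo --> limit_cost t.
Proof.
rewrite /= in_itv/= => tT; apply/cvgrPdist_lt => e e0.
have e20 : 0 < e / 2 by rewrite divr_gt0.
have cG : continuous (fun y => L y (m t) + psi (f t y)) by exact: continuous_cost.
have [del del0 h] := W1_integral_close_ball (rho + K) cG e20.
have [_ _ hLc] := hL.
have hLB := hLc _ _ (narrow_cvg_at tT) _ (@compact_norm_ball R n rho) _ e20.
apply: filterS3 z_rho (num del0) hLB => N zr' hW hLN.
have zr i : `|@z N i t| <= rho by exact: zr'.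
have sub r : r <= rho + K -> ~` norm_ball (rho + K) `<=` ~` (norm_ball r : set 'rV[R]_n).
  by move=> rr; apply: subsetC => y yr; exact: le_trans yr rr.
have k1 : `|\int[m t]_y (L y (m t) + psi (f t y)) - \int[nu N t]_y (L y (m t) + psi (f t y))| < e / 2.
  rewrite distrC; apply: h.
  - by apply: empirical_norm_ball => i; rewrite (le_trans (zr i))// lerDl.
  - apply: (@subset_measure0 _ _ _ (P1_probability (m t)) _ (~` norm_ball K)) => //.
    + by apply: measurableC; exact: measurable_norm_ball.
    + by apply: measurableC; exact: measurable_norm_ball.
    + by apply: sub; rewrite lerDr.
    + exact: mK.
  - exact: hW.
have k2 : `|\int[nu N t]_y (L y (m t) + psi (f t y)) - F N t| <= e / 2.
  rewrite Rintegral_empirical; last exact: continuous_measurable_borelRn.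
  rewrite -mulrBr -sumrB normrM ger0_norm ?invr_ge0// ler_pdivrMl//.
  rewrite (le_trans (ler_norm_sum _ _ _))//.
  rewrite (@le_trans _ _ (\sum_(i < N.+1) (e / 2)))//; last first.
    by rewrite sumr_const card_ord -[leLHS]mulr_natl.
  apply: ler_sum => i _; rewrite opprD addrACA subrr addr0 distrC ltW//.
  by apply: hLN; exact: zr.
rewrite -(subrK (\int[nu N t]_y (L y (m t) + psi (f t y))) (limit_cost t)) -addrA.
by rewrite (le_lt_trans (ler_normD _ _))// [ltRHS](splitr e) ltr_leD.
Qed.

Lemma total_cost_cvg :
  (fun N => total_cost T L psi f (nu N)) @ \oo --> total_cost T L psi f m.
Proof.
have [N1 [B [B0 hB]]] := cost_bound.
have [N2 _ hN2] := z_rho.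
have [D iD D_ae] := psi_ae rho0.
pose N0 := maxn N1 N2.
have F_ae : {ae mu, forall t, `[0, T]%classic t -> forall N, (N0 <= N)%N ->
    `|F N t| <= B + D t}.
  have ? := ae_filter_ringOfSetsType mu.
  apply: filterS D_ae => t + tT N; rewrite geq_max => + /andP[N1N N2N].
  have tT' : 0 <= t <= T by move: tT; rewrite /= in_itv.
  move=> /(_ tT') hD.
  have L0 y nu' : 0 <= L y nu' by have [h _ _] := hL.
  rewrite normrM ger0_norm ?invr_ge0// ler_pdivrMl//.
  rewrite (le_trans (ler_norm_sum _ _ _))//.
  rewrite (@le_trans _ _ (\sum_(i < N.+1) (B + D t)))//; last first.
    by rewrite sumr_const card_ord -[leLHS]mulr_natl.
  apply: ler_sum => i _; have zr : `|@z N i t| <= rho by exact: hN2.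
  by rewrite ger0_norm ?addr_ge0// lerD// ?hB// hD.
have iBD : mu.-integrable `[0, T] (EFin \o (fun t => B + D t)).
  by apply: integrable_addR => //; exact: (integrable_cst_itv (a := 0) (b := T)).
have [iF cF] := @dominated_cvgR _ _ _ mu _ F limit_cost _ N0 mT measurable_F F_cvg F_ae iBD.
have costN N : total_cost T L psi f (nu N) = (\int[mu]_(t in `[0%R, T]) (F N t)%:E)%E.
  apply: eq_integral => t; rewrite inE/= in_itv/= => tT.
  by rewrite integral_empirical//; apply: continuous_measurable_borelRn; exact: continuous_cost.
have costm : total_cost T L psi f m = (\int[mu]_(t in `[0%R, T]) (limit_cost t)%:E)%E.
  apply: eq_integral => t; rewrite inE/= in_itv/= => tT.
  rewrite /limit_cost /Rintegral fineK//.
  have [M _ hM] := continuous_norm_le K (@continuous_cost (m t) t tT).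
  have mG : measurable_fun setT ((fun y => L y (m t) + psi (f t y)) : borelRn R n -> R).
    by apply: continuous_measurable_borelRn; exact: continuous_cost.
  have := P1_conull_integrable (measurable_norm_ball K) (mK t) mG hM.
  exact: integrable_fin_num.
rewrite costm -[X in _ --> X]fineK; last exact: integrable_fin_num.
apply/fine_cvgP; split; last by under eq_cvg do rewrite /= costN; exact: cF.
exists N0 => // N /= N0N; rewrite costN; apply: integrable_fin_num => //.
(* [D] bounds the running cost only almost everywhere and may be negative on a null set; its
   absolute value gives a dominating function non-negative everywhere. *)
apply: (@dominated_integrableR_ae _ _ _ mu _ _ (fun t => B + `|D t|)) => //.
- exact: measurable_F.
- by move=> t _; rewrite addr_ge0.
- have ? := ae_filter_ringOfSetsType mu.
  apply: filterS F_ae => t ht tT; rewrite (le_trans (ht tT N N0N))// lerD2l ler_norm//.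
- apply: integrable_addR => //; last exact: integrable_normR.
  exact: (integrable_cst_itv (a := 0) (b := T)).
Qed.

End cost_limit.

(** * Bounds extracted from the hypotheses on the data *)

Section data.
Context {R : realType}.
Notation mu := (@lebesgue_measure R).

(** The infimum is approached by admissible constants within [e / (enorm (y - y') + 1)], which
    changes the bound by at most [e]. *)
Lemma Lip_le {n : nat} {Y : zmodType} (nrm : Y -> R) (g : 'rV[R]_n -> Y)
    (A : set 'rV[R]_n) k : (Lip nrm g A <= k%:E)%E ->
  forall y y', A y -> A y' -> nrm (g y - g y') <= k * enorm (y - y').
Proof.
move=> hk y y' Ay Ay'; apply/ler_addgt0Pr => e e0.
have e0' : 0 < enorm (y - y') + 1 by rewrite ltr_wpDl// sqrtr_ge0.
have : (Lip nrm g A < (k + e / (enorm (y - y') + 1))%:E)%E.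
  by rewrite (le_lt_trans hk)// lte_fin ltrDl divr_gt0.
move=> /ereal_inf_lt[_ [c [_ hc] <-]]; rewrite lte_fin => ck.
rewrite (le_trans (hc y y' Ay Ay'))//.
rewrite (@le_trans _ _ ((k + e / (enorm (y - y') + 1)) * enorm (y - y')))//.
  by rewrite ler_wpM2r ?sqrtr_ge0// ltW.
rewrite mulrDl lerD2l mulrAC ler_pdivrMr// ler_wpM2l ?(ltW e0)//.
by rewrite lerDl.
Qed.

Lemma Lip_ge0 {n : nat} {Y : zmodType} (nrm : Y -> R) (g : 'rV[R]_n -> Y)
    (A : set 'rV[R]_n) : (0 <= Lip nrm g A)%E.
Proof. by apply: le_ereal_inf_tmp => _ [k [k0 _] <-]; rewrite lee_fin. Qed.

Lemma msupport_empirical {n N : nat} (p : 'I_N.+1 -> 'rV[R]_n) i :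
  msupport (empirical p) (p i).
Proof.
move=> U oU Ui; rewrite (_ : _ U = emp_measure p U)// emp_measureE.
apply: mule_gt0; first by rewrite lte_fin invr_gt0.
rewrite (bigD1 i)//= diracE mem_set// (lt_le_trans (lte01))// leeDl// sume_ge0//.
Qed.

Section running_cost.
Context {d : nat} (psi : 'rV[R]_d -> R) (Cpsi q : R).
Hypothesis Cpsi0 : 0 <= Cpsi.
Hypothesis q1 : 1 <= q.
Hypothesis psiL : forall r : R, 0 < r ->
  (Lip Num.norm psi (eball 0 r) <= (Cpsi * r `^ (q - 1))%:E)%E.

Let psi_ball r w w' : 0 < r -> enorm w < r -> enorm w' < r ->
  `|psi w - psi w'| <= Cpsi * r `^ (q - 1) * enorm (w - w').
Proof. by move=> r0 wr w'r; apply: (Lip_le (psiL r0)); rewrite /eball/= subr0. Qed.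

Lemma continuous_running_cost : continuous psi.
Proof.
move=> w; have ? := nbhs_filter w; pose r := enorm w + 1.
have r0 : 0 < r by rewrite ltr_wpDl// sqrtr_ge0.
pose k := Cpsi * r `^ (q - 1) * d%:R.
have k0 : 0 <= k by rewrite !mulr_ge0// powR_ge0.
apply/cvgrPdist_lt => e e0.
have ek0 : 0 < e / (k + 1) by rewrite divr_gt0// ltr_wpDl.
have near_r : \forall y \near w, enorm y < r.
  apply: (@cvgr_lt _ _ (nbhs w) _ (@enorm R d) (enorm w) (@continuous_enorm R d w)).
  by rewrite ltrDl.
have /cvgrPdist_lt /(_ _ ek0) := cvg_dist0 w.
apply: filterS2 near_r => y yr; rewrite sub0r normrN normr_id distrC => yw.
have wr : enorm w < r by rewrite ltrDl.
rewrite (le_lt_trans (psi_ball r0 wr yr))//.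
apply: (@le_lt_trans _ _ (k * `|w - y|)).
  rewrite /k -[leRHS]mulrA ler_wpM2l ?mulr_ge0 ?powR_ge0//; exact: enorm_le_norm.
apply: (@le_lt_trans _ _ (k * (e / (k + 1)))).
  by rewrite ler_wpM2l// distrC ltW.
by rewrite mulrCA gtr_pMr// ltr_pdivrMr ?ltr_wpDl// mul1r ltrDl.
Qed.

(** The Lipschitz constant on radius [r = 2 M b] times [|w| < r] is at most [Cpsi * r ^ q]; this is
    how an L^q bound on the control makes the running cost integrable. *)
Lemma running_cost_growth M a w : 1 <= M -> 0 <= a -> enorm w <= M * a ->
  psi w <= psi 0 + Cpsi * ((2 * M) `^ q * (1 + a `^ q)).
Proof.
(* [b >= 1] keeps the radius positive, the factor 2 puts [w] strictly inside the ball, and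
   [b ^ q <= 1 + a ^ q]. *)
move=> M1 a0 wM; pose b := Num.max 1 a.
have b1 : 1 <= b by rewrite le_max lexx.
have M0 : 0 < M by exact: lt_le_trans M1.
have b0 : 0 < b by exact: lt_le_trans b1.
have r0 : 0 < 2 * M * b by rewrite !mulr_gt0.
have Mb : M * a <= M * b by rewrite ler_wpM2l ?(ltW M0)// le_max lexx orbT.
have Mb0 : 0 < M * b by rewrite mulr_gt0.
have wr : enorm w < 2 * M * b by rewrite -mulrA; lra.
have zr : enorm (0 : 'rV[R]_d) < 2 * M * b.
  by rewrite (le_lt_trans (enorm_le_norm 0))// normr0 mulr0.
rewrite -lerBlDl (le_trans (ler_norm _))// (le_trans (psi_ball r0 wr zr))// subr0 -mulrA.
rewrite ler_wpM2l//.
apply: (@le_trans _ _ ((2 * M * b) `^ q)).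
  rewrite -[X in _ <= _ `^ X](subrK 1 q) [leRHS]powRD; last by rewrite (gt_eqF r0) implybT.
  by rewrite powRr1 ?(ltW r0)// ler_wpM2l ?powR_ge0// ltW.
rewrite powRM ?mulr_ge0 ?(ltW M0) ?(ltW b0)// ler_wpM2l ?powR_ge0// /b.
have [_|_] := leP 1 a; first by rewrite lerDr.
by rewrite powR1 lerDl powR_ge0.
Qed.

End running_cost.

Lemma le_1powR (a q : R) : 1 <= q -> 0 <= a -> a <= 1 + a `^ q.
Proof.
move=> q1 a0; have [a1|a1] := leP a 1; first by rewrite (le_trans a1)// lerDl powR_ge0.
have : a <= a `^ q by rewrite -[leLHS]powRr1// ler_powR// ltW.
by move=> /le_trans; apply; rewrite lerDr.
Qed.

(** The data say nothing about [l] outside the open interval, not even at its ends; the extension by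
    0 gives a function integrable on [[0, T]]. *)
Lemma integrable_Lq_patch (T q c b : R) (l : R -> R) : 0 <= T -> in_Lq T q l ->
  mu.-integrable `[0, T] (EFin \o ((fun t => c * (b + `|l t| `^ q)) \_ `]0, T[)).
Proof.
move=> T0 [ml lq].
have mi : measurable (`]0, T[%classic : set R) by exact: measurable_itv.
have mq : measurable_fun `]0, T[ (fun t => `|l t| `^ q).
  apply: (@measurableT_comp _ _ _ _ _ _ (@powR R ^~ q)) => //.
  exact: measurableT_comp.
have iq : mu.-integrable `]0, T[ (EFin \o (fun t => `|l t| `^ q)).
  apply/integrableP; split; first exact/measurable_EFinP.
  apply: le_lt_trans lq; under eq_integral do rewrite /= ger0_norm ?powR_ge0//.
  by [].
have ib : mu.-integrable `]0, T[ (EFin \o (fun t => c * (b + `|l t| `^ q))).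
  apply: integrable_scaleR => //; apply: integrable_addR => //.
  apply: (integrable_cst_itv (a := 0) (b := T)).
  by apply: subset_itv; rewrite bnd_simp.
have : mu.-integrable setT (EFin \o ((fun t => c * (b + `|l t| `^ q)) \_ `]0, T[)).
  by move: ib; rewrite integrable_mkcond// restrict_EFin.
exact: integrableS.
Qed.

Lemma ae_interior (T : R) : {ae mu, forall t : R, 0 <= t <= T -> 0 < t < T}.
Proof.
have ? := ae_filter_ringOfSetsType mu.
have ne (c : R) : {ae mu, forall t : R, t != c}.
  exists [set c]; split => //; first exact: lebesgue_measure_set1.
  by move=> t /= /negP; rewrite negbK => /eqP.
apply: filterS2 (ne 0) (ne T) => t t0 tT /andP[h1 h2].
by rewrite !lt_neqAle h1 h2 eq_sym t0 tT.
Qed.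

Lemma admissible_control_bounds {n d : nat} (T : R) (l : R -> R)
    (f : R -> 'rV[R]_n -> 'rV[R]_d) : admissible_control T l f ->
  {ae mu, forall t, 0 <= t <= T ->
    (forall y, `|f t y| <= `|l t| * (1 + enorm y)) /\
    (forall y y', `|f t y - f t y'| <= `|l t| * enorm (y - y'))}.
Proof.
move=> [_ hf]; have ? := ae_filter_ringOfSetsType mu.
apply: filterS hf => t + tT => /(_ _)[|_ hl]; first by rewrite in_itv.
pose k := l t - enorm (f t 0).
have Lk : (Lip enorm (f t) setT <= k%:E)%E by rewrite EFinB leeBrDl.
have k0 : 0 <= k by rewrite -lee_fin (le_trans (Lip_ge0 _ _ _) Lk).
have f0 : 0 <= enorm (f t 0) by exact: sqrtr_ge0.
have kl : k <= `|l t| by rewrite (le_trans _ (ler_norm _))// lerBlDr lerDl.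
have hL y y' : enorm (f t y - f t y') <= k * enorm (y - y') by exact: Lip_le Lk y y' I I.
have hL' y y' := le_trans (norm_le_enorm (f t y - f t y')) (hL y y').
split => [y|y y']; last by rewrite (le_trans (hL' y y'))// ler_wpM2r// sqrtr_ge0.
rewrite -[f t y](subrK (f t 0)) (le_trans (ler_normD _ _))//.
have := hL' y 0; rewrite subr0 => h; have := ler_norm (l t).
have : k * enorm y <= `|l t| * enorm y by rewrite ler_wpM2r// sqrtr_ge0.
have : k + enorm (f t 0) = l t by rewrite subrK.
have := norm_le_enorm (f t 0); clearbody k; lra.
Qed.

End data.

(** [L] may grow arbitrarily fast in space, so a vanishing fraction of far particles could carry a
    non-vanishing cost. The premise of the last conclusion confines the initial data to one ball and
    excludes this. *)
Theorem theorem4p6 (R : realType) (d : nat) (hd : (0 < d)%N) (T : R) (hT : 0 < T)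
  (H : 'rV[R]_(d + d) -> 'rV[R]_d) (C : R)
  (hHlip : locally_Lipschitz H)
  (hHgrowth : forall z, enorm (H z) <= C * (1 + enorm z))
  (L : 'rV[R]_(d + d) -> P1 R (d + d) -> R)
  (hL : admissible_cost L)
  (psi : 'rV[R]_d -> R) (Cpsi q : R)
  (hpsi0 : forall w, 0 <= psi w)
  (hpsiconv : convex_function [set: convex_lmodType 'rV[R]_d] (psi : _ -> R^o))
  (hCpsi : 0 <= Cpsi) (hq : 1 <= q)
  (hpsilip : forall r : R, 0 < r ->
     (Lip Num.norm psi (eball 0 r) <= (Cpsi * r `^ (q - 1))%:E)%E)
  (l : R -> R) (hl : in_Lq T q l)
  (mu0 : P1 R (d + d)) (hmu0 : compact (msupport mu0))
  (f : R -> 'rV[R]_(d + d) -> 'rV[R]_d) (hf : admissible_control T l f)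
  (x0 v0 : forall N : nat, 'I_N.+1 -> 'rV[R]_d)
  (hmuN0 : (fun N => W1 (empirical (fun i => row_mx (x0 N i) (v0 N i))) mu0)
     @ \oo --> 0%E)
  (x v : forall N : nat, 'I_N.+1 -> R -> 'rV[R]_d)
  (hxv : forall N, particle_solution T H f (x0 N) (v0 N) (x N) (v N)) :
  let muN0 N := empirical (fun i => row_mx (x0 N i) (v0 N i)) in
  let muN N t := empirical (fun i => row_mx (x N i t) (v N i t)) in
  exists mu : R -> P1 R (d + d),
  [/\ forall e : R, 0 < e -> \forall N \near \oo,
        forall t : R, t \in `[0, T] -> (W1 (muN N t) (mu t) < e%:E)%E,
      weak_solution T H f mu &
      (exists r : R, forall N, msupport (muN0 N) `<=` eball 0 r) ->
      (fun N => total_cost T L psi f (muN N)) @ \oo --> total_cost T L psi f mu].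
Proof.
move=> muN0 muN.
pose n : R := (d + d)%:R.
have n0 : 0 <= n by exact: ler0n.
have T0 : 0 <= T := ltW hT.
have [cf _] := hf.
have H_loc (z : 'rV[R]_(d + d)) : exists K : R, \forall p \near (z, z), `|H p.1 - H p.2| <= K * `|p.1 - p.2|.
  exact: locally_Lipschitz_norm.
have cH : continuous H := locally_Lipschitz_continuous H_loc.
have HL r := locally_Lipschitz_ball r H_loc.
have enorm0 : enorm (0 : 'rV[R]_(d + d)) = 0.
  apply/eqP; rewrite eq_le sqrtr_ge0 andbT.
  by rewrite (le_trans (enorm_le_norm _))// normr0 mulr0.
have C0 : 0 <= C.
  by have := hHgrowth 0; rewrite enorm0 addr0 mulr1; apply: le_trans; exact: sqrtr_ge0.
have n1 (y : 'rV[R]_(d + d)) : 1 + enorm y <= (1 + n) * (1 + `|y|).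
  have := enorm_le_norm y; have := normr_ge0 y; rewrite -/n; have := n0; lra.
pose CH := C * (1 + n).
have CH0 : 0 <= CH by rewrite mulr_ge0// addr_ge0.
have HC z : `|H z| <= CH * (1 + `|z|).
  rewrite (le_trans (norm_le_enorm _))// (le_trans (hHgrowth z))// -mulrA.
  by rewrite ler_wpM2l.
(* Since [q >= 1], [|l| <= 1 + |l| ^ q], so the rate is integrable without Hoelder's inequality;
   [1 + n] pays for passing from the Euclidean to the sup norm. *)
pose kf : R -> R := (fun t => (1 + n) * (1 + `|l t| `^ q)) \_ `]0, T[.
have kf0 t : 0 <= kf t.
  rewrite /kf patchE; case: ifP => // _.
  by rewrite mulr_ge0// ?addr_ge0// powR_ge0.
have ikf := integrable_Lq_patch (1 + n) 1 T0 hl.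
have ? := ae_filter_ringOfSetsType (@lebesgue_measure R).
have patch_in (F : R -> R) t : 0 < t < T -> (F \_ `]0, T[) t = F t.
  by move=> tT; rewrite patchE mem_set//= in_itv.
have f_ae : {ae @lebesgue_measure R, forall t, 0 <= t <= T ->
    (forall z, `|f t z| <= kf t * (1 + `|z|)) /\
    (forall z z', `|f t z - f t z'| <= kf t * `|z - z'|)}.
  apply: filterS2 (ae_interior T) (admissible_control_bounds hf) => t tin hft tT.
  have [h1 h2] := hft tT; rewrite /kf patch_in ?tin//.
  have lq := le_1powR hq (normr_ge0 (l t)).
  have lq0 : 0 <= 1 + `|l t| `^ q by exact: le_trans lq.
  split => [z|z z'].
    rewrite (le_trans (h1 z))// mulrAC [leRHS]mulrC ler_pM//.
    by rewrite addr_ge0// sqrtr_ge0.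
  rewrite (le_trans (h2 z z'))// (@le_trans _ _ (`|l t| * ((1 + n) * `|z - z'|)))//.
    rewrite ler_wpM2l// (le_trans (enorm_le_norm _))// ler_wpM2r// -/n lerDr//.
  by rewrite mulrA [_ * (1 + n)]mulrC ler_wpM2r// ler_wpM2l// addr_ge0.
pose z N i t := row_mx (x N i t) (v N i t).
have hz N : integral_solution T H f (z N).
  exact: (particle_integral_solution T0 cH CH0 HC cf kf0 ikf f_ae (hxv N)).
have z0 N : (fun i => z N i 0) = (fun i => row_mx (x0 N i) (v0 N i)).
  by apply/funext => i; rewrite /z; have [_ _ -> -> _] := hxv N i.
have hW e : 0 < e -> \forall N \near \oo, (W1 (empirical (fun i => z N i 0%R)) mu0 < e%:E)%E.
  move=> e0; apply: filterS (near_lt_cvge0 _ hmuN0 e0) => N.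
  by rewrite z0.
have [R1 [_ hR1]] := compact_bounded hmu0.
pose R0 := `|R1| + 1.
have R00 : 0 <= R0 by rewrite addr_ge0.
have SR y : msupport mu0 y -> `|y| <= R0.
  by move=> Sy; apply: (hR1 R0) => //; rewrite ltr_pwDr// ler_norm.
have Spos y : msupport mu0 y -> forall U : set 'rV[R]_(d + d), open U -> U y -> (0 < mu0 U)%E.
  by move=> Sy U; exact: Sy.
have S1 := msupport_conull mu0.
have [A [K [Z [A1 [K0 [zA [zZ [ZL [Zt ZK]]]]]]]]] :=
  limit_flow T0 cH CH0 HC HL kf0 ikf f_ae hmu0 S1 Spos R00 SR hz hW.
have zu N i j t := particle_unique T0 cH CH0 HC HL kf0 ikf f_ae (hz N) (i := i) (j := j) (t := t).
pose m := limit_measure mu0 hmu0 K0 ZL ZK.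
have num e (e0 : 0 < e) := empirical_cvg_limit_measure hmu0 S1 R00 SR hW A1 K0 zA zZ ZL ZK zu e0.
have mK t : m t (~` norm_ball K) = 0%E by exact: limit_measure_ball.
have irt := integrable_rate CH ikf.
have mt e (e0 : 0 < e) := limit_measure_time mu0 hmu0 K0 ZL irt (rate_ge0 CH0 kf0) Zt ZK e0.
exists m; split.
- move=> e e0; apply: filterS (num e e0) => N h t; rewrite in_itv; exact: h.
- split.
  + move=> t; rewrite in_itv/= => tT.
    apply: cvge0_near_lt => [s|e e0]; first exact: W1_ge0.
    have [del del0 hdel] := mt e e0.
    apply/nbhs_ballP; exists del => //= s; rewrite -ball_normE /ball_/= => st.
    by rewrite in_itv/= => sT; exact: hdel.
  (* The support lies in the closed sup-norm ball of radius [K]; the extra 1 makes the Euclidean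
     inequality strict. *)
  + exists (n * K + 1); first by rewrite ltr_wpDl// mulr_ge0.
    move=> t _ y /msupport_limit_measure yK; rewrite /eball/= subr0.
    by rewrite (le_lt_trans (enorm_le_norm y))// ltr_pwDr// ler_wpM2l.
  + move=> zeta tz; exact: (weak_limit T0 cH CH0 HC cf kf0 ikf f_ae hxv K0 mK num tz).
move=> [r hr].
pose rho := A * (1 + `|r|).
have rho0 : 0 <= rho by rewrite mulr_ge0 ?addr_ge0// (le_trans _ A1).
have z_rho : \forall N \near \oo, forall i t, 0 <= t <= T -> `|z N i t| <= rho.
  apply: filterS zA => N h i t tT; rewrite (le_trans (h i t tT))//.
  rewrite ler_wpM2l ?(le_trans _ A1)// lerD2l.
  have -> : z N i 0 = row_mx (x0 N i) (v0 N i) := congr1 (@^~ i) (z0 N).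
  have : msupport (muN0 N) (row_mx (x0 N i) (v0 N i)).
    exact: (@msupport_empirical _ _ _ (fun j : 'I_N.+1 => row_mx (x0 N j) (v0 N j)) i).
  move=> /hr; rewrite /eball/= subr0 => /ltW h1.
  by rewrite (le_trans (norm_le_enorm _))// (le_trans h1)// ler_norm.
have psi_ae a : 0 <= a -> exists2 D : R -> R,
    (@lebesgue_measure R).-integrable `[0, T] (EFin \o D) &
    {ae @lebesgue_measure R, forall t, 0 <= t <= T -> forall y, `|y| <= a -> psi (f t y) <= D t}.
  (* On the ball of radius [a], the Euclidean norm of the forcing is at most
     [d * (1 + n * a) * |l t|]; the summand 1 secures [1 <= M]. *)
  move=> a0; pose M := 1 + d%:R * (1 + n * a).
  have M1 : 1 <= M by rewrite lerDl mulr_ge0// addr_ge0// mulr_ge0.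
  pose G := (fun t => Cpsi * (2 * M) `^ q * (1 + `|l t| `^ q)) \_ `]0, T[.
  exists (fun t => psi 0 + G t).
    apply: integrable_addR; first exact: measurable_itv.
      exact: (integrable_cst_itv (a := 0) (b := T)).
    exact: integrable_Lq_patch.
  apply: filterS2 (ae_interior T) (admissible_control_bounds hf) => t tin hft tT y ya.
  have [h1 _] := hft tT; rewrite /G patch_in ?tin// -mulrA.
  apply: (running_cost_growth hCpsi hpsilip) => //.
  rewrite (le_trans (enorm_le_norm _))//.
  rewrite (@le_trans _ _ (d%:R * (`|l t| * (1 + n * a))))//.
    rewrite ler_wpM2l// (le_trans (h1 y))// ler_wpM2l// lerD2l.
    by rewrite (le_trans (enorm_le_norm _))// ler_wpM2l.
  by rewrite mulrCA mulrC ler_wpM2r// lerDr.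
have uz N i : ucont_on T (z N i) by have [] := hz N i.
exact: (total_cost_cvg T0 cf hL hpsi0 (continuous_running_cost hCpsi hpsilip)
  psi_ae uz K0 rho0 mK num mt z_rho).
Qed.
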